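(* Let $R$ be a semi-local Noetherian domain all of whose residue fields (at maximal ideals) are infinite and of characteristic different from $2$. Let $S$ be a finite étale $R$-algebra (not necessarily a domain), and let $(V,q)$ be a quadratic space of rank $m$ over $R$. Let $N^S_R: S^*\to R^*$ be the norm map of $S/R$. Then $$N^S_R(D_q(S))\subset D_q(R).$$
   Context: Rings are commutative with $1$; $A^*$ denotes the group of units of $A$. A quadratic space $(V,q)$ over $R$ is a finitely generated projective $R$-module $V$ with a quadratic form $q:V\to R$ whose associated symmetric bilinear form is nonsingular, i.e. induces an isomorphism $V\to \mathrm{Hom}_R(V,R)$ (note that $2$ is invertible in $R$). $(V_S,q_S)$ denotes the base change of $(V,q)$ to $S$: $V_S=V\otimes_R S$, $q_S=q\otimes_R S$. $D_q(R)\subset R^*$ is the subgroup generated by the set of units of $R$ of the form $q(v)$ with $v\in V$; $D_q(S)\subset S^*$ is the subgroup generated by the set of units of $S$ of the form $q_S(v)$ with $v\in V_S$. For $s\in S^*$, $N^S_R(s)$ is the determinant of the $R$-linear endomorphism of $S$ given by multiplication by $s$. *)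

(* Defs.v *)
From HB Require Import structures.
From mathcomp Require Import all_boot all_order all_algebra.
From mathcomp Require Import generic_quotient ring_quotient fraction.
From mathcomp Require Import boolp classical_sets cardinality.

Set Implicit Arguments.
Unset Strict Implicit.
Unset Printing Implicit Defensive.

Import GRing.Theory.

Local Open Scope ring_scope.
Local Open Scope classical_set_scope.
Local Open Scope quotient_scope.

(* An R-algebra is given by its structure morphism iota : R -> S. Rings are
   [comPzRingType]s rather than [comNzRingType]s so that the zero algebra is
   allowed. [restrict iota] is S seen as an R-module. *)
Definition restrict (R S : comPzRingType) (iota : {rmorphism R -> S}) : Type :=
  S.

Section Restrict.
Variables (R S : comPzRingType) (iota : {rmorphism R -> S}).

HB.instance Definition _ := GRing.Zmodule.on (restrict iota).

Let scale (a : R) (s : restrict iota) : restrict iota := iota a * (s : S).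

Let scaleA a b s : scale a (scale b s) = scale (a * b) s.
Proof. by rewrite /scale rmorphM mulrA. Qed.

Let scale1 : left_id 1 scale.
Proof. by move=> s; rewrite /scale rmorph1 mul1r. Qed.

Let scaleDr : right_distributive scale +%R.
Proof. by move=> a s t; rewrite /scale mulrDr. Qed.

Let scaleDl s : {morph scale^~ s : a b / a + b}.
Proof. by move=> a b; rewrite /scale rmorphD mulrDl. Qed.

HB.instance Definition _ := GRing.Zmodule_isLmodule.Build R (restrict iota)
  scaleA scale1 scaleDr scaleDl.
End Restrict.

(* The base change V_S = V (x)_R S. The list [:: (v1, s1); ...; (vn, sn)]
   stands for v1 (x) s1 + ... + vn (x) sn, and [tensor_rel] is the congruence
   generated by the defining relations of the tensor product. *)
Section BaseChange.
Variables (R S : comPzRingType) (iota : {rmorphism R -> S}) (V : lmodType R).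

Inductive tensor_rel : seq (V * S) -> seq (V * S) -> Prop :=
| tensor_refl t : tensor_rel t t
| tensor_sym t u : tensor_rel t u -> tensor_rel u t
| tensor_trans t u w : tensor_rel t u -> tensor_rel u w -> tensor_rel t w
| tensor_cat t t' u u' :
    tensor_rel t t' -> tensor_rel u u' -> tensor_rel (t ++ u) (t' ++ u')
| tensor_catC t u : tensor_rel (t ++ u) (u ++ t)
| tensor0l s : tensor_rel [:: (0, s)] [::]
| tensorDl v w s : tensor_rel [:: (v + w, s)] [:: (v, s); (w, s)]
| tensorDr v s r : tensor_rel [:: (v, s + r)] [:: (v, s); (v, r)]
| tensorZ a v s : tensor_rel [:: (a *: v, s)] [:: (v, iota a * s)].

Definition tensor_relb (t u : seq (V * S)) : bool := `[< tensor_rel t u >].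

Let tensor_relb_refl : reflexive tensor_relb.
Proof. by move=> t; apply/asboolP; exact: tensor_refl. Qed.

Let tensor_relb_sym : symmetric tensor_relb.
Proof. by move=> t u; apply/asboolP/asboolP; exact: tensor_sym. Qed.

Let tensor_relb_trans : transitive tensor_relb.
Proof.
move=> t u w /asboolP ut /asboolP tw; apply/asboolP; exact: tensor_trans tw.
Qed.

Canonical tensor_equiv :=
  EquivRel tensor_relb tensor_relb_refl tensor_relb_sym tensor_relb_trans.

Definition base_change : Type := {eq_quot tensor_equiv}.
HB.instance Definition _ := Choice.on base_change.
HB.instance Definition _ := EqQuotient.on base_change.

Definition tensor_sum (t : seq (V * S)) : base_change := \pi_base_change t.

Definition tens (v : V) (s : S) : base_change := tensor_sum [:: (v, s)].

Lemma tensor_sumP t u : tensor_rel t u <-> tensor_sum t = tensor_sum u.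
Proof.
by split=> [tu|/eqmodP/asboolP//]; apply/eqmodP/asboolP.
Qed.

Lemma repr_tensor_sum t : tensor_rel (repr (tensor_sum t)) t.
Proof. by apply/tensor_sumP; rewrite /tensor_sum reprK. Qed.

Lemma tensor_sum_ind (P : base_change -> Prop) :
  (forall t, P (tensor_sum t)) -> forall x, P x.
Proof. by move=> Pt x; rewrite -(reprK x); exact: Pt. Qed.

Let oppt (t : seq (V * S)) := [seq (- p.1, p.2) | p <- t].
Let scalet (c : S) (t : seq (V * S)) := [seq (p.1, c * p.2) | p <- t].

Let add (x y : base_change) := tensor_sum (repr x ++ repr y).
Let opp (x : base_change) := tensor_sum (oppt (repr x)).
Let scale (c : S) (x : base_change) := tensor_sum (scalet c (repr x)).

Let addE t u : add (tensor_sum t) (tensor_sum u) = tensor_sum (t ++ u).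
Proof.
by apply/tensor_sumP; apply: tensor_cat; exact: repr_tensor_sum.
Qed.

Let oppt_rel t u : tensor_rel t u -> tensor_rel (oppt t) (oppt u).
Proof.
elim=> {t u} //=.
- by move=> t; exact: tensor_refl.
- by move=> t u _; exact: tensor_sym.
- by move=> t u w _ tu _; exact: tensor_trans.
- by move=> t t' u u' _ tt' _ uu'; rewrite /oppt !map_cat; exact: tensor_cat.
- by move=> t u; rewrite /oppt !map_cat; exact: tensor_catC.
- by move=> s; rewrite oppr0; exact: tensor0l.
- by move=> v w s; rewrite opprD; exact: tensorDl.
- by move=> v s r; exact: tensorDr.
- by move=> a v s; rewrite -scalerN; exact: tensorZ.
Qed.

Let scalet_rel c t u : tensor_rel t u -> tensor_rel (scalet c t) (scalet c u).
Proof.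
elim=> {t u} //=.
- by move=> t; exact: tensor_refl.
- by move=> t u _; exact: tensor_sym.
- by move=> t u w _ tu _; exact: tensor_trans.
- by move=> t t' u u' _ tt' _ uu'; rewrite /scalet !map_cat; exact: tensor_cat.
- by move=> t u; rewrite /scalet !map_cat; exact: tensor_catC.
- by move=> s; exact: tensor0l.
- by move=> v w s; exact: tensorDl.
- by move=> v s r; rewrite mulrDr; exact: tensorDr.
- by move=> a v s; rewrite mulrCA; exact: tensorZ.
Qed.

Let oppE t : opp (tensor_sum t) = tensor_sum (oppt t).
Proof. by apply/tensor_sumP; apply: oppt_rel; exact: repr_tensor_sum. Qed.

Let scaleE c t : scale c (tensor_sum t) = tensor_sum (scalet c t).
Proof. by apply/tensor_sumP; apply: scalet_rel; exact: repr_tensor_sum. Qed.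

Let addA : associative add.
Proof.
elim/tensor_sum_ind=> t; elim/tensor_sum_ind=> u; elim/tensor_sum_ind=> w.
by rewrite !addE catA.
Qed.

Let addC : commutative add.
Proof.
elim/tensor_sum_ind=> t; elim/tensor_sum_ind=> u.
by rewrite !addE; apply/tensor_sumP; exact: tensor_catC.
Qed.

Let add0 : left_id (tensor_sum [::]) add.
Proof. by elim/tensor_sum_ind=> t; rewrite addE. Qed.

Let addN : left_inverse (tensor_sum [::]) opp add.
Proof.
elim/tensor_sum_ind=> t; rewrite oppE addE; apply/tensor_sumP.
elim: t => [|[v s] t IH]; first exact: tensor_refl.
have h : tensor_rel (oppt t ++ [:: (- v, s); (v, s)] ++ t) (oppt t ++ t).
  apply: tensor_cat; first exact: tensor_refl.
  rewrite -{2}[t]cat0s; apply: tensor_cat; last exact: tensor_refl.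
  apply: tensor_trans (tensor0l s).
  by apply: tensor_sym; rewrite -(addNr v); exact: tensorDl.
apply: tensor_trans IH; apply: tensor_trans h.
rewrite /= -cat1s catA -[(v, s) :: t]cat1s -[(- v, s) :: (v, s) :: t]cat1s.
rewrite -[(v, s) :: t in X in tensor_rel _ X]cat1s !catA.
by do 2!(apply: tensor_cat; last exact: tensor_refl); exact: tensor_catC.
Qed.

HB.instance Definition _ :=
  GRing.isZmodule.Build base_change addA addC add0 addN.

Lemma tensor_sum_cat t u : tensor_sum (t ++ u) = tensor_sum t + tensor_sum u.
Proof. by rewrite -addE. Qed.

Let scaleA a b x : scale a (scale b x) = scale (a * b) x.
Proof.
elim/tensor_sum_ind: x => t; rewrite !scaleE /scalet -map_comp.
by congr tensor_sum; apply: eq_map => p /=; rewrite mulrA.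
Qed.

Let scale1 : left_id 1 scale.
Proof.
elim/tensor_sum_ind=> t; rewrite scaleE; congr tensor_sum.
by rewrite -[RHS]map_id; apply: eq_map => -[v s] /=; rewrite mul1r.
Qed.

Let scaleDr : right_distributive scale +%R.
Proof.
move=> c; elim/tensor_sum_ind=> t; elim/tensor_sum_ind=> u.
by rewrite -tensor_sum_cat !scaleE -tensor_sum_cat /scalet map_cat.
Qed.

Let scaleDl x : {morph scale^~ x : a b / a + b}.
Proof.
move=> a b; elim/tensor_sum_ind: x => t; rewrite !scaleE.
elim: t => [|[v s] t IH]; first by rewrite -tensor_sum_cat.
have pE c : scalet c ((v, s) :: t) = [:: (v, c * s)] ++ scalet c t by [].
rewrite !pE !tensor_sum_cat IH addrACA; congr (_ + _).
by rewrite -tensor_sum_cat; apply/tensor_sumP; rewrite mulrDl; exact: tensorDr.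
Qed.

HB.instance Definition _ := GRing.Zmodule_isLmodule.Build S base_change
  scaleA scale1 scaleDr scaleDl.

Lemma tensor_sum_scale c t :
  c *: tensor_sum t = tensor_sum [seq (p.1, c * p.2) | p <- t].
Proof. exact: scaleE. Qed.

Lemma tensE v s : tens v s = s *: tens v 1.
Proof. by rewrite tensor_sum_scale /= mulr1. Qed.

Lemma tensor_sumE t : tensor_sum t = \sum_(p <- t) tens p.1 p.2.
Proof.
elim: t => [|[v s] t IH]; first by rewrite big_nil.
by rewrite big_cons -IH -tensor_sum_cat.
Qed.

End BaseChange.

Definition base_change_map (R S : comPzRingType) (iota : {rmorphism R -> S})
    (M N : lmodType R) (f : M -> N) (x : base_change iota M) :
    base_change iota N :=
  tensor_sum iota [seq (f p.1, p.2) | p <- repr x].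

Lemma base_change_mapE (R S : comPzRingType) (iota : {rmorphism R -> S})
    (M N : lmodType R) (f : {linear M -> N}) (t : seq (M * S)) :
  base_change_map f (tensor_sum iota t) =
  tensor_sum iota [seq (f p.1, p.2) | p <- t].
Proof.
rewrite /base_change_map; apply/tensor_sumP.
move: (repr _) (repr_tensor_sum iota t) => u; elim=> {t u} //=.
- by move=> t; exact: tensor_refl.
- by move=> t u _; exact: tensor_sym.
- by move=> t u w _ tu _; exact: tensor_trans.
- by move=> t t' u u' _ tt' _ uu'; rewrite !map_cat; exact: tensor_cat.
- by move=> t u; rewrite !map_cat; exact: tensor_catC.
- by move=> s; rewrite raddf0; exact: tensor0l.
- by move=> v w s; rewrite raddfD; exact: tensorDl.
- by move=> v s r; exact: tensorDr.
- by move=> a v s; rewrite linearZ; exact: tensorZ.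
Qed.

Section Modules.
Variables (R : comPzRingType).

Definition finitely_generated (M : lmodType R) : Prop :=
  exists (n : nat) (e : 'I_n -> M),
    forall x, exists c : 'I_n -> R, x = \sum_i c i *: e i.

Definition projective (P : lmodType R) : Prop :=
  forall (M N : lmodType R) (g : {linear M -> N}) (f : {linear P -> N}),
    (forall y, exists x, g x = y) ->
    exists h : {linear P -> M}, forall x, g (h x) = f x.

Definition basis (M : lmodType R) (n : nat) (e : 'I_n -> M) : Prop :=
  forall x, exists! c : 'rV[R]_n, x = \sum_i c 0 i *: e i.

(* The determinant of an endomorphism f of a finitely generated projective
   module M. Generators e and coordinate forms phi such that
   x = \sum_i phi_i(x) e_i exhibit M as a direct summand of R^n; the matrix
   below is that of f on M extended by the identity on the complement, and its
   determinant does not depend on the choice of e and phi. *)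
Definition is_det (M : lmodType R) (f : M -> M) (d : R) : Prop :=
  exists (n : nat) (e : 'I_n -> M) (phi : 'I_n -> {scalar M}),
    (forall x, x = \sum_i phi i x *: e i) /\
    d = \det (1%:M + \matrix_(i, j) phi j (f (e i) - e i)).

Definition endo_det (M : lmodType R) (f : M -> M) : R := xget 0 (is_det f).

End Modules.

Definition norm (R S : comPzRingType) (iota : {rmorphism R -> S}) (s : S) : R :=
  endo_det (fun x : restrict iota => (s * (x : S) : restrict iota)).

Section Etale.
Variables (R S : comPzRingType) (iota : {rmorphism R -> S}).

Definition flat : Prop :=
  forall (M N : lmodType R) (f : {linear M -> N}),
    injective f -> injective (base_change_map f : base_change iota M -> _).

Definition derivation (M : lmodType S) (D : S -> M) : Prop :=
  [/\ forall x y, D (x + y) = D x + D y,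
      forall x y, D (x * y) = x *: D y + y *: D x &
      forall a, D (iota a) = 0].

(* The module of Kaehler differentials of S over R, which represents
   M |-> Der_R(S, M), is zero. *)
Definition unramified : Prop :=
  forall (M : lmodType S) (D : S -> M), derivation D -> forall x, D x = 0.

(* Finite presentation is not repeated: over a Noetherian ring R it follows
   from finiteness. *)
Definition finite_etale : Prop :=
  [/\ finitely_generated (restrict iota), flat & unramified].

End Etale.

(* The library's [idealr R] is the type of proper ideals of R. *)
Section Ideals.
Variable R : comNzRingType.

Definition maximal_ideal (I : idealr R) : Prop :=
  forall J : idealr R, {subset I <= J} -> {subset J <= I}.

Definition semilocal : Prop :=
  exists (n : nat) (I : 'I_n -> idealr R),
    forall J : idealr R, maximal_ideal J -> exists i, J =i I i.

(* The ideal R itself is generated by 1. *)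
Definition noetherian : Prop :=
  forall I : idealr R, exists (n : nat) (g : 'I_n -> R),
    (forall i, g i \in I) /\
    (forall x, x \in I -> exists c : 'I_n -> R, x = \sum_i c i * g i).

End Ideals.

Definition polar (R : comPzRingType) (V : lmodType R) (q : V -> R) (v w : V) :=
  q (v + w) - q v - q w.

Section QuadraticForms.
Variables (R : comPzRingType) (V : lmodType R) (q : V -> R).

(* As [polar q] is symmetric, linearity in one argument is bilinearity. *)
Definition quadratic_form : Prop :=
  (forall a v, q (a *: v) = a ^+ 2 * q v) /\
  (forall v a u w, polar q v (a *: u + w) = a * polar q v u + polar q v w).

Definition nonsingular : Prop :=
  forall phi : {scalar V}, exists! v, forall w, polar q v w = phi w.

Definition quadratic_space : Prop :=
  [/\ finitely_generated V, projective V, quadratic_form & nonsingular].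

Definition is_unit (a : R) : Prop := exists b, a * b = 1.

Definition unit_subgroup (H : set R) : Prop :=
  [/\ forall a, H a -> is_unit a, H 1,
      forall a b, H a -> H b -> H (a * b) &
      forall a b, H a -> a * b = 1 -> H b].

Definition Dq : set R :=
  smallest unit_subgroup [set a | is_unit a /\ exists v, q v = a].

End QuadraticForms.

(* The rank of a finitely generated projective module over a domain R with
   field of fractions K is constant, equal to dim_K (V (x)_R K). *)
Definition has_rank (R : idomainType) (V : lmodType R) (m : nat) : Prop :=
  exists e : 'I_m -> base_change (@tofrac R) V, basis e.

(* q_S is given on \sum_i v_i (x) s_i by
   \sum_i s_i ^ 2 q(v_i) + \sum_(i < j) s_i s_j b(v_i, v_j), where b = polar q;
   [base_change_formE] states that this value does not depend on the chosen
   representation when q is a quadratic form. *)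
Section BaseChangeForm.
Variables (R S : comPzRingType) (iota : {rmorphism R -> S}).
Variables (V : lmodType R) (q : V -> R).

Fixpoint tensor_form (t : seq (V * S)) : S :=
  if t is (v, s) :: u then
    s ^+ 2 * iota (q v) + \sum_(p <- u) s * p.2 * iota (polar q v p.1)
    + tensor_form u
  else 0.

Definition base_change_form (x : base_change iota V) : S :=
  tensor_form (repr x).

Hypothesis qP : quadratic_form q.

Let polarC v w : polar q v w = polar q w v.
Proof. by rewrite /polar [w + v]addrC addrAC. Qed.

Let polarDr v u w : polar q v (u + w) = polar q v u + polar q v w.
Proof. by rewrite -[u]scale1r qP.2 mul1r !scale1r. Qed.

Let polar0r v : polar q v 0 = 0.
Proof. by apply: (addIr (polar q v 0)); rewrite -polarDr !add0r. Qed.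

Let polarZr v a w : polar q v (a *: w) = a * polar q v w.
Proof. by rewrite -[a *: w]addr0 qP.2 polar0r addr0. Qed.

Let form0 : q 0 = 0.
Proof. by rewrite -(scale0r 0) qP.1 expr0n mul0r. Qed.

Let formD v w : q (v + w) = q v + q w + polar q v w.
Proof. by rewrite /polar -(addrA (q (v + w))) -opprD [RHS]addrC subrK. Qed.

Let polarvv v : polar q v v = q v + q v.
Proof.
rewrite /polar -mulr2n -scaler_nat qP.1 -natrX mulr_natl.
by rewrite -addrA -opprD -mulr2n -mulrnBr // mulr2n.
Qed.

Let pair (t u : seq (V * S)) : S :=
  \sum_(p <- t) \sum_(r <- u) p.2 * r.2 * iota (polar q p.1 r.1).

Let pairC t u : pair t u = pair u t.
Proof.
rewrite /pair exchange_big; apply: eq_bigr => p _; apply: eq_bigr => r _.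
by rewrite polarC [p.2 * _]mulrC.
Qed.

Let pair_catr t u w : pair t (u ++ w) = pair t u + pair t w.
Proof.
by rewrite /pair -big_split; apply: eq_bigr => p _; rewrite big_cat.
Qed.

Let pair_relr w t u : tensor_rel iota t u -> pair w t = pair w u.
Proof.
elim=> {t u} //=.
- by move=> t u w' _ -> _ ->.
- by move=> t t' u u' _ tt' _ uu'; rewrite !pair_catr tt' uu'.
- by move=> t u; rewrite !pair_catr addrC.
- move=> s; rewrite /pair; apply: eq_bigr => p _.
  by rewrite big_seq1 big_nil polar0r rmorph0 mulr0.
- move=> v v' s; rewrite /pair; apply: eq_bigr => p _.
  by rewrite !(big_cons, big_nil) !addr0 polarDr rmorphD mulrDr.
- move=> v s r; rewrite /pair; apply: eq_bigr => p _.
  by rewrite !(big_cons, big_nil) !addr0 mulrDr mulrDl.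
- move=> a v s; rewrite /pair; apply: eq_bigr => p _.
  by rewrite !big_seq1 polarZr rmorphM !mulrA [_ * iota a]mulrAC.
Qed.

Let tensor_form_cat t u :
  tensor_form (t ++ u) = tensor_form t + tensor_form u + pair t u.
Proof.
elim: t => [|[v s] t IH] /=; first by rewrite /pair big_nil addr0 add0r.
rewrite IH big_cat /= /pair big_cons /=.
set a := s ^+ 2 * _; set b := \sum_(p <- t) _; set c := \sum_(p <- u) _.
set d := \sum_(p <- t) _; rewrite -!addrA; congr (_ + (_ + _)).
by rewrite [LHS]addrCA; congr (_ + _); exact: addrCA.
Qed.

Lemma tensor_form_rel t u :
  tensor_rel iota t u -> tensor_form t = tensor_form u.
Proof.
elim=> {t u} //=.
- by move=> t u w _ -> _ ->.
- move=> t t' u u' tt' ett' uu' euu'; rewrite !tensor_form_cat ett' euu'.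
  by rewrite (pair_relr _ uu') pairC (pair_relr _ tt') pairC.
- by move=> t u; rewrite !tensor_form_cat pairC [tensor_form t + _]addrC.
- by move=> s; rewrite big_nil form0 rmorph0 mulr0 !addr0.
- move=> v w s; rewrite !big_seq1 !big_nil !addr0 formD !rmorphD !mulrDr.
  by rewrite addrAC.
- move=> v s r; rewrite !big_seq1 !big_nil !addr0 polarvv rmorphD sqrrD.
  by rewrite !mulrDl mulrDr.
- by move=> a v s; rewrite !big_nil !addr0 qP.1 rmorphM rmorphXn exprMn mulrA
    [s ^+ 2 * _]mulrC.
Qed.

Lemma base_change_formE t :
  base_change_form (tensor_sum iota t) = tensor_form t.
Proof. exact/tensor_form_rel/repr_tensor_sum. Qed.

Lemma base_change_form_tens v : base_change_form (tens iota v 1) = iota (q v).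
Proof. by rewrite base_change_formE /= big_nil !addr0 expr1n mul1r. Qed.

Lemma base_change_form_quadratic : quadratic_form base_change_form.
Proof.
have polE t u : polar base_change_form (tensor_sum iota t) (tensor_sum iota u)
    = pair t u.
  rewrite /polar -tensor_sum_cat !base_change_formE tensor_form_cat.
  by rewrite -addrA -opprD addrAC subrr add0r.
split=> [c|].
  elim/tensor_sum_ind=> t; rewrite tensor_sum_scale !base_change_formE.
  elim: t => [|[v s] t IH] /=; first by rewrite mulr0.
  rewrite IH !mulrDr; congr (_ + _ + _).
    by rewrite [RHS]mulrA exprMn.
  rewrite big_map mulr_sumr; apply: eq_bigr => p _ /=.
  by rewrite !mulrA expr2 [c * s * c]mulrAC.
elim/tensor_sum_ind=> t c; elim/tensor_sum_ind=> u; elim/tensor_sum_ind=> w.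
rewrite tensor_sum_scale -tensor_sum_cat !polE pair_catr; congr (_ + _).
rewrite /pair mulr_sumr; apply: eq_bigr => p _.
rewrite big_map mulr_sumr; apply: eq_bigr => r _ /=.
by rewrite !mulrA [c * _]mulrC.
Qed.

End BaseChangeForm.

Arguments base_change_form {R S} iota {V} q x.

(* Main.v *)
From HB Require Import structures.
Require Import Defs.
From mathcomp Require Import all_boot all_order all_algebra.
From mathcomp Require Import ring_quotient.
From mathcomp Require Import ring zify.
From mathcomp Require Import boolp classical_sets cardinality.

(** Norm principle for values of quadratic forms, proved by an elementary
    descent.

    The norm is multiplicative, so it suffices to treat the norm of a unit
    [s = q_S(v)]. By [etale_generator] there is a unit [c] of [S] such that
    [th = c ^ 2 * s = q_S(c * v)] generates [S], and [S] is then [R[X]/(p)] with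
    [p] monic of some degree [n] and [th] the class of [X]. The norm of [th] is
    [N(c) ^ 2 * N(s)], and [N(c) ^ 2] is a quotient of two values of [q] as soon
    as [q] takes a unit value on [V]; this is the case if [n > 0]. The vector
    [c * v] lifts to a vector [w] of polynomials with [q(w) = X + h * p] in
    [R[X]], and the norm of [th] is [(-1) ^ n * p(0)]. The claim thus becomes a
    statement on polynomials over [R], [norm_principle_monogenic].

    It is proved by induction on [n]; the inductive step is [descent]. One may
    assume that [w] has degree less than [n]. Let [f] be a product of [n - 1]
    linear factors and [w'] the remainder of [f * w] modulo [p]. Then [q(w')] is
    congruent to [f ^ 2 * X] modulo [p] and has degree at most [2 * n - 2], so
    that [f ^ 2 * X - q(w') = p' * p] with [p'] monic of degree [n - 1]. Taking
    the value at 0 gives [p(0) * p'(0) = - q(w'(0))]. If [q(w')] takes unit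
    values at 0 and at the roots of [f], so does [p']; hence [q(w'(0))] and
    [p'(0)] are units, [f] is invertible modulo [p'], and [w' / f] shows that
    [X] is a value of [q] modulo [p'], to which the induction hypothesis
    applies.

    The roots of [f] are found over the residue fields, which are infinite
    ([choose_points]), and lifted by the Chinese remainder theorem. They exist
    unless the coefficients of [w] of positive degree span a totally isotropic
    space over some residue field; this is avoided by first replacing [w] with
    its image under a reflection ([reflect_tail]), which does not change [q(w)]
    modulo [p].

    As to [etale_generator], let [A] be the fiber of [S] over a residue field
    [k]. The derivations of [A] with values in a module vanish, which makes its
    trace form nondegenerate ([trace_nondegenerate]). Hence [A] is reduced over
    every extension of [k], and its multiplications are simultaneously
    diagonalizable over a splitting field. There one sees an invertible [c] such that [c ^ 2 * s] has pairwise
    distinct eigenvalues and so generates the algebra; as this amounts to the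
    nonvanishing of a polynomial function of [c], such a [c] also exists over
    the infinite field [k]. Nakayama's lemma lifts generators from the fibers to
    [S], and the equational criterion of flatness shows that the powers of [th]
    of exponent less than the largest fiber degree are linearly independent. *)

Set Implicit Arguments.
Unset Strict Implicit.
Unset Printing Implicit Defensive.

Import GRing.Theory.

Local Open Scope ring_scope.
Local Open Scope classical_set_scope.

(** * Residue fields *)

Section ResidueField.
Variables (R : comNzRingType) (I : idealr R).
Hypothesis Imax : maximal_ideal I.

(** The quotient by a maximal ideal. The proof of maximality is a parameter of
    the type, so that the field structure can be inferred from it. *)
Definition residue_field of maximal_ideal I : Type := {ideal_quot I}.
Local Notation K := (residue_field Imax).

HB.instance Definition _ := GRing.ComNzRing.on K.

Definition residue_map : R -> K := \pi_({ideal_quot I})%qT.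

Lemma residue_map_zmod_morphism : zmod_morphism residue_map.
Proof. by move=> x y; rewrite /residue_map raddfB. Qed.

Lemma residue_map_monoid_morphism : monoid_morphism residue_map.
Proof. by split=> [|x y]; rewrite /residue_map ?rmorph1 ?rmorphM. Qed.

HB.instance Definition _ :=
  GRing.isZmodMorphism.Build R K residue_map residue_map_zmod_morphism.
HB.instance Definition _ :=
  GRing.isMonoidMorphism.Build R K residue_map residue_map_monoid_morphism.

Lemma residue_map_surj (y : K) : exists x, residue_map x = y.
Proof. by exists (repr (y : {ideal_quot I})); rewrite /residue_map reprK. Qed.

Lemma residue_map_eq0 x : (residue_map x == 0) = (x \in I).
Proof.
rewrite -(rmorph0 residue_map) /residue_map -[x in RHS]subr0.
by rewrite Quotient.idealrBE.
Qed.

Let enlarge (x : R) : {pred R} := [pred y | `[< exists a, y - a * x \in I >]].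

(** The ideal generated by [I] and a representative of [y] contains 1, for
    otherwise it would be a proper ideal larger than [I]. *)
Lemma residue_field_inv (y : K) : y != 0 -> exists z, z * y = 1.
Proof.
have [x <-] := residue_map_surj y; rewrite residue_map_eq0 => xI.
have [[a ax]|nax] := pselect (exists a, 1 - a * x \in I).
  exists (residue_map a); rewrite -rmorphM; apply/esym/eqP.
  by rewrite -(rmorph1 residue_map) -subr_eq0 -rmorphB residue_map_eq0.
have JP z : reflect (exists a, z - a * x \in I) (z \in enlarge x).
  exact: asboolP.
have Jid : idealr_closed (enlarge x).
  split=> [||a u v /JP[b ub] /JP[c vc]].
  - by apply/JP; exists 0; rewrite mul0r subr0 rpred0.
  - by apply/JP.
  - apply/JP; exists (a * b + c).
    rewrite mulrDl opprD addrACA -mulrA -mulrBr.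
    by apply: rpredD => //; exact: idealMr.
pose J := HB.pack_for (idealr R) (enlarge x : R -> bool)
  (isIdealr.Build R (enlarge x) Jid).
have JI : {subset I <= J}.
  by move=> z zI; apply/JP; exists 0; rewrite mul0r subr0.
have /negP[] := xI; apply: (Imax (J := J) JI).
by apply/JP; exists 1; rewrite mul1r subrr rpred0.
Qed.

Let inv (y : K) : K :=
  if pselect (exists z, z * y = 1) is left e then projT1 (cid e) else 0.

Let mulVf (y : K) : y != 0 -> inv y * y = 1.
Proof.
move=> /residue_field_inv yV; rewrite /inv.
by case: pselect => // e; case: (cid e).
Qed.

Let inv0 : inv 0 = 0.
Proof.
rewrite /inv; case: pselect => // e; case: (cid e) => z /= /eqP.
by rewrite mulr0 eq_sym oner_eq0.
Qed.

HB.instance Definition _ := GRing.ComNzRing_isField.Build K mulVf inv0.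
End ResidueField.

(** A finite family of residue fields of [R] that detects units and for which
    the Chinese remainder theorem holds: [res_idem j] is congruent to 1 in the
    [j]-th residue field and to 0 in the others. *)
Record residue_system (R : comUnitRingType) := ResidueSystem {
  res_num : nat;
  res_field : 'I_res_num -> fieldType;
  res_proj : forall j, {rmorphism R -> res_field j};
  res_surj : forall j (y : res_field j), exists x, res_proj j x = y;
  res_idem : 'I_res_num -> R;
  res_idemE : forall i j, res_proj i (res_idem j) = (i == j)%:R;
  res_unit : forall x, (forall j, res_proj j x != 0) -> x \is a GRing.unit
}.

Section ResidueSystem.
Variables (R : comUnitRingType) (X : residue_system R).
Local Notation pi := (@res_proj R X).

Lemma res_crt (y : 'I_(res_num X) -> R) :
  exists x, forall j, pi j x = pi j (y j).
Proof.
exists (\sum_j @res_idem R X j * y j) => j.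
rewrite rmorph_sum (bigD1 j) //= rmorphM res_idemE eqxx mul1r big1 ?addr0 //.
by move=> i ij; rewrite rmorphM res_idemE eq_sym (negPf ij) mul0r.
Qed.

Lemma res_crt_pick (P : forall j, @res_field R X j -> Prop) :
  (forall j, exists y, P j y) -> exists x, forall j, P j (pi j x).
Proof.
move=> PX; have /choice[y yP] : forall j, exists x, P j (pi j x).
  by move=> j; have [z Pz] := PX j; have [x xz] := res_surj z; exists x; rewrite xz.
by have [x xP] := res_crt y; exists x => j; rewrite xP.
Qed.

Lemma res_unitP x : x \is a GRing.unit <-> forall j, pi j x != 0.
Proof.
split=> [xU j|]; last exact: res_unit.
by have := rmorph_unit (pi j) xU; rewrite unitfE.
Qed.

(** Nakayama's lemma: if modulo [N] every generator [x i] is, for each [j], a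
    combination of the generators with coefficients in the kernel of [pi j],
    then [N] contains the generators. By Cramer's rule, as the relations can be
    glued to a single matrix that vanishes in every residue field. *)
Lemma nakayama (M : lmodType R) (N : M -> Prop) (n : nat) (x : 'I_n -> M) :
  N 0 -> (forall u v, N u -> N v -> N (u + v)) ->
  (forall a u, N u -> N (a *: u)) ->
  (forall j i, exists mu : 'I_n -> R,
     (forall l, pi j (mu l) = 0) /\ N (x i - \sum_l mu l *: x l)) ->
  forall i, N (x i).
Proof.
move=> N0 ND NZ loc.
have Nsum (I : finType) (F : I -> M) : (forall i, N (F i)) -> N (\sum_i F i).
  by move=> NF; apply: big_ind.
have {loc} /choice[mu muP] : forall ji : 'I_(res_num X) * 'I_n,
    exists mu : 'I_n -> R, (forall l, pi ji.1 (mu l) = 0) /\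
      N (x ji.2 - \sum_l mu l *: x l) by move=> [j i]; exact: loc.
pose e := @res_idem R X.
pose A := \matrix_(i, l) ((1 - \sum_j e j) *+ (i == l)
                          + \sum_j e j * mu (j, i) l).
have NA i : N (x i - \sum_l A i l *: x l).
  have -> : x i - \sum_l A i l *: x l =
      \sum_j e j *: (x i - \sum_l mu (j, i) l *: x l).
    have -> : \sum_l A i l *: x l =
        (1 - \sum_j e j) *: x i + \sum_l (\sum_j e j * mu (j, i) l) *: x l.
      under eq_bigr => l _ do rewrite mxE scalerDl.
      rewrite big_split /=; congr (_ + _); rewrite (bigD1 i) //= eqxx.
      rewrite [X in _ + X]big1 ?addr0 // => l.
      by rewrite eq_sym => /negPf->; rewrite scale0r.
    have -> : \sum_j e j *: (x i - \sum_l mu (j, i) l *: x l) =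
        (\sum_j e j) *: x i - \sum_l (\sum_j e j * mu (j, i) l) *: x l.
      under eq_bigr => j _ do rewrite scalerBr scaler_sumr.
      rewrite sumrB -scaler_suml exchange_big /=; congr (_ - _).
      apply: eq_bigr => l _; rewrite scaler_suml.
      by apply: eq_bigr => j _; rewrite scalerA.
    by rewrite scalerBl scale1r opprD opprB addrA [x i + _]addrC subrK.
  by apply: Nsum => j; apply: NZ; exact: (muP (j, i)).2.
have detU : \det (1%:M - A) \is a GRing.unit.
  apply/res_unitP => j; rewrite -det_map_mx.
  rewrite (_ : map_mx _ _ = 1%:M) ?det1 ?oner_neq0 //.
  rewrite map_mxB map_mx1 (_ : map_mx _ A = 0) ?subr0 //.
  apply/matrixP=> i l; rewrite !mxE.
  rewrite [LHS](rmorphD (pi j)) rmorphMn rmorphB rmorph1.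
  rewrite !rmorph_sum (bigD1 j) //= res_idemE eqxx big1 ?addr0 ?subrr ?mul0rn.
    rewrite add0r (bigD1 j) //= rmorphM (muP (j, i)).1 mulr0 add0r.
    by rewrite big1 // => m mj; rewrite rmorphM res_idemE eq_sym (negPf mj) mul0r.
  by move=> m mj; rewrite res_idemE eq_sym (negPf mj).
move=> i; rewrite -[x i]scale1r -(mulVr detU) -scalerA; apply: (NZ).
have -> : \det (1%:M - A) *: x i =
    \sum_l (\adj (1%:M - A)) i l *: (x l - \sum_m A l m *: x m).
  have E l : x l - \sum_m A l m *: x m = \sum_m (1%:M - A) l m *: x m.
    rewrite [in RHS](eq_bigr (fun m => (l == m)%:R *: x m - A l m *: x m)).
      rewrite sumrB; congr (_ - _); rewrite (bigD1 l) //= eqxx scale1r big1 ?addr0 // => m.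
      by rewrite eq_sym => /negPf->; rewrite scale0r.
    by move=> m _; rewrite !mxE scalerBl.
  rewrite (eq_bigr (fun l => \sum_m (\adj (1%:M - A) i l * (1%:M - A) l m) *: x m)).
    rewrite exchange_big /= (eq_bigr (fun m => (\det (1%:M - A))%:M i m *: x m)).
      rewrite (bigD1 i) //= [_%:M i i]mxE eqxx mulr1n big1 ?addr0 // => m mi.
      by rewrite [_%:M i m]mxE eq_sym (negPf mi) scale0r.
    by move=> m _; rewrite -scaler_suml -mul_adj_mx mxE.
  by move=> l _; rewrite E scaler_sumr; apply: eq_bigr => m _; rewrite scalerA.
by apply: Nsum => l; exact: NZ.
Qed.
End ResidueSystem.

Section Semilocal.
Variable R : comUnitRingType.

Lemma nonunit_maximal_ideal (x : R) :
  x \isn't a GRing.unit -> exists2 I : idealr R, maximal_ideal I & x \in I.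
Proof.
move=> xU.
(* The empty set is admitted so that the empty chain has an upper bound. *)
pose P : set (set R) := fun A => [/\ forall a u v, A u -> A v -> A (a * u + v),
  ~ A 1 & forall u, A u -> A x].
have [|A [[Acl A1 Ax] Amax]] := @Zorn_bigcup R P.
  move=> F FP Ftot; split.
  - move=> a u v [B FB Bu] [C FC Cv].
    have [BC|CB] := Ftot _ _ FB FC.
      by exists C => //; have [h _ _] := FP _ FC; apply: h => //; exact: BC.
    by exists B => //; have [h _ _] := FP _ FB; apply: h => //; exact: CB.
  - by move=> [B FB B1]; have [_ h _] := FP _ FB; apply: h.
  - by move=> u [B FB Bu]; exists B => //; have [_ _ h] := FP _ FB; exact: h Bu.
have Ax' : A x.
  apply: contrapT => nAx.
  have A0 u : ~ A u by move=> /Ax.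
  apply: (Amax [set y | exists a, y = a * x]).
    split; first by move=> y /A0.
    by move=> sub; apply: (A0 x); apply: sub; exists 1; rewrite mul1r.
  split.
  - move=> a u v [b ->] [c ->]; exists (a * b + c).
    by rewrite mulrDl mulrA.
  - move=> [a /esym ax]; move/negP: xU; apply; apply/unitrPr.
    by exists a; rewrite mulrC.
  - by move=> u _; exists 1; rewrite mul1r.
have A0 : A 0 by rewrite -(addNr x) -mulN1r; exact: Acl.
pose S : {pred R} := [pred y | `[< A y >]].
have SP z : reflect (A z) (z \in S) by exact: asboolP.
have Sid : idealr_closed S.
  split; [exact/SP|exact/SP|move=> a u v /SP Au /SP Av].
  by apply/SP; exact: Acl.
pose I := HB.pack_for (idealr R) (S : R -> bool) (isIdealr.Build R S Sid).
exists I; last exact/SP.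
move=> J IJ y yJ; apply/SP; apply: contrapT => nAy.
apply: (Amax [set z | z \in J]).
  split; first by move=> z Az; apply: IJ; exact/SP.
  by move=> /(_ y yJ).
split.
- by move=> a u v uJ vJ; apply: rpredD => //; exact: idealMr.
- by apply/negP; rewrite idealr1.
- by move=> u _; apply: IJ; exact/SP.
Qed.

(** The residue fields of a semilocal ring form a residue system. The property
    [P] carries the hypotheses on them over to the system. *)
Lemma semilocal_residue_system (P : fieldType -> Prop) :
  semilocal R ->
  (forall (I : idealr R) (Imax : maximal_ideal I), P (residue_field Imax)) ->
  exists X : residue_system R, forall j, P (@res_field R X j).
Proof.
move=> [n [I semi]] PI.
(* A maximal ideal may be listed several times; its first occurrence counts. *)
pose first (i : 'I_n) := [forall i' : 'I_n, (i' < i)%N ==> ~~ `[< I i' =i I i >]].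
pose T := [set i | `[< maximal_ideal (I i) >] && first i]%SET.
have Tmax (j : 'I_#|T|) : maximal_ideal (I (enum_val j)).
  by have := enum_valP j; rewrite inE => /andP[/asboolP].
have Tsub (j j' : 'I_#|T|) :
    {subset I (enum_val j') <= I (enum_val j)} -> j = j'.
  move=> sub; apply: enum_val_inj; apply: contrapT => ne.
  have eqI : I (enum_val j) =i I (enum_val j').
    by move=> z; apply/idP/idP; [exact: (Tmax j')|exact: sub].
  have := enum_valP j; have := enum_valP j'.
  rewrite !inE => /andP[_ /forallP f'] /andP[_ /forallP f].
  have := f (enum_val j'); have := f' (enum_val j).
  have -> : `[< I (enum_val j) =i I (enum_val j') >] by exact/asboolP.
  have -> : `[< I (enum_val j') =i I (enum_val j) >].
    by apply/asboolP => z; rewrite eqI.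
  rewrite !implybF -!leqNgt => le1 le2.
  by apply: ne; apply/val_inj/eqP; rewrite eqn_leq le1 le2.
pose pi j := @residue_map R _ (Tmax j).
have sep (jj : 'I_#|T| * 'I_#|T|) : exists y, jj.1 != jj.2 ->
    pi jj.1 y != 0 /\ pi jj.2 y = 0.
  case: jj => j j' /=; have [->|ne] := eqVneq j j'; first by exists 0.
  apply: contrapT => no; move/eqP: ne; apply; apply: Tsub => y yj'.
  apply: contrapT => /negP yj; apply: no; exists y => _.
  by rewrite /pi residue_map_eq0; split => //; apply/eqP; rewrite residue_map_eq0.
have /choice[y yP] := sep.
have piM i a b : pi i (a * b) = pi i a * pi i b by exact: rmorphM.
have pi_prod i (Q : pred 'I_#|T|) F :
  pi i (\prod_(j | Q j) F j) = \prod_(j | Q j) pi i (F j) by exact: rmorph_prod.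
have epsP j : exists e, forall i, pi i e = (i == j)%:R.
  pose e := \prod_(j' | j' != j) y (j, j').
  have ej : pi j e != 0.
    rewrite pi_prod; apply/prodf_neq0 => j' jj'.
    by have [] := yP (j, j'); rewrite /= 1?eq_sym.
  have [z zP] : exists z, pi j z = (pi j e)^-1 by exact: residue_map_surj.
  exists (z * e) => i.
  rewrite piM.
  have [->|ij] := eqVneq i j; first by rewrite zP mulVf.
  rewrite pi_prod (bigD1 i) //= [X in _ * (X * _)](yP (j, i) _).2 ?mul0r ?mulr0 //=.
  by rewrite eq_sym.
have /choice[eps epsE] := epsP.
have unitT x : (forall j, pi j x != 0) -> x \is a GRing.unit.
  move=> xP; apply: contrapT => /negP /nonunit_maximal_ideal[J Jmax xJ].
  have [i0 JI] := semi _ Jmax.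
  have : exists i : nat, `[< exists2 i' : 'I_n, i' = i :> nat & J =i I i' >].
    by exists i0; apply/asboolP; exists i0.
  case/ex_minnP => m /asboolP[i im JIi] mmin.
  have iT : i \in T.
    rewrite inE; apply/andP; split.
      apply/asboolP => J' IJ' z zJ'; rewrite -JIi.
      by apply: (Jmax J') zJ' => w wJ; apply: IJ'; rewrite -JIi.
    apply/forallP => i'; apply/implyP => lti'; apply/negP => /asboolP eqI.
    have : (m <= i')%N.
      by apply: mmin; apply/asboolP; exists i' => // z; rewrite JIi eqI.
    by rewrite -im leqNgt lti'.
  have := xP (enum_rank_in iT i).
  by rewrite residue_map_eq0 enum_rankK_in // -JIi xJ.
exists (@ResidueSystem R #|T| (fun j => residue_field (Tmax j))
  (fun j => @residue_map R _ (Tmax j)) (fun j => @residue_map_surj R _ (Tmax j))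
  eps (fun i j => epsE j i) unitT) => j /=.
exact: PI.
Qed.
End Semilocal.

(** * Bilinear forms on vectors of polynomials *)

Import Pdiv.Ring Pdiv.CommonRing Pdiv.RingMonic.

Section Form.
Variables (L : comNzRingType) (N : nat) (G : 'M[L]_N).

(** The bilinear form with Gram matrix [G]. *)
Definition gform (x y : 'rV[L]_N) : L := (x *m G *m y^T) 0 0.

Lemma gformDl x x' y : gform (x + x') y = gform x y + gform x' y.
Proof. by rewrite /gform !mulmxDl mxE. Qed.

Lemma gformDr x y y' : gform x (y + y') = gform x y + gform x y'.
Proof. by rewrite /gform linearD mulmxDr mxE. Qed.

Lemma gformZl a x y : gform (a *: x) y = a * gform x y.
Proof. by rewrite /gform -!scalemxAl mxE. Qed.

Lemma gformZr a x y : gform x (a *: y) = a * gform x y.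
Proof. by rewrite /gform linearZ -scalemxAr mxE. Qed.

Lemma gformBl x x' y : gform (x - x') y = gform x y - gform x' y.
Proof. by rewrite -scaleN1r gformDl gformZl mulN1r. Qed.

Lemma gformBr x y y' : gform x (y - y') = gform x y - gform x y'.
Proof. by rewrite -scaleN1r gformDr gformZr mulN1r. Qed.

Lemma gformC : G^T = G -> forall x y, gform x y = gform y x.
Proof.
move=> Gsym x y; rewrite /gform.
have -> : x *m G *m y^T = (y *m G *m x^T)^T.
  by rewrite !trmx_mul trmxK Gsym mulmxA.
by rewrite mxE.
Qed.
End Form.

Lemma gform_map (L L' : comNzRingType) (f : {rmorphism L -> L'}) N
    (G : 'M[L]_N) x y :
  f (gform G x y) = gform (map_mx f G) (map_mx f x) (map_mx f y).
Proof. by rewrite /gform map_trmx -!map_mxM [RHS]mxE. Qed.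

(** The extension of the bilinear form of Gram matrix [G] to vectors of
    polynomials. *)
Notation pform G := (gform (map_mx polyC G)).

Lemma pform_map (L L' : comNzRingType) (f : {rmorphism L -> L'}) N
    (G : 'M[L]_N) x y :
  map_poly f (pform G x y) =
  pform (map_mx f G) (map_mx (map_poly f) x) (map_mx (map_poly f) y).
Proof.
rewrite (gform_map (map_poly f)); congr (gform _ _ _).
by rewrite -!map_mx_comp; apply: eq_map_mx => a /=; rewrite map_polyC.
Qed.

Lemma pform_horner (L : comNzRingType) N (G : 'M[L]_N) x y a :
  (pform G x y).[a] =
  gform G (map_mx (horner_eval a) x) (map_mx (horner_eval a) y).
Proof.
rewrite -[LHS]/(horner_eval a _) (gform_map (horner_eval a)).
congr (gform _ _ _).
by apply/matrixP=> i j; rewrite !mxE; exact: hornerC.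
Qed.

(** The remainder of a vector of polynomials modulo [p]. *)
Definition vrem (L : nzRingType) N (p : {poly L}) (w : 'rV[{poly L}]_N) :=
  map_mx (fun f => rmodp f p) w.

(** The vector of coefficients of ['X^i] in a vector of polynomials. *)
Definition vcoef (L : nzRingType) N (i : nat) (w : 'rV[{poly L}]_N) : 'rV[L]_N :=
  map_mx (fun f : {poly L} => f`_i) w.

(** * Choice of the linear factors *)

Section InfiniteField.
Variable k : fieldType.
Hypothesis k_inf : forall s : seq k, exists x, x \notin s.

Lemma infinite_uniq (s : seq k) n :
  exists t : seq k, [/\ uniq t, size t = n & all (fun x => x \notin s) t].
Proof.
elim: n => [|n [t [ut st ts]]]; first by exists [::].
have [x] := k_inf (s ++ t); rewrite mem_cat negb_or => /andP[xs xt].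
by exists (x :: t); rewrite /= xt ut st xs ts.
Qed.

Lemma infinite_nonroot (f : {poly k}) : f != 0 -> exists x, f.[x] != 0.
Proof.
move=> f0; have [t [ut st _]] := infinite_uniq [::] (size f).
apply: contrapT => no; have /negP[] := f0.
apply/eqP/(roots_geq_poly_eq0 _ ut); last by rewrite st.
apply/allP => x _; rewrite /root; apply: contrapT => /negP fx.
by apply: no; exists x.
Qed.

Lemma infinite_poly0 (z f : {poly k}) : z != 0 ->
  (forall x, z.[x] != 0 -> f.[x] = 0) -> f = 0.
Proof.
move=> z0 fx; apply: contrapT => /eqP f0.
have [|x] := @infinite_nonroot (z * f); first by rewrite mulf_neq0.
by rewrite hornerM mulf_eq0 negb_or => /andP[/fx->]; rewrite eqxx.
Qed.

Hypothesis two : (2%:R : k) != 0.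

(** A symmetric bilinear form that does not vanish on the polynomials of
    degree at most [d] has a nonisotropic vector that is a product of [d]
    linear factors, with roots outside those of a given nonzero [z]. By
    induction on [d]: otherwise [B (('X - b) * f) (('X - b) * g)] vanishes for
    all but finitely many [b], and its coefficients as a polynomial in [b] give
    relations that make [B] vanish. *)
Lemma split_nonisotropic d (B : {poly k} -> {poly k} -> k) (z : {poly k}) :
  z != 0 ->
  (forall f f' g : {poly k}, B (f + f') g = B f g + B f' g) ->
  (forall a (f g : {poly k}), B (a *: f) g = a * B f g) ->
  (forall f g, B f g = B g f) ->
  (exists f g : {poly k}, [/\ (size f <= d.+1)%N, (size g <= d.+1)%N & B f g != 0]) ->
  exists s : seq k, [/\ size s = d, all (fun x => z.[x] != 0) s &
    B (\prod_(x <- s) ('X - x%:P)) (\prod_(x <- s) ('X - x%:P)) != 0].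
Proof.
move=> z0; elim: d B => [|d IH] B BD BZ BC.
  move=> [f [g [/size1_polyC fE /size1_polyC gE Bfg]]].
  exists [::]; split=> //; rewrite big_nil.
  apply: contra Bfg => /eqP B11.
  by rewrite fE gE -!alg_polyC BZ BC BZ B11 !mulr0.
move=> Bnz; apply: contrapT => no.
have BDr (f g g' : {poly k}) : B f (g + g') = B f g + B f g' by rewrite BC BD !(BC f).
have BZr a (f g : {poly k}) : B f (a *: g) = a * B f g by rewrite BC BZ (BC f).
have rel b (f g : {poly k}) : z.[b] != 0 -> (size f <= d.+1)%N -> (size g <= d.+1)%N ->
    B (('X - b%:P) * f) (('X - b%:P) * g) = 0.
  move=> bZ sf sg; apply: contrapT => /eqP Bb; apply: no.
  have [||||s [ss sZ Bs]] :=
    IH (fun f g : {poly k} => B (('X - b%:P) * f) (('X - b%:P) * g)).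
  - by move=> u u' v; rewrite mulrDr BD.
  - by move=> a u v; rewrite -scalerAr BZ.
  - by move=> u v; rewrite BC.
  - by exists f, g.
  by exists (b :: s); rewrite /= ss bZ sZ big_cons.
have coefs (f g : {poly k}) : (size f <= d.+1)%N -> (size g <= d.+1)%N ->
    [/\ B f g = 0, B ('X * f) ('X * g) = 0 &
        B ('X * f) g + B f ('X * g) = 0].
  move=> sf sg; pose h := (B ('X * f) ('X * g))%:P
    - (B ('X * f) g + B f ('X * g)) *: 'X + B f g *: 'X^2.
  have h0 : h = 0.
    apply: (infinite_poly0 z0) => b bZ.
    rewrite -(rel b f g bZ sf sg) /h !hornerE.
    rewrite !mulrBl !mul_polyC -!scaleNr !BD !BDr !BZ !BZr.
    by rewrite /=; ring.
  have hE i : h`_i = 0 by rewrite h0 coef0.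
  have := hE 0%N; have := hE 1%N; have := hE 2%N.
  rewrite /h !coefD !coefN !coefZ !coefC !coefX !coefXn /=.
  rewrite !mulr0 !mulr1 !subr0 !addr0 !add0r => -> /eqP.
  by rewrite oppr_eq0 => /eqP-> ->.
have s1 : (size (1%R : {poly k}) <= d.+1)%N by rewrite size_poly1.
have B1X (h : {poly k}) : (size h <= d.+1)%N -> B 1 ('X * h) = 0.
  move=> sh; have [d0|d0] := posnP d.
    have /size1_polyC-> : (size h <= 1)%N by rewrite -[1%N]/(0.+1) -d0.
    rewrite -alg_polyC -scalerAr BZr; apply/eqP; rewrite mulf_eq0; apply/orP.
    right; have [_ _] := coefs (1%R) (1%R) s1 s1.
    rewrite (BC _ 1) -mulr2n -mulr_natl => /eqP.
    by rewrite mulf_eq0 (negPf two).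
  have [_ _] := coefs (1%R) h s1 sh.
  have sX : (size ('X : {poly k}) <= d.+1)%N by rewrite size_polyX.
  have [Xh _ _] := coefs 'X h sX sh.
  by rewrite mulr1 Xh add0r.
case: Bnz => f [g [sf sg /eqP[]]].
have dec (u : {poly k}) : (size u <= d.+2)%N ->
    exists a (v : {poly k}), (size v <= d.+1)%N /\ u = a%:P + 'X * v.
  move=> su; exists (u`_0), (drop_poly 1 u); split.
    by rewrite size_drop_poly leq_subLR.
  rewrite -{1}[u](poly_take_drop 1) mulrC expr1; congr (_ + _).
  have /size1_polyC-> : (size (take_poly 1 u) <= 1)%N by exact: size_take_poly.
  by rewrite coef_take_poly.
have [a [u [su ->]]] := dec f sf; have [b [v [sv ->]]] := dec g sg.
have BP c (h : {poly k}) : B c%:P h = c * B 1 h.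
  by rewrite -BZ -mul_polyC mulr1.
rewrite BD !BDr (BP a b%:P) (BP a) (BC 1) (BP b 1) (BC ('X * u) b%:P) (BP b).
rewrite !B1X //.
have [-> _ _] := coefs (1%R) (1%R) s1 s1.
have [_ -> _] := coefs u v su sv.
by rewrite !mulr0 !addr0.
Qed.
End InfiniteField.

(** The coefficients of [g] are the values at [g] of the functionals that send
    [g] to the coefficient of highest degree of [f * g] modulo the monic [p],
    for [f] the quotients of [p] by the powers of ['X]. *)
Lemma lead_rmodp_drop (L : comNzRingType) (p g : {poly L}) n i :
  p \is monic -> size p = n.+2 -> (size g <= n.+1)%N -> (i <= n)%N ->
  (rmodp (drop_poly i.+1 p * g) p)`_n = g`_i.
Proof.
move=> pm sp sg lein.
set D := drop_poly i.+1 p.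
have sD : size D = (n.+1 - i)%N by rewrite size_drop_poly sp subSS.
have Dn : D`_(n - i) = 1.
  rewrite coef_drop_poly addnS subnK //.
  by move/monicP: pm; rewrite lead_coefE sp.
pose g2 := drop_poly i.+1 g; pose g1 := take_poly i g.
have gE : g = g2 * 'X^(i.+1) + g1 + g`_i *: 'X^i.
  rewrite -{1}[g](poly_take_drop i.+1) addrC -addrA; congr (_ + _).
  apply/polyP=> j; rewrite coefD coefZ !coef_take_poly coefXn ltnS.
  by case: ltngtP => [||->]; rewrite ?mulr0 ?addr0 ?mulr1 ?add0r.
have DgE : D * g = g2 * p + (D * g1 - take_poly i.+1 p * g2 + g`_i *: (D * 'X^i)).
  by rewrite {1}gE -{1}[p](poly_take_drop i.+1) -/D -!mul_polyC; ring.
have s1 : (size (D * g1)%R <= n)%N.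
  apply: leq_trans (size_polyMleq _ _) _; rewrite sD.
  by have := size_take_poly i g; rewrite -/g1; lia.
have s2 : (size (take_poly i.+1 p * g2)%R <= n)%N.
  apply: leq_trans (size_polyMleq _ _) _; rewrite size_drop_poly.
  by have := size_take_poly i.+1 p; lia.
have s3 : (size (g`_i *: (D * 'X^i))%R <= n.+1)%N.
  apply: leq_trans (size_scale_leq _ _) _.
  apply: leq_trans (size_polyMleq _ _) _; rewrite sD size_polyXn; lia.
rewrite DgE rmodpD // rmodp_mull // add0r rmodp_small; last first.
  rewrite sp ltnS; apply: leq_trans (size_polyD _ _) _; rewrite geq_max s3 andbT.
  apply: leq_trans (size_polyD _ _) _; rewrite size_polyN geq_max.
  by rewrite (leq_trans s1) // (leq_trans s2).
rewrite !coefD coefN (nth_default _ s1) (nth_default _ s2) subr0 add0r coefZ.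
by rewrite coefMXn ltnNge lein /= Dn mulr1.
Qed.

Section Step.
Variables (L : comNzRingType) (N n : nat) (p : {poly L}).
Variables (w : 'rV[{poly L}]_N) (b : 'I_n -> L) (a : L).

(** With [c] the product of ['X - a] and the ['X - b i], and [p] monic of degree
    [n.+2], [step_vec] is the remainder of [c * w] modulo [p], computed in two
    steps so as to make the dependence on [a] explicit. *)
Definition step_part : 'rV[{poly L}]_N :=
  vrem p ((\prod_i ('X - (b i)%:P)) *: w).

Definition step_vec : 'rV[{poly L}]_N :=
  ('X - a%:P) *: step_part - p *: map_mx polyC (vcoef n.+1 step_part).
End Step.

Section ChoosePoints.
Variable k : fieldType.
Hypothesis k_inf : forall s : seq k, exists x, x \notin s.
Hypothesis two : (2%:R : k) != 0.

(** Over an infinite field, the roots [b i], [a] of [c] can be chosen such that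
    the form takes nonzero values on the remainder of [c * w] at 0 and at these
    roots. The [b i] make the coefficient [l] of highest degree of [step_part]
    nonisotropic; the value at [x] is then a nonzero polynomial [F x] in [a]
    whenever [p.[x] != 0], and at [a] itself it is [p.[a] ^ 2] times the value
    at [l]. *)
Lemma choose_points N (G : 'M[k]_N) n (p : {poly k}) (w : 'rV[{poly k}]_N) :
  G^T = G -> p \is monic -> size p = n.+3 -> p.[0] != 0 ->
  (forall i, (size (w 0%R i) <= n.+2)%N) ->
  (exists i i', [/\ (0 < i <= n.+1)%N, (0 < i' <= n.+1)%N &
     gform G (vcoef i w) (vcoef i' w) != 0]) ->
  exists ba : ('I_n -> k) * k, forall x,
    [\/ x = 0, x = ba.2 | exists i, x = ba.1 i] ->
    (pform G (step_vec p w ba.1 ba.2) (step_vec p w ba.1 ba.2)).[x] != 0.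
Proof.
move=> Gsym pm sp p0 sw [i [i' [/andP[i0 iN] /andP[i'0 i'N] Gii']]].
have pn0 : p != 0 by rewrite monic_neq0.
pose lam f := vcoef n.+1 (vrem p (f *: w)).
have lamD f f' : lam (f + f') = lam f + lam f'.
  by apply/rowP=> l; rewrite !mxE mulrDl rmodpD // coefD.
have lamZ c f : lam (c *: f) = c *: lam f.
  by apply/rowP=> l; rewrite !mxE -scalerAl rmodpZ // coefZ.
have lam_drop j : (j <= n.+1)%N -> lam (drop_poly j.+1 p) = vcoef j w.
  by move=> jn; apply/rowP=> l; rewrite !mxE lead_rmodp_drop.
have [||||s [ss sp0 Bs]] := split_nonisotropic k_inf two (d := n)
    (B := fun f g => gform G (lam f) (lam g)) pn0.
- by move=> f f' g; rewrite lamD gformDl.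
- by move=> c f g; rewrite lamZ gformZl.
- by move=> f g; rewrite gformC.
- exists (drop_poly i.+1 p), (drop_poly i'.+1 p).
  rewrite !lam_drop // !size_drop_poly sp Gii'.
  by split=> //; lia.
pose b (j : 'I_n) := s`_j.
have cE : \prod_(x <- s) ('X - x%:P) = \prod_j ('X - (b j)%:P).
  by rewrite (big_nth 0) ss big_mkord.
have pb j : p.[b j] != 0 by apply: (allP sp0); rewrite mem_nth // ss.
move: Bs; rewrite cE; set c := \prod_j _ => Bc.
set v := step_part p w b; set l := vcoef n.+1 v.
have Ql : gform G l l != 0 by [].
pose ev x := map_mx (horner_eval x) v.
pose F x : {poly k} := (gform G (ev x) (ev x)) *: (x%:P - 'X) ^+ 2
  - (2%:R * p.[x] * gform G (ev x) l) *: (x%:P - 'X)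
  + (p.[x] ^+ 2 * gform G l l)%:P.
have FE x a : (pform G (step_vec p w b a) (step_vec p w b a)).[x] = (F x).[a].
  rewrite pform_horner.
  have -> : map_mx (horner_eval x) (step_vec p w b a)
      = (x - a) *: ev x - p.[x] *: l.
    apply/rowP=> m; rewrite !mxE /horner_eval !hornerE.
    by [].
  rewrite gformBl !gformBr !gformZl !gformZr (gformC Gsym l (ev x)) /F !hornerE.
  by rewrite /=; ring.
have F0 x : p.[x] != 0 -> F x != 0.
  move=> px; apply: contraNneq (mulf_neq0 (mulf_neq0 px px) Ql) => Fx.
  have : (F x).[x] = 0 by rewrite Fx horner0.
  rewrite /F !hornerE subrr /=.
  by move=> <-; apply/eqP; ring.
have [a] : exists a, (p * (F 0 * \prod_j F (b j))).[a] != 0.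
  apply: infinite_nonroot => //; rewrite !mulf_neq0 ?F0 //.
  by apply/prodf_neq0 => j _; rewrite F0.
rewrite !hornerM horner_prod !mulf_eq0 !negb_or => /and3P[pa Fa0].
move=> /prodf_neq0 Fab; exists (b, a) => x /= [->|->|[j ->]]; rewrite FE //.
  rewrite /F !hornerE subrr /=.
  rewrite [X in X != 0](_ : _ = p.[a] * p.[a] * gform G l l); last by ring.
  by rewrite !mulf_neq0.
exact: Fab.
Qed.
End ChoosePoints.

(** * Reflections *)

Section VectorCongruence.
Variables (L : comNzRingType) (N : nat) (G : 'M[L]_N) (p : {poly L}).
Hypotheses (Gsym : G^T = G) (pm : p \is monic).

Lemma map_polyC_sym : (map_mx polyC G)^T = map_mx polyC G.
Proof. by rewrite map_trmx Gsym. Qed.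

Lemma vremE (w : 'rV[{poly L}]_N) :
  w = vrem p w + p *: map_mx (fun f => rdivp f p) w.
Proof.
by apply/rowP=> i; rewrite !mxE {1}(rdivp_eq pm (w 0 i)) addrC mulrC.
Qed.

Lemma vrem_cong (w w' u : 'rV[{poly L}]_N) : w = w' + p *: u -> vrem p w = vrem p w'.
Proof.
by move->; apply/rowP=> i; rewrite !mxE rmodpD // mulrC rmodp_mull // addr0.
Qed.

Lemma vrem_small (w : 'rV[{poly L}]_N) :
  (forall i, size (w 0%R i) < size p)%N -> vrem p w = w.
Proof. by move=> sw; apply/rowP=> i; rewrite mxE rmodp_small. Qed.

Lemma size_vrem n (w : 'rV[{poly L}]_N) i :
  size p = n.+1 -> (size (vrem p w 0%R i) <= n)%N.
Proof.
by move=> sp; rewrite -ltnS -sp mxE ltn_rmodpN0 // monic_neq0.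
Qed.

Lemma pform_cong (w w' u : 'rV[{poly L}]_N) :
  w = w' + p *: u -> exists h, pform G w w = pform G w' w' + h * p.
Proof.
move->; exists (2%:R * pform G w' u + p * pform G u u).
rewrite gformDl !gformDr !gformZl !gformZr (gformC map_polyC_sym u w').
by ring.
Qed.

Lemma coef_pform (y z : 'rV[{poly L}]_N) m :
  (pform G y z)`_m = \sum_(j < m.+1) gform G (vcoef j y) (vcoef (m - j) z).
Proof.
rewrite /gform mxE coef_sum.
under [RHS]eq_bigr => j _ do rewrite mxE.
rewrite exchange_big /=; apply: eq_bigr => l _.
rewrite coefM; apply: eq_bigr => j _; rewrite !mxE coef_sum; congr (_ * _).
by apply: eq_bigr => i _; rewrite !mxE coefMC.
Qed.

Lemma pformC (x y : 'rV[L]_N) :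
  pform G (map_mx polyC x) (map_mx polyC y) = (gform G x y)%:P.
Proof. by rewrite (gform_map polyC). Qed.

Lemma size_pform m (w : 'rV[{poly L}]_N) :
  (forall i, size (w 0%R i) <= m.+1)%N -> (size (pform G w w) <= (m + m).+1)%N.
Proof.
move=> sw; apply/leq_sizeP => j mj; rewrite coef_pform big1 // => i _.
have v0 l : (m < l)%N -> vcoef l w = 0.
  by move=> ml; apply/rowP=> r; rewrite !mxE nth_default // (leq_trans (sw r)).
have [mi|im] := ltnP m i; first by rewrite v0 // -(scale0r 0) gformZl mul0r.
rewrite (v0 (j - i)%N) ?ltn_subRL; last first.
  by apply: leq_trans mj; rewrite ltnS leq_add2r.
by rewrite -(scale0r 0) gformZr mul0r.
Qed.
End VectorCongruence.

Section MapPoly.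
Variables (L L' : comNzRingType) (f : {rmorphism L -> L'}) (p : {poly L}).
Hypothesis pm : p \is monic.

Lemma map_rmodp g :
  map_poly f (rmodp g p) = rmodp (map_poly f g) (map_poly f p).
Proof.
have pm' : map_poly f p \is monic by exact: monic_map.
rewrite {2}(rdivp_eq pm g) rmorphD rmorphM rmodp_addl_mul_small //.
have -> : size (map_poly f p) = size p.
  by rewrite size_map_poly_id0 // (monicP pm) rmorph1 oner_neq0.
apply: leq_ltn_trans (_ : size (rmodp g p) < size p)%N; first exact: size_poly.
by rewrite ltn_rmodpN0 // monic_neq0.
Qed.

Lemma map_vrem N (w : 'rV[{poly L}]_N) :
  map_mx (map_poly f) (vrem p w) = vrem (map_poly f p) (map_mx (map_poly f) w).
Proof. by apply/rowP=> i; rewrite !mxE map_rmodp. Qed.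

Lemma map_step_vec N n (w : 'rV[{poly L}]_N) (b : 'I_n -> L) a :
  map_mx (map_poly f) (step_vec p w b a) =
  step_vec (map_poly f p) (map_mx (map_poly f) w) (f \o b) (f a).
Proof.
have pE : map_mx (map_poly f) (step_part p w b) =
    step_part (map_poly f p) (map_mx (map_poly f) w) (f \o b).
  rewrite /step_part map_vrem; congr (vrem _ _).
  apply/rowP=> l; rewrite !mxE rmorphM rmorph_prod; congr (_ * _).
  by apply: eq_bigr => i _; rewrite rmorphB /= map_polyX map_polyC.
rewrite /step_vec -pE; apply/rowP=> l; rewrite !mxE.
by rewrite !(rmorphB, rmorphM) /= map_polyX !map_polyC /= coef_map.
Qed.
End MapPoly.

(** [w] modulo [p], reflected along [u]; [r] is meant to be an inverse of
    [pform G u u] modulo [p]. *)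
Definition reflect_vec (L : comNzRingType) N (G : 'M[L]_N) (p r : {poly L})
    (w u : 'rV[{poly L}]_N) :=
  vrem p (w - (2%:R * r * pform G w u) *: u).

(** The coefficients of [w] of degrees 1 to [n] do not span a totally isotropic
    space. *)
Definition nondegenerate_tail (L : comNzRingType) N (G : 'M[L]_N) n
    (w : 'rV[{poly L}]_N) :=
  exists i i', [/\ (0 < i <= n)%N, (0 < i' <= n)%N &
    gform G (vcoef i w) (vcoef i' w) != 0].

Section Reflection.
Variable k : fieldType.
Hypothesis k_inf : forall s : seq k, exists x, x \notin s.
Hypothesis two : (2%:R : k) != 0.
Variables (N n : nat) (G : 'M[k]_N) (p : {poly k}) (w : 'rV[{poly k}]_N).
Hypotheses (Gsym : G^T = G) (pm : p \is monic) (sp : size p = n.+3).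
Hypothesis sw : forall i, (size (w 0%R i) <= n.+2)%N.

Let p0 : p != 0. Proof. exact: monic_neq0. Qed.

Let vcoef0 i : (n.+1 < i)%N -> vcoef i w = 0.
Proof.
by move=> ni; apply/rowP=> l; rewrite !mxE nth_default // (leq_trans (sw l)).
Qed.

Let gform0l x : gform G 0 x = 0.
Proof. by rewrite -(scale0r 0) gformZl mul0r. Qed.

Let gform0r x : gform G x 0 = 0.
Proof. by rewrite -(scale0r 0) gformZr mul0r. Qed.

Let two_half (x : k) : 2%:R * x = 1 -> x = 2%:R^-1.
Proof. by move=> h; rewrite -[LHS](mulKf two) h mulr1. Qed.

(** If the coefficients of positive degree do not span a totally isotropic
    space, this remains so after the reflection along a constant nonisotropic
    vector. The reflection is not needed over the residue field at hand, but the
    vector to reflect along is chosen over all residue fields at once. *)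
Lemma reflect_nondegenerate : nondegenerate_tail G n.+1 w ->
  exists u : 'rV[{poly k}]_N,
    (exists r s, r * pform G u u + s * p = 1) /\
    (forall r s, r * pform G u u + s * p = 1 ->
       nondegenerate_tail G n.+1 (reflect_vec G p r w u)).
Proof.
move=> [i [i' [iN i'N Gii']]].
have [x Gx] : exists x, gform G x x != 0.
  apply: contrapT => no; have G0 x : gform G x x = 0.
    by apply: contrapT => /eqP Gx; apply: no; exists x.
  have := G0 (vcoef i w + vcoef i' w).
  rewrite gformDl !gformDr !G0 add0r addr0 (gformC Gsym (vcoef i' w)).
  by rewrite -mulr2n -mulr_natl => /eqP; rewrite mulf_eq0 (negPf two) (negPf Gii').
set u := map_mx polyC x.
have Qu : pform G u u = (gform G x x)%:P by exact: pformC.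
exists u; rewrite Qu; split.
  by exists (gform G x x)^-1%:P, 0; rewrite mul0r addr0 -polyCM mulVf.
move=> r s rs; pose c := 2%:R * (gform G x x)^-1.
have -> : reflect_vec G p r w u = w - (c%:P * pform G w u) *: u.
  have sb : (size (pform G w u) <= n.+2)%N.
    apply/leq_sizeP => m nm; rewrite coef_pform big1 // => j _.
    have [jn|nj] := leqP j n.+1; last by rewrite vcoef0.
    rewrite (_ : vcoef (m - j) u = 0) //; apply/rowP=> l; rewrite !mxE coefC.
    by rewrite subn_eq0 leqNgt (leq_trans _ nm).
  rewrite /reflect_vec (vrem_cong pm (w' := w - (c%:P * pform G w u) *: u)
    (u := (c%:P * s * pform G w u) *: u)).
    apply: vrem_small => l; rewrite !mxE sp ltnS.
    apply: leq_trans (size_polyD _ _) _; rewrite size_polyN geq_max.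
    rewrite (leq_trans (sw l)) //= mulrC !mul_polyC.
    by do 2!(rewrite (leq_trans (size_scale_leq _ _)) //); rewrite leqW.
  rewrite scalerA -addrA; congr (_ + _); rewrite -!scaleNr -scalerDl; congr (_ *: _).
  have -> : r = (gform G x x)^-1%:P * (1 - s * p).
    by rewrite -rs addrK mulrCA -polyCM mulVf // mulr1.
  by rewrite /c polyCM (_ : 2%:R%:P = 2%:R) ?rmorph_nat //; ring.
pose T y := y - (c * gform G y x) *: x.
have cT j : vcoef j (w - (c%:P * pform G w u) *: u) = T (vcoef j w).
  apply/rowP=> l; rewrite !mxE coefB coefMC coefCM; congr (_ - _ * _ * _).
  rewrite coef_pform big_ord_recr /= subnn.
  rewrite (_ : vcoef 0 u = x); last by apply/rowP=> m; rewrite !mxE coefC.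
  rewrite big1 ?add0r // => m _.
  rewrite (_ : vcoef (j - m) u = 0) //; apply/rowP=> q; rewrite !mxE coefC.
  by rewrite subn_eq0 leqNgt ltn_ord.
exists i, i'; split=> //; rewrite !cT /T.
rewrite gformBl !gformBr !gformZl !gformZr (gformC Gsym x).
move: Gii'; congr (_ != 0).
by rewrite /c; field.
Qed.

(** If the coefficients of positive degree span a totally isotropic space, then
    the form takes the value ['X] at [w], not only modulo [p]. The coefficients
    [w_ 0] and [w_ 1] then span a hyperbolic plane, and [w_ 0] is orthogonal to
    the other ones. The reflection along [w_ 0 - ('X + a) *: w_ 1] gives the
    coefficient of degree 1 a component along [w_ 0], which makes it
    nonisotropic, for all but finitely many values of [a]. *)
Lemma reflect_degenerate (h : {poly k}) :
  pform G w w = 'X + h * p -> ~ nondegenerate_tail G n.+1 w ->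
  exists u : 'rV[{poly k}]_N,
    (exists r s, r * pform G u u + s * p = 1) /\
    (forall r s, r * pform G u u + s * p = 1 ->
       nondegenerate_tail G n.+1 (reflect_vec G p r w u)).
Proof.
move=> Qw deg; pose w_ i := vcoef i w.
have g0 i i' : (0 < i)%N -> (0 < i')%N -> gform G (w_ i) (w_ i') = 0.
  move=> i0 i'0; have [iN|] := leqP i n.+1; last by move=> /vcoef0; rewrite /w_ => ->.
  have [i'N|] := leqP i' n.+1; last by move=> /vcoef0; rewrite /w_ => ->.
  apply: contrapT => /eqP ne; apply: deg; exists i, i'.
  by rewrite i0 iN i'0 i'N.
have Qcoef m : (0 < m)%N -> (pform G w w)`_m = 2%:R * gform G (w_ 0%N) (w_ m).
  case: m => // m _; rewrite coef_pform big_ord_recl big_ord_recr /= subn0 subnn.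
  rewrite big1 ?add0r; last by move=> j _; rewrite g0 // subn_gt0 ltnS.
  by rewrite (gformC Gsym _ (vcoef 0 w)) mulr_natl mulr2n.
have h0 : h = 0.
  apply: contrapT => /eqP hn0.
  have : (size (h * p)%R <= n.+2)%N.
    have -> : h * p = pform G w w - 'X by rewrite Qw addrC addKr.
    apply: leq_trans (size_polyD _ _) _; rewrite size_polyN size_polyX geq_max.
    rewrite andbT; apply/leq_sizeP => j nj; rewrite Qcoef; last by case: j nj.
    by rewrite /w_ (vcoef0 nj) gform0r mulr0.
  have : (0 < size h)%N by rewrite size_poly_gt0.
  by rewrite size_Mmonic // sp; move: (size h) => d; lia.
have {h h0}Qw : pform G w w = 'X by rewrite Qw h0 mul0r addr0.
have g00 : gform G (w_ 0%N) (w_ 0%N) = 0.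
  have : (pform G w w)`_0 = 0 by rewrite Qw coefX.
  by rewrite coef_pform big_ord1.
have g01 : gform G (w_ 0%N) (w_ 1%N) = 2%:R^-1.
  by apply: two_half; rewrite -Qcoef // Qw coefX.
have g0m m : (1 < m)%N -> gform G (w_ 0%N) (w_ m) = 0.
  move=> m1; have := Qcoef m (ltnW m1); rewrite Qw coefX.
  case: m m1 => [|[|m]] // _ /esym/eqP; rewrite mulf_eq0 (negPf two) /=.
  by move/eqP.
(* [p.[- a] != 0] makes the reflection exist modulo [p]; the last condition says
   that the inverse of ['X + a] modulo [p] has a nonzero coefficient in degree 1. *)
have [a [a0 pa ha]] : exists a, [/\ a != 0, p.[- a] != 0 &
    p.[- a] + a * p`_1 - p`_0 != 0].
  pose f : {poly k} := p - p`_1 *: 'X - (p`_0)%:P.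
  have f0 : f != 0.
    apply/eqP => /(congr1 (fun g : {poly k} => g`_n.+2)) /eqP.
    rewrite !coefB coefZ coefX coefC coef0 /= mulr0 !subr0.
    by move/monicP: pm; rewrite lead_coefE sp /= => ->; rewrite oner_eq0.
  have [|x] := infinite_nonroot k_inf (f := 'X * (p * f)).
    by rewrite !mulf_neq0 ?polyX_eq0.
  rewrite !hornerM hornerX !mulf_eq0 !negb_or => /and3P[x0 px fx].
  exists (- x); rewrite oppr_eq0 opprK; split=> //.
  by move: fx; rewrite /f !hornerE /= mulNr [p`_1 * x]mulrC.
pose W i := map_mx polyC (w_ i).
pose u : 'rV[{poly k}]_N := W 0%N - ('X + a%:P) *: W 1%N.
have Qu : pform G u u = - ('X + a%:P).
  rewrite /u gformBl !gformBr !gformZl !gformZr !pformC.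
  rewrite (gformC Gsym (w_ 1%N) (w_ 0%N)) g00 (g0 1%N 1%N) // g01 !rmorph0.
  have e2 : 2%:R * (2%:R^-1)%:P = 1 :> {poly k}.
    by rewrite -(rmorph_nat polyC) -polyCM mulfV.
  transitivity (- (('X + a%:P) * (2%:R * (2%:R^-1)%:P))); last by rewrite e2 mulr1.
  by move: (2%:R^-1)%:P => e; ring.
have cW j m : (pform G w (W j))`_m = gform G (w_ m) (w_ j).
  rewrite coef_pform big_ord_recr /= subnn.
  rewrite (_ : vcoef 0 (W j) = w_ j); last by apply/rowP=> l; rewrite !mxE coefC.
  rewrite big1 ?add0r // => i _.
  rewrite (_ : vcoef (m - i) (W j) = 0) //; apply/rowP=> l; rewrite !mxE coefC.
  by rewrite subn_eq0 leqNgt ltn_ord.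
have b0 : pform G w (W 0%N) = (2%:R^-1) *: 'X.
  apply/polyP=> m; rewrite cW coefZ coefX (gformC Gsym).
  case: m => [|[|m]]; rewrite ?g00 ?g01 ?g0m ?mulr0 ?mulr1 //.
have b1 : pform G w (W 1%N) = (2%:R^-1)%:P.
  apply/polyP=> m; rewrite cW coefC.
  by case: m => [|m]; [exact: g01|rewrite g0].
have b : 2%:R * pform G w u = - a%:P.
  rewrite /u gformBr gformZr b0 b1 -mul_polyC.
  have e2 : 2%:R * (2%:R^-1)%:P = 1 :> {poly k}.
    by rewrite -(rmorph_nat polyC) -polyCM mulfV.
  transitivity (- a%:P * (2%:R * (2%:R^-1)%:P)); last by rewrite e2 mulr1.
  by move: (2%:R^-1)%:P => e; ring.
exists u; rewrite Qu; split.
  have [g gE] : exists g, p = p.[- a]%:P + g * ('X + a%:P).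
    have : root (p - p.[- a]%:P) (- a) by rewrite /root !hornerE subrr.
    move=> /factor_theorem[g]; rewrite polyCN opprK => gE; exists g.
    by rewrite -gE addrC subrK.
  exists (p.[- a]^-1%:P * g), (p.[- a]^-1)%:P.
  by rewrite {3}gE mulrDr -polyCM mulVf //; ring.
move=> r s rs; set r' := rmodp r p.
have [s' rs'] : exists s', r' * ('X + a%:P) = s' * p - 1.
  exists (s - rdivp r p * ('X + a%:P)).
  rewrite -rs {2}(rdivp_eq pm r) -/r'; ring.
have sr' : (size r' <= n.+2)%N by rewrite -ltnS -sp ltn_rmodpN0.
have s's : (size s' <= 1)%N.
  have [->|s'0] := eqVneq s' 0; first by rewrite size_poly0.
  have : (size (s' * p)%R <= n.+3)%N.
    have -> : s' * p = r' * ('X + a%:P) + 1 by rewrite rs' subrK.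
    apply: leq_trans (size_polyD _ _) _; rewrite size_poly1 geq_max andbT.
    apply: leq_trans (size_polyMleq _ _) _.
    by rewrite -[a]opprK polyCN size_XsubC addn2.
  by rewrite size_Mmonic // sp; move: (size s') => d; lia.
have s'E := size1_polyC s's; set t := s'`_0 in s'E.
have tpa : t * p.[- a] = 1.
  have := congr1 (fun f : {poly k} => f.[- a]) rs'.
  rewrite s'E !hornerE /= addNr mulr0 => /eqP.
  by rewrite eq_sym subr_eq0 => /eqP.
have r'1 : r'`_1 != 0.
  apply/eqP => r10.
  have E1 : r'`_0 = t * p`_1.
    have := congr1 (fun f : {poly k} => f`_1) rs'.
    by rewrite s'E mulrDr coefD coefMX coefMC r10 mul0r addr0 coefB coefCM coef1 subr0.
  have E0 : r'`_0 * a = t * p`_0 - 1.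
    have := congr1 (fun f : {poly k} => f`_0) rs'.
    by rewrite s'E mulrDr coefD coefMX coefMC add0r coefB coefCM coef1.
  move/eqP: ha; apply.
  have -> : p.[- a] + a * p`_1 - p`_0 = p.[- a] * (1 - t * p`_0 + t * p`_1 * a).
    by rewrite !mulrDr mulr1 mulrN !mulrA [p.[- a] * t]mulrC tpa; ring.
  by rewrite -E1 E0; ring.
have refE : reflect_vec G p r w u = w + (a%:P * r') *: W 0%N + a%:P *: W 1%N.
  rewrite /reflect_vec.
  rewrite (vrem_cong pm (w' := w + (a%:P * r') *: W 0%N + a%:P *: W 1%N)
    (u := (a%:P * rdivp r p) *: W 0%N - (a%:P * s) *: W 1%N)).
    apply: vrem_small => l; rewrite !mxE sp ltnS.
    apply: leq_trans (size_polyD _ _) _; rewrite geq_max; apply/andP; split.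
      apply: leq_trans (size_polyD _ _) _; rewrite geq_max sw /=.
      by rewrite mulrC !mul_polyC; do 2!(rewrite (leq_trans (size_scale_leq _ _)) //).
    rewrite mul_polyC (leq_trans (size_scale_leq _ _)) //.
    by rewrite (leq_trans (size_polyC_leq1 _)).
  have -> : (2%:R * r * pform G w u) *: u = (- (a%:P * r)) *: u.
    by congr (_ *: _); rewrite mulrAC b; ring.
  have rE : r = rdivp r p * p + r' by exact: rdivp_eq.
  apply/rowP=> l; rewrite !mxE.
  set x := (_`_0)%:P; set y := (_`_1)%:P.
  have e : a%:P * r * ('X + a%:P) = a%:P * (s * p - 1) by rewrite -rs; ring.
  transitivity (w 0 l + a%:P * r * x - a%:P * r * ('X + a%:P) * y); first by ring.
  by rewrite e [X in a%:P * X * x]rE; ring.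
exists 1%N, 1%N; split=> //.
have -> : vcoef 1 (reflect_vec G p r w u) = w_ 1%N + (a * r'`_1) *: w_ 0%N.
  rewrite refE; apply/rowP=> l.
  by rewrite !mxE !coefD coefMC !coefCM coefC mulr0 addr0.
rewrite gformDl !gformDr !gformZl !gformZr (gformC Gsym (w_ 1%N) (w_ 0%N)).
rewrite g00 (g0 1%N 1%N) // g01.
rewrite [X in X != 0](_ : _ = a * r'`_1); last by field.
by rewrite mulf_neq0.
Qed.
End Reflection.

(** * Descent on the degree *)

Lemma is_unitP (R : comUnitRingType) (a : R) : is_unit a <-> a \is a GRing.unit.
Proof.
split=> [[b ab]|aU]; first by apply/unitrPr; exists b.
by exists a^-1; rewrite mulrV.
Qed.

Section Core.
Variables (R : idomainType) (X : residue_system R).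
Local Notation pi := (@res_proj R X).
Hypothesis res_inf : forall j (s : seq (@res_field R X j)), exists x, x \notin s.
Hypothesis res_two : forall j, (2%:R : @res_field R X j) != 0.

Lemma res_crt_poly (f : forall j, {poly @res_field R X j}) :
  exists F : {poly R}, forall j, map_poly (pi j) F = f j.
Proof.
have /choice[c cP] : forall i, exists x, forall j, pi j x = (f j)`_i.
  move=> i; apply: (res_crt_pick (P := fun j y => y = (f j)`_i)) => j.
  by exists (f j)`_i.
exists (\poly_(i < \max_j size (f j)) c i) => j.
apply/polyP=> i; rewrite coef_map coef_poly; case: ltnP => [_|le]; first exact: cP.
rewrite [LHS](rmorph0 (pi j)) nth_default //.
exact: leq_trans (leq_bigmax (F := fun j => size (f j)) j) le.
Qed.

Lemma res_lift_poly j (f : {poly @res_field R X j}) :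
  exists F : {poly R}, map_poly (pi j) F = f.
Proof.
have /choice[c cP] : forall i, exists x, pi j x = f`_i.
  by move=> i; exact: res_surj.
exists (\poly_(i < size f) c i); apply/polyP=> i.
rewrite coef_map coef_poly; case: ltnP => [_|le]; first exact: cP.
by rewrite [LHS](rmorph0 (pi j)) nth_default.
Qed.

Lemma res_crt_vec N (f : forall j, 'rV[{poly @res_field R X j}]_N) :
  exists F : 'rV[{poly R}]_N, forall j, map_mx (map_poly (pi j)) F = f j.
Proof.
have /choice[c cP] : forall i, exists F : {poly R}, forall j, map_poly (pi j) F = f j 0 i.
  by move=> i; exact: (res_crt_poly (fun j => f j 0 i)).
by exists (\row_i c i) => j; apply/rowP=> i; rewrite !mxE cP.
Qed.

(** An element of [R[X]/(p)], [p] monic, is invertible if it is so over every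
    residue field. *)
Lemma inverse_mod (p f : {poly R}) : p \is monic ->
  (forall j, exists r s, r * map_poly (pi j) f + s * map_poly (pi j) p = 1) ->
  exists r s, r * f + s * p = 1.
Proof.
move=> pm cop.
pose I (g : {poly R}) := exists r s, g = r * f + s * p.
have ID g g' : I g -> I g' -> I (g + g').
  move=> [r [s ->]] [r' [s' ->]]; exists (r + r'), (s + s'); ring.
have IM g g' : I g -> I (g' * g).
  by move=> [r [s ->]]; exists (g' * r), (g' * s); ring.
have Ip : I p by exists 0, 1; ring.
suff [r [s e]] : I 1 by exists r, s.
have [s1|s1] := leqP (size p) 1.
  suff <- : p = 1 by [].
  have pE := size1_polyC s1; move/monicP: pm; rewrite {1}pE lead_coefC => c1.
  by rewrite pE c1.
pose x (i : 'I_(size p).-1) : {poly R} := 'X^i.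
have /= := @nakayama R X {poly R} I _ x _ ID _ _ (Ordinal (_ : 0 < (size p).-1)%N).
rewrite /x /= expr0; apply.
- by exists 0, 0; ring.
- by move=> a u Iu; rewrite -mul_polyC; exact: IM.
- move=> j i; have [r [s rs]] := cop j.
  have [A AE] := res_lift_poly r; have [B BE] := res_lift_poly s.
  pose e := rmodp (x i * (1 - (A * f + B * p))) p.
  have e0 : map_poly (pi j) e = 0.
    rewrite map_rmodp // rmorphM rmorphB rmorphD !rmorphM rmorph1 /=.
    by rewrite AE BE rs subrr mulr0 rmod0p.
  exists (fun l : 'I_(size p).-1 => e`_l); split=> [l|].
    by have := congr1 (fun g : {poly _} => g`_l) e0; rewrite coef_map coef0.
  have -> : \sum_(l < (size p).-1) e`_l *: x l = e.
    apply/polyP=> m; rewrite coef_sum.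
    have se : (size e <= (size p).-1)%N.
      by rewrite -ltnS prednK ?(ltnW s1) // ltn_rmodpN0 // monic_neq0.
    have [lt|ge] := ltnP m (size p).-1.
      rewrite (bigD1 (Ordinal lt)) //= coefZ coefXn eqxx mulr1 big1 ?addr0 //.
      move=> l lm; rewrite coefZ coefXn; case: eqP => [E|_]; last by rewrite mulr0.
      by case/eqP: lm; apply: val_inj.
    rewrite nth_default ?(leq_trans se) // big1 // => l _.
    by rewrite coefZ coefXn gtn_eqF ?mulr0 // (leq_trans (ltn_ord l)).
  exists (x i * A), (x i * B + rdivp (x i * (1 - (A * f + B * p))) p).
  have := rdivp_eq pm (x i * (1 - (A * f + B * p))); rewrite -/e.
  rewrite -/(x i); set d := rdivp _ _ => E; clearbody d e; move: (x i) E => y E.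
  transitivity (y * (1 - (A * f + B * p)) + y * (A * f + B * p) - e).
    by ring.
  by rewrite E; ring.
- by rewrite -ltnS prednK // ltnW.
Qed.

(** A vector on which the form takes the value ['X] modulo [p] can be replaced
    with one whose coefficients of positive degree do not span a totally
    isotropic space in any residue field. *)
Lemma reflect_tail N n (G : 'M[R]_N) (p h : {poly R}) (w : 'rV[{poly R}]_N) :
  G^T = G -> p \is monic -> size p = n.+3 -> pform G w w = 'X + h * p ->
  exists (w' : 'rV[{poly R}]_N) (h' : {poly R}), [/\ forall i, (size (w' 0%R i) <= n.+2)%N,
    pform G w' w' = 'X + h' * p &
    forall j, nondegenerate_tail (map_mx (pi j) G) n.+1
      (map_mx (map_poly (pi j)) w')].
Proof.
move=> Gsym pm sp Qw.
have [h0 Qw0] : exists h0, pform G (vrem p w) (vrem p w) = 'X + h0 * p.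
  have [g] := pform_cong Gsym (vremE pm w); rewrite Qw => E.
  by exists (h - g); rewrite mulrBl addrA E addrK.
have sw0 i : (size (vrem p w 0%R i) <= n.+2)%N by exact: size_vrem.
move: (vrem p w) Qw0 sw0 => {h Qw}w; move: h0 => h Qw sw.
have mp j : map_poly (pi j) p \is monic by exact: monic_map.
have smp j : size (map_poly (pi j) p) = n.+3.
  by rewrite size_map_poly_id0 // (monicP pm) rmorph1 oner_neq0.
have exu j : exists u : 'rV[{poly @res_field R X j}]_N,
    (exists r s, r * pform (map_mx (pi j) G) u u + s * map_poly (pi j) p = 1) /\
    (forall r s, r * pform (map_mx (pi j) G) u u + s * map_poly (pi j) p = 1 ->
       nondegenerate_tail (map_mx (pi j) G) n.+1
         (reflect_vec (map_mx (pi j) G) (map_poly (pi j) p) r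
            (map_mx (map_poly (pi j)) w) u)).
  have Gs : (map_mx (pi j) G)^T = map_mx (pi j) G by rewrite map_trmx Gsym.
  have smw i : (size (map_mx (map_poly (pi j)) w 0%R i) <= n.+2)%N.
    by rewrite mxE (leq_trans (size_poly _ _)).
  have [nd|deg] := pselect (nondegenerate_tail (map_mx (pi j) G) n.+1
    (map_mx (map_poly (pi j)) w)).
    by apply: reflect_nondegenerate.
  apply: (reflect_degenerate (@res_inf j) (res_two j) Gs (mp j) (smp j) smw
    (h := map_poly (pi j) h)) deg.
  by rewrite -pform_map Qw rmorphD rmorphM /= map_polyX.
pose u j := projT1 (cid (exu j)); have uP j := projT2 (cid (exu j)).
have [U UE] := res_crt_vec u.
have [|r [s rs]] := @inverse_mod p (pform G U U) pm.
  by move=> j; have [[r [s rs]] _] := uP j; exists r, s; rewrite pform_map UE.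
pose w' := reflect_vec G p r w U.
have [h'] : exists h', pform G w' w' = 'X + h' * p.
  pose b := pform G w U; pose y := w - (2%:R * r * b) *: U.
  have [g E] := pform_cong Gsym (vremE pm y).
  exists (h - g - 4%:R * r * b * b * s).
  have -> : pform G w' w' = pform G y y - g * p by rewrite E addrK.
  rewrite /y gformBl !gformBr !gformZl !gformZr (gformC (map_polyC_sym Gsym) U).
  rewrite -/b Qw.
  transitivity ('X + h * p - g * p - 4%:R * r * b * b * (1 - r * pform G U U)).
    by ring.
  by rewrite -rs; ring.
move=> Qw'; exists w', h'; split=> // [i|j]; first exact: size_vrem.
have [_ +] := uP j; rewrite -/(u j) -UE -pform_map.
move=> /(_ (map_poly (pi j) r) (map_poly (pi j) s)).
have -> : map_mx (map_poly (pi j)) w' = reflect_vec (map_mx (pi j) G)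
    (map_poly (pi j) p) (map_poly (pi j) r) (map_mx (map_poly (pi j)) w)
    (map_mx (map_poly (pi j)) U).
  rewrite /w' /reflect_vec map_vrem //; congr (vrem _ _).
  apply/rowP=> l; rewrite !mxE rmorphB !rmorphM rmorph_nat /=.
  by rewrite pform_map.
by apply; rewrite -!rmorphM -rmorphD rs rmorph1.
Qed.

Lemma linear_coprime (h : {poly R}) x :
  h.[x] \is a GRing.unit -> exists r s, r * ('X - x%:P) + s * h = 1.
Proof.
move=> hx; have : root (h - h.[x]%:P) x by rewrite /root !hornerE subrr.
move=> /factor_theorem[g gE].
exists (- (h.[x]^-1)%:P * g), (h.[x]^-1)%:P.
rewrite !mulNr -mulrA -gE mulrBr -polyCM mulVr // polyC1; ring.
Qed.

Lemma prod_linear_coprime (I : Type) (t : seq I) (x : I -> R) (h : {poly R}) :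
  (forall i, h.[x i] \is a GRing.unit) ->
  exists r s, r * (\prod_(i <- t) ('X - (x i)%:P)) + s * h = 1.
Proof.
move=> hx; elim: t => [|i t [r [s rs]]].
  by exists 1, 0; rewrite big_nil; ring.
have [r' [s' rs']] := linear_coprime (hx i).
rewrite big_cons; move: (\prod_(j <- t) _) rs => c rs.
exists (r * r'), (s * r' * ('X - (x i)%:P) + s').
transitivity (r' * ('X - (x i)%:P) * (r * c + s * h) + s' * h); first by ring.
by rewrite rs mulr1.
Qed.

(** The descent step: the degree of [p] drops by one, at the cost of the value
    of the form at a constant vector. The polynomial [- g] of the proof is
    [p']. *)
Lemma descent N n (G : 'M[R]_N) (p h : {poly R}) (w : 'rV[{poly R}]_N) :
  G^T = G -> p \is monic -> size p = n.+3 -> p.[0] \is a GRing.unit ->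
  pform G w w = 'X + h * p ->
  exists (p' h' : {poly R}) (w' : 'rV[{poly R}]_N) (x : 'rV[R]_N),
    [/\ p' \is monic, size p' = n.+2, p'.[0] \is a GRing.unit,
        pform G w' w' = 'X + h' * p' & p.[0] * p'.[0] = - gform G x x].
Proof.
move=> Gsym pm sp p0 /(reflect_tail Gsym pm sp)[{h}w0 [h [sw Qw tail]]].
move: w0 sw Qw tail => {}w sw Qw tail.
have mp j : map_poly (pi j) p \is monic by exact: monic_map.
have smp j : size (map_poly (pi j) p) = n.+3.
  by rewrite size_map_poly_id0 // (monicP pm) rmorph1 oner_neq0.
have Gs j : (map_mx (pi j) G)^T = map_mx (pi j) G by rewrite map_trmx Gsym.
have mp0 j : (map_poly (pi j) p).[0] != 0.
  have := rmorph_unit (pi j) p0; rewrite unitfE -horner_map /=.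
  by rewrite [X in _.[X]](rmorph0 (pi j)).
have msw j i : (size (map_mx (map_poly (pi j)) w 0%R i) <= n.+2)%N.
  by rewrite mxE (leq_trans (size_poly _ _)).
have exba j := choose_points (@res_inf j) (res_two j) (Gs j) (mp j) (smp j)
  (mp0 j) (msw j) (tail j).
pose ba j := projT1 (cid (exba j)); have baP j := projT2 (cid (exba j)).
have [a aE] : exists a, forall j, pi j a = (ba j).2.
  by apply: (res_crt_pick (P := fun j y => y = (ba j).2)) => j; exists (ba j).2.
have /choice[b bE] : forall i, exists x, forall j, pi j x = (ba j).1 i.
  move=> i; apply: (res_crt_pick (P := fun j y => y = (ba j).1 i)) => j.
  by exists ((ba j).1 i).
pose v := step_vec p w b a.
have vU x : [\/ x = 0, x = a | exists i, x = b i] ->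
    (pform G v v).[x] \is a GRing.unit.
  move=> xP; apply/res_unitP => j; rewrite -horner_map pform_map /=.
  rewrite map_step_vec //; have := baP j (pi j x); rewrite -/(ba j) aE.
  have -> : pi j \o b = (ba j).1 by apply: funext => i /=; rewrite bE.
  apply; case: xP => [->|->|[i ->]].
  - by constructor 1; exact: (rmorph0 (pi j)).
  - by constructor 2; rewrite aE.
  - by constructor 3; exists i; rewrite bE.
pose c := ('X - a%:P) * \prod_i ('X - (b i)%:P).
have cm : c \is monic by rewrite monicMl ?monicXsubC // monic_prod_XsubC.
have sc : size c = n.+2.
  rewrite size_Mmonic ?monic_neq0 ?monicXsubC ?monic_prod_XsubC //.
  by rewrite size_XsubC size_prod_XsubC [index_enum _]unlock -enumT size_enum_ord.
have [u vE] : exists u, v = c *: w + p *: u.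
  pose c1 := \prod_i ('X - (b i)%:P).
  pose y := map_mx (fun f => rdivp f p) (c1 *: w).
  have E : c1 *: w = step_part p w b + p *: y by exact: vremE.
  exists (- (('X - a%:P) *: y) - map_mx polyC (vcoef n.+1 (step_part p w b))).
  rewrite /v /step_vec /c -/c1; move: (map_mx polyC _) => l; clearbody y c1.
  move: (step_part p w b) E => z E; apply/rowP=> i.
  have := congr1 (fun t : 'rV[{poly R}]_N => t 0 i) E; rewrite !mxE => Ei.
  by rewrite -[in RHS]mulrA Ei; ring.
have [g Qv] : exists g, pform G v v = c ^+ 2 * 'X + g * p.
  have [g ->] := pform_cong Gsym vE; exists (g + c ^+ 2 * h).
  by rewrite gformZl gformZr Qw; ring.
have sv i : (size (v 0%R i) <= n.+2)%N.
  have : (size (step_part p w b 0%R i) <= n.+2)%N by exact: size_vrem.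
  have -> : v 0 i = ('X - a%:P) * step_part p w b 0 i
      - p * ((step_part p w b 0 i)`_n.+1)%:P by rewrite /v /step_vec !mxE.
  move: (step_part p w b 0 i) => y sy; apply/leq_sizeP => -[//|m] nm.
  rewrite mulrBl !coefB coefXM coefCM coefMC /=.
  rewrite [y`_m.+1]nth_default ?mulr0 ?subr0 ?(leq_trans sy) //.
  have [<-|nm'] := eqVneq n.+1 m.
    have -> : p`_n.+2 = 1 by move/monicP: pm; rewrite lead_coefE sp.
    by rewrite mul1r subrr.
  have {nm nm'}nm : (n.+1 < m)%N by rewrite ltn_neqAle nm'.
  rewrite [y`_m]nth_default ?(leq_trans sy) // [p`_m.+1]nth_default ?sp //.
  by rewrite mul0r subr0.
have hp : (- g) * p = c ^+ 2 * 'X - pform G v v by rewrite Qv; ring.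
have sQv : (size (pform G v v) <= (n.+1 + n.+1).+1)%N by exact: size_pform.
have c2m : c ^+ 2 * 'X \is monic by rewrite monicMl ?monicX // monic_exp.
have sc2 : size (c ^+ 2 * 'X)%R = (n.+1 + n.+1).+2.
  rewrite size_mulX ?monic_neq0 ?monic_exp // expr2 size_Mmonic ?monic_neq0 //.
  by rewrite sc addnS.
have hpm : (- g) * p \is monic.
  by rewrite hp monicE lead_coefDl ?size_polyN ?sc2 // -monicE.
have gm : - g \is monic by rewrite -(monicMr _ pm).
have sg : size (- g) = n.+2.
  have : size ((- g) * p)%R = (n.+1 + n.+1).+2.
    by rewrite hp size_polyDl // size_polyN sc2.
  by rewrite size_Mmonic ?monic_neq0 // sp; move: (size (- g)) => d; lia.
have gU x : [\/ x = 0, x = a | exists i, x = b i] -> (- g).[x] \is a GRing.unit.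
  move=> xP; have : ((- g) * p).[x] \is a GRing.unit.
    rewrite hp hornerD hornerN hornerM hornerX horner_exp.
    have -> : c.[x] ^+ 2 * x = 0.
      case: xP => [->|->|[i ->]]; first by rewrite mulr0.
        by rewrite hornerM hornerXsubC subrr mul0r expr0n mul0r.
      rewrite hornerM horner_prod (bigD1 i) //= !hornerXsubC subrr mul0r mulr0.
      by rewrite expr0n mul0r.
    by rewrite sub0r unitrN vU.
  by rewrite hornerM unitrM => /andP[].
have [r1 [s1 rs1]] : exists r s, r * (\prod_i ('X - (b i)%:P)) + s * (- g) = 1.
  by apply: prod_linear_coprime => i; apply: gU; constructor 3; exists i.
have [r2 [s2 rs2]] := linear_coprime (gU a (Or32 _ _ (erefl a))).
pose r := r1 * r2; pose s := s2 + r2 * ('X - a%:P) * s1.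
have rs : r * c + s * (- g) = 1.
  rewrite /r /s /c; move: rs1; move: (\prod_i _) => c1 rs1.
  transitivity (r2 * ('X - a%:P) * (r1 * c1 + s1 * (- g)) + s2 * (- g)).
    by ring.
  by rewrite rs1 mulr1.
exists (- g), ((s ^+ 2 * (- g) - 2%:R * s) * 'X - r ^+ 2 * p), (r *: v),
  (map_mx (horner_eval 0) v); split=> //.
- by apply: gU; constructor 1.
- rewrite gformZl gformZr.
  have -> : pform G v v = c ^+ 2 * 'X - (- g) * p by rewrite hp; ring.
  have rc : r * c = 1 - s * (- g) by rewrite -rs; ring.
  transitivity ((r * c) ^+ 2 * 'X - r ^+ 2 * ((- g) * p)); first by ring.
  by rewrite rc; ring.
- have := congr1 (fun f : {poly R} => f.[0]) hp.
  rewrite hornerD hornerN !hornerM hornerX mulr0 sub0r pform_horner => <-.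
  by rewrite mulrC.
Qed.

(** The case of degree 1, in which evaluation at the root of [p] suffices. *)
Lemma linear_value N (G : 'M[R]_N) (p h : {poly R}) (w : 'rV[{poly R}]_N) :
  p \is monic -> size p = 2 -> pform G w w = 'X + h * p ->
  exists x, gform G x x = - p.[0].
Proof.
move=> pm sp Qw; pose r := - p.[0]; have pr : p.[r] = 0.
  have pE : p = 'X + (p`_0)%:P.
    apply/polyP=> -[|[|i]]; rewrite coefD coefX coefC ?add0r //=.
      by have := monicP pm; rewrite lead_coefE sp /= => ->; rewrite ?addr0.
    by rewrite ?addr0 nth_default // sp.
  by rewrite /r {1}pE !hornerE horner_coef0 addNr.
exists (map_mx (horner_eval r) w).
by rewrite -pform_horner Qw hornerD hornerX hornerM pr mulr0 addr0.
Qed.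

(** The value at a constant vector given by the descent is a unit. *)
Lemma monogenic_represents_unit N n (G : 'M[R]_N) (p h : {poly R})
    (w : 'rV[{poly R}]_N) :
  G^T = G -> p \is monic -> size p = n.+2 -> p.[0] \is a GRing.unit ->
  pform G w w = 'X + h * p -> exists x, gform G x x \is a GRing.unit.
Proof.
move=> Gsym pm; case: n => [|n] sp p0 Qw.
  by have [x xE] := linear_value pm sp Qw; exists x; rewrite xE unitrN.
have [p' [h' [w' [x [_ _ p'0 _ xE]]]]] := descent Gsym pm sp p0 Qw.
by exists x; rewrite -[gform G x x]opprK -xE unitrN unitrM p0.
Qed.

(** The norm principle for [R[X]/(p)] and the class of ['X], whose norm is
    [(-1) ^+ n * p.[0]] and which is a value of the form by the hypothesis on
    [w]. *)
Lemma norm_principle_monogenic N n (G : 'M[R]_N) (p h : {poly R})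
    (w : 'rV[{poly R}]_N) (D : set R) :
  G^T = G -> unit_subgroup D ->
  (forall x, is_unit (gform G x x) -> D (gform G x x)) ->
  p \is monic -> size p = n.+1 -> p.[0] \is a GRing.unit ->
  pform G w w = 'X + h * p -> D ((-1) ^+ n * p.[0]).
Proof.
move=> Gsym [_ D1 DM DV] Dval.
elim/ltn_ind: n p h w => -[|[|n]] IH p h w pm sp p0 Qw.
- have pE : p = (p`_0)%:P by apply: size1_polyC; rewrite sp.
  have : lead_coef p = 1 by exact/monicP.
  by rewrite pE lead_coefC hornerC mul1r => ->.
- have [x xE] := linear_value pm sp Qw.
  by rewrite expr1 mulN1r -xE; apply: Dval; rewrite xE; apply/is_unitP; rewrite unitrN.
have [p' [h' [w' [x [p'm sp' p'0 Qw' xE]]]]] := descent Gsym pm sp p0 Qw.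
have /(_ (ltnSn _)) := IH n.+1 _ p' h' w' p'm sp' p'0 Qw'.
set b := _ * p'.[0] => Db.
have bU : b \is a GRing.unit by rewrite unitrM p'0 unitrX ?unitrN1.
have -> : (-1) ^+ n.+2 * p.[0] = gform G x x * b^-1.
  apply: (mulIr bU); rewrite mulrVK // /b.
  transitivity (- (((-1) ^+ n.+1 * (-1) ^+ n.+1) * (p.[0] * p'.[0]))).
    by rewrite exprS; ring.
  by rewrite -exprD addnn -signr_odd odd_double expr0 mul1r xE opprK.
apply: DM; last by apply: (DV b); rewrite // mulrV.
apply: Dval; apply/is_unitP.
by rewrite -[gform G x x]opprK -xE unitrN unitrM p0.
Qed.
End Core.

(** * Splitting fields and Fitting decompositions *)

(** Every nonzero polynomial over a field splits over some extension; roots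
    are adjoined one at a time, in residue fields of the polynomial ring. *)
Lemma splitting_field (k : fieldType) (f : {poly k}) : f != 0 ->
  exists (K : fieldType) (iota : {rmorphism k -> K}) (s : seq K) (c : K),
    map_poly iota f = c *: \prod_(x <- s) ('X - x%:P).
Proof.
have [n] := ubnP (size f); elim: n => // n IH in k f *; rewrite ltnS => sf f0.
have [s1|s1] := leqP (size f) 1.
  exists k, idfun, [::], f`_0; rewrite big_nil alg_polyC.
  by rewrite map_poly_id // -size1_polyC.
have fU : f \isn't a GRing.unit by rewrite poly_unitE gtn_eqF.
have [I Imax fI] := nonunit_maximal_ideal fU.
pose res := @residue_map _ _ Imax.
pose iota1 : {rmorphism k -> residue_field Imax} :=
  (res \o polyC : {rmorphism k -> residue_field Imax}).
pose a := res 'X.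
have : root (map_poly iota1 f) a.
  rewrite /root /iota1 map_poly_comp /= horner_map /=.
  by rewrite -[(map_poly polyC f).['X]]/(f \Po 'X) comp_polyXr residue_map_eq0.
move=> /factor_theorem[g gE].
have f10 : map_poly iota1 f != 0 by rewrite map_poly_eq0.
have g0 : g != 0 by apply: contraNneq f10 => g0; rewrite gE g0 mul0r.
have sg : (size g < n)%N.
  have := congr1 (size : {poly _} -> nat) gE.
  rewrite size_map_poly size_Mmonic ?monicXsubC // size_XsubC addn2 /=.
  by move=> sE; rewrite -ltnS -sE ltnS.
have [K [iota2 [s [c E]]]] := IH _ g sg g0.
exists K, (iota2 \o iota1 : {rmorphism k -> K}), (iota2 a :: s), c.
rewrite map_poly_comp gE rmorphM /= E big_cons rmorphB /= map_polyX map_polyC /=.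
by rewrite -scalerAl mulrC.
Qed.

(** Fitting decomposition for commuting endomorphisms [T i]: if the vectors
    killed by all products [T i *m T j] are already killed by all [T i], then
    there is a projector onto the common kernel of the [T i] that commutes with
    all endomorphisms that commute with the [T i]. *)
Section Fitting.
Variables (k : fieldType) (m : nat) (I : finType) (T : I -> 'M[k]_m.+1).
Hypothesis Tcomm : forall i j, T i *m T j = T j *m T i.

(** [F] is, up to a constant, the characteristic polynomial of [A] deprived of
    its factors ['X]. *)
Lemma fitting_polynomial (A : 'M[k]_m.+1) :
  exists (F : {poly k}) (N : nat), F.[0] = 1 /\ horner_mx A F *m A ^+ N = 0.
Proof.
have [N [q]] := multiplicity_XsubC (char_poly A) 0.
rewrite monic_neq0 ?char_poly_monic //= => q0; rewrite subr0 => cE.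
exists (q.[0]^-1 *: q), N; split; first by rewrite hornerZ mulVf.
have := Cayley_Hamilton A; rewrite cE rmorphM rmorphXn /= horner_mx_X => E.
by rewrite linearZ /= -scalemxAl [X in _ *: X]E scaler0.
Qed.

Lemma fitting_seq (s : seq I) : exists P : 'M[k]_m.+1,
  [/\ forall A, (forall i, A *m T i = T i *m A) -> A *m P = P *m A,
      forall z : 'rV_m.+1, (forall i, z *m T i = 0) -> z *m P = z &
      forall i, i \in s -> exists N, P *m T i ^+ N = 0].
Proof.
elim: s => [|i s [P [Pcomm Pfix Pnil]]].
  by exists 1%:M; split=> // [A _|z _]; rewrite ?mulmx1 ?mul1mx.
have [F [N [F0 FN]]] := fitting_polynomial (T i).
exists (horner_mx (T i) F *m P); split=> [A AT|z zT|j].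
- rewrite -mulmxA -Pcomm // !mulmxA; congr (_ *m _).
  by apply: comm_mx_horner; exact: AT.
- rewrite mulmxA; have -> : z *m horner_mx (T i) F = z; last exact: Pfix.
  have FE : F = drop_poly 1 F * 'X + 1.
    rewrite -{1}[F](poly_take_drop 1) addrC expr1; congr (_ + _).
    have /size1_polyC-> : (size (take_poly 1 F) <= 1)%N by exact: size_take_poly.
    by rewrite coef_take_poly /= -horner_coef0 F0.
  rewrite FE rmorphD rmorphM /= horner_mx_X rmorph1 mulmxDr mulmx1.
  rewrite [X in z *m X](_ : _ = T i *m horner_mx (T i) (drop_poly 1 F)).
    by rewrite mulmxA zT mul0mx add0r.
  by apply/esym/comm_mx_horner.
- rewrite inE => /orP[/eqP->|js].
    exists N; have -> : horner_mx (T i) F *m P = P *m horner_mx (T i) F.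
      by apply: Pcomm => l; apply: comm_horner_mx; exact: Tcomm.
    by rewrite -mulmxA FN mulmx0.
  by have [N' PN'] := Pnil j js; exists N'; rewrite -mulmxA PN' mulmx0.
Qed.

Hypothesis Tker : forall x : 'rV[k]_m.+1,
  (forall i j, x *m T i *m T j = 0) -> forall i, x *m T i = 0.

(** A counterexample [y] can be multiplied by powers of the [T i], one after the
    other, until it is not in the common kernel but all its images are. *)
Lemma nilpotent_ker (y : 'rV[k]_m.+1) :
  (forall i, exists N, y *m T i ^+ N = 0) -> forall i, y *m T i = 0.
Proof.
move=> ynil; pose W (x : 'rV[k]_m.+1) := forall i, x *m T i = 0.
suff : W y by []. apply: contrapT => yW.
have Tpow j i n : T j *m T i ^+ n = T i ^+ n *m T j.
  by apply: commrX; exact: Tcomm.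
have WT x n i : W x -> W (x *m T i ^+ n).
  by move=> xW j; rewrite -mulmxA -Tpow mulmxA xW mul0mx.
have [x [xnil xW xT]] : exists x, [/\ forall i, exists N, x *m T i ^+ N = 0,
    ~ W x & forall i, i \in enum I -> W (x *m T i)].
  elim: (enum I) => [|i s [x [xnil xW xs]]]; first by exists y.
  have : exists n, `[< W (x *m T i ^+ n) >].
    have [N xN] := xnil i; exists N; apply/asboolP => j.
    by rewrite xN mul0mx.
  case/ex_minnP => -[|n] /asboolP xn nmin.
    by case: xW => j; have := xn j; rewrite expr0 mulmx1.
  exists (x *m T i ^+ n); split=> [j||j].
  - have [N xN] := xnil j; exists N.
    have -> : x *m T i ^+ n *m T j ^+ N = x *m T j ^+ N *m T i ^+ n.
      rewrite -!mulmxA; congr (_ *m _).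
      by apply: commrX; apply/commr_sym/commrX; exact: Tcomm.
    by rewrite xN mul0mx.
  - by move=> /asboolP /nmin; rewrite ltnn.
  - rewrite inE => /orP[/eqP->|js].
      by move: xn; rewrite exprSr mulmxA.
    rewrite -mulmxA -Tpow mulmxA; exact/WT/xs.
by apply: xW; apply: Tker => i j; apply: xT; rewrite mem_enum.
Qed.

Lemma fitting_projector : exists P : 'M[k]_m.+1,
  [/\ forall A, (forall i, A *m T i = T i *m A) -> A *m P = P *m A,
      forall z : 'rV_m.+1, (forall i, z *m T i = 0) -> z *m P = z &
      forall (z : 'rV_m.+1) i, z *m P *m T i = 0].
Proof.
have [P [Pcomm Pfix Pnil]] := fitting_seq (enum I).
exists P; split=> // z; apply: nilpotent_ker => i.
have [|N PN] := Pnil i; first by rewrite mem_enum.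
by exists N; rewrite -mulmxA PN mulmx0.
Qed.
End Fitting.

(** * The trace form of an unramified algebra *)

(** A commutative algebra [A] of dimension [d.+1] over [k] with a basis indexed
    by ['I_d.+1], in its regular representation: [M i] is the matrix of the
    multiplication by the [i]-th basis vector, and [u] is the row of coordinates
    of 1. *)
Section RegularRepresentation.
Variables (k : fieldType) (d : nat) (M : 'I_d.+1 -> 'M[k]_d.+1) (u : 'rV[k]_d.+1).
Hypothesis Mcomm : forall i j, M i *m M j = M j *m M i.
Hypothesis Mcyc : forall i, u *m M i = delta_mx 0 i.

(** The matrix of the multiplication by the element of coordinates [z]. *)
Definition regular (z : 'rV[k]_d.+1) : 'M[k]_d.+1 := \sum_i z 0 i *: M i.

Lemma regular1 z : u *m regular z = z.
Proof.
rewrite mulmx_sumr [RHS]row_sum_delta; apply: eq_bigr => i _.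
by rewrite -scalemxAr Mcyc.
Qed.

Lemma regular_comm Y z : (forall i, M i *m Y = Y *m M i) ->
  regular z *m Y = Y *m regular z.
Proof.
move=> YM; rewrite mulmx_suml mulmx_sumr; apply: eq_bigr => i _.
by rewrite -scalemxAl YM -scalemxAr.
Qed.

Lemma regular_commM z i : M i *m regular z = regular z *m M i.
Proof. by apply/esym/regular_comm => j; exact: Mcomm. Qed.

(** The algebra is its own commutant. *)
Lemma commutant_regular Y : (forall i, M i *m Y = Y *m M i) -> Y = regular (u *m Y).
Proof.
move=> YM; apply/row_matrixP => j; rewrite !rowE -!Mcyc -!mulmxA YM mulmxA.
rewrite [M j *m _]regular_commM [RHS]mulmxA; congr (_ *m _).
by rewrite regular1.
Qed.

(** The condition [unram] says that derivations of [A] that are given by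
    commutators vanish; the trace form of [A] is then nondegenerate. *)
Hypothesis unram : forall X : 'M[k]_d.+1,
  (forall i j, let D := M i *m X - X *m M i in M j *m D = D *m M j) ->
  forall i, M i *m X = X *m M i.

Lemma mxvec_inj_mul m n p (P P' : 'M[k]_(m * n, p)) :
  (forall X, mxvec X *m P = mxvec X *m P') -> P = P'.
Proof.
by move=> PP'; apply/row_matrixP => i; rewrite !rowE -(vec_mxK (delta_mx 0 i)) PP'.
Qed.

(** By [unram], the Fitting decomposition applies to the endomorphisms
    [X |-> M i *m X - X *m M i] of the space of matrices. It yields a projector
    [Pi] of this space onto the commutant of [A], which is [A]; it is linear over
    [A] on both sides. Writing [Z = regular z] as a sum of [Z *m (e i)^T *m u *m M i]
    and moving the [M i] to the other side of the matrices, one finds that [Z]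
    is the image under [Pi] of a matrix whose entries are multiples of the
    traces [\tr (M j *m Z)]. *)
Lemma trace_nondegenerate z :
  (forall j, \tr (M j *m regular z) = 0) -> regular z = 0.
Proof.
pose m := (d + d * d.+1)%N.
(* [m.+1] is convertible to [d.+1 * d.+1]. *)
pose vec (X : 'M[k]_d.+1) : 'rV[k]_m.+1 := mxvec X.
pose Lm (A : 'M[k]_d.+1) : 'M[k]_m.+1 := @lin_mulmx k d.+1 d.+1 d.+1 A.
pose Rm (A : 'M[k]_d.+1) : 'M[k]_m.+1 := @lin_mulmxr k d.+1 d.+1 d.+1 A.
have LmE A X : vec X *m Lm A = vec (A *m X)
  by exact (mul_vec_lin (mulmx A) X).
have RmE A X : vec X *m Rm A = vec (X *m A)
  by exact (mul_vec_lin (mulmxr A) X).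
pose mat (x : 'rV[k]_m.+1) : 'M[k]_d.+1 := @vec_mx k d.+1 d.+1 x.
have matK x : vec (mat x) = x by exact (@vec_mxK k d.+1 d.+1 x).
have vec_inj : injective vec by exact (can_inj (@mxvecK k d.+1 d.+1)).
have vecB X Y : vec (X - Y) = vec X - vec Y.
  have E : mxvec (X - Y) = mxvec X - mxvec Y by exact: linearB.
  exact E.
have vecD X Y : vec (X + Y) = vec X + vec Y.
  have E : mxvec (X + Y) = mxvec X + mxvec Y by exact: linearD.
  exact E.
have vec0 : vec 0 = 0.
  have E : mxvec (0 : 'M[k]_d.+1) = 0 by rewrite linear0.
  exact E.
have vec_ext (P P' : 'M[k]_m.+1) : (forall X, vec X *m P = vec X *m P') -> P = P'.
  exact: (@mxvec_inj_mul d.+1 d.+1 m.+1).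
pose T i := Lm (M i) - Rm (M i).
have TE i X : vec X *m T i = vec (M i *m X - X *m M i).
  by rewrite mulmxBr LmE RmE vecB.
have LT A : (forall i, M i *m A = A *m M i) ->
    forall i, Lm A *m T i = T i *m Lm A.
  move=> AM i; apply: vec_ext => X.
  by rewrite !mulmxA LmE !TE LmE mulmxBr !mulmxA AM.
have RT A : (forall i, M i *m A = A *m M i) ->
    forall i, Rm A *m T i = T i *m Rm A.
  move=> AM i; apply: vec_ext => X.
  by rewrite !mulmxA RmE !TE RmE mulmxBl -!mulmxA AM.
have [||P [Pcomm Pfix Pker]] := @fitting_projector k m 'I_d.+1 T.
- move=> i j; apply: vec_ext => X; rewrite !mulmxA !TE; congr vec.
  rewrite !mulmxBr !mulmxBl !mulmxA (Mcomm j i) -[X *m M i *m M j]mulmxA.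
  rewrite (Mcomm i j) !mulmxA !opprB addrACA [RHS]addrACA.
  by congr (_ + _); exact: addrC.
- move=> x xT i.
  rewrite -(matK x) TE unram ?subrr ?vec0 // => i' j /=.
  apply/eqP; rewrite -subr_eq0; apply/eqP/vec_inj.
  by rewrite -!TE matK vec0.
pose Pi X := mat (vec X *m P).
have vPi X : vec (Pi X) = vec X *m P by exact: matK.
have PiL A X : (forall i, M i *m A = A *m M i) -> Pi (A *m X) = A *m Pi X.
  move=> AM; apply: vec_inj; rewrite vPi -!LmE vPi -!mulmxA; congr (_ *m _).
  exact/Pcomm/LT.
have PiR A X : (forall i, M i *m A = A *m M i) -> Pi (X *m A) = Pi X *m A.
  move=> AM; apply: vec_inj; rewrite vPi -!RmE vPi -!mulmxA; congr (_ *m _).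
  exact/Pcomm/RT.
have PiC X i : M i *m Pi X = Pi X *m M i.
  apply/eqP; rewrite -subr_eq0; apply/eqP/vec_inj.
  by rewrite -TE vPi Pker vec0.
have PiFix A : (forall i, M i *m A = A *m M i) -> Pi A = A.
  move=> AM; apply: vec_inj; rewrite vPi; apply: Pfix => i.
  by rewrite TE AM subrr vec0.
have PiD (I : finType) (F : I -> 'M[k]_d.+1) : Pi (\sum_i F i) = \sum_i Pi (F i).
  have vecS (H : I -> 'M[k]_d.+1) : vec (\sum_i H i) = \sum_i vec (H i).
    apply: (big_ind2 (fun x y => vec x = y)) => // x1 x2 y1 y2 <- <-.
    exact: vecD.
  apply: vec_inj; rewrite vPi !vecS mulmx_suml.
  by apply: eq_bigr => i _; rewrite vPi.
move=> trz; set Z := regular z in trz *.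
have ZM i : M i *m Z = Z *m M i by exact: regular_commM.
pose e i : 'rV[k]_d.+1 := delta_mx 0 i.
have ZE : Z = \sum_i Z *m (e i)^T *m u *m M i.
  rewrite -[LHS]mulmx1.
  have -> : 1%:M = \sum_i (e i)^T *m u *m M i :> 'M[k]_d.+1.
    rewrite mx1_sum_delta; apply: eq_bigr => i _.
    by rewrite -mulmxA Mcyc /e trmx_delta mul_delta_mx.
  by rewrite mulmx_sumr; apply: eq_bigr => i _; rewrite !mulmxA.
have PiZ : Z = Pi (\sum_i M i *m (Z *m (e i)^T *m u)).
  rewrite -[LHS]PiFix // {1}ZE !PiD; apply: eq_bigr => i _.
  rewrite PiR; last by move=> j; exact: Mcomm.
  rewrite PiL; last by move=> j; exact: Mcomm.
  by rewrite PiC.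
rewrite PiZ.
have -> : \sum_i M i *m (Z *m (e i)^T *m u) = 0.
  under eq_bigr => i _ do rewrite !mulmxA.
  rewrite -!mulmx_suml; suff -> : \sum_i M i *m Z *m (e i)^T = 0 by rewrite mul0mx.
  apply/row_matrixP => j; rewrite row0 rowE -Mcyc mulmx_sumr.
  apply/rowP => l; rewrite [RHS]mxE ord1 -(trz j) summxE; apply: eq_bigr => i _.
  rewrite !mulmxA -[u *m _ *m _]mulmxA Mcomm mulmxA Mcyc -!mulmxA -rowE.
  by rewrite mulmxA /e trmx_delta -colE !mxE.
by apply: vec_inj; rewrite vPi vec0 mul0mx.
Qed.
End RegularRepresentation.

(** * Generators in a given square class *)

Lemma trace_square_zero (K : fieldType) n (Y : 'M[K]_n) : Y *m Y = 0 -> \tr Y = 0.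
Proof.
rewrite -{1 2}(mulmx_base Y) mulmxA -(mulmxA (col_base Y)) => /eqP.
rewrite mulmx_free_eq0 ?row_base_free // => /eqP CRC.
rewrite -(mulmx_base Y) mxtrace_mulC.
suff -> : row_base Y *m col_base Y = 0 by rewrite mxtrace0.
have /row_fullP[B BC] := col_base_full Y.
by rewrite -[LHS]mul1mx -BC -mulmxA CRC mulmx0.
Qed.

(** A natural function [F] that does not vanish at a point over an extension of
    an infinite field [k] does not vanish at some point over [k]. The
    coordinates are moved to [k] one at a time; applied over [{poly K}], [F] is
    a polynomial in the coordinate that moves. *)
Lemma specialization (k K : fieldType) (iota : {rmorphism k -> K}) d
    (F : forall L : comNzRingType, {rmorphism k -> L} -> 'rV[L]_d -> L)
    (c : 'rV[K]_d) :
  (forall s : seq k, exists x, x \notin s) ->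
  (forall (L L' : comNzRingType) (f : {rmorphism k -> L}) (f' : {rmorphism k -> L'})
     (g : {rmorphism L -> L'}), (forall x, g (f x) = f' x) ->
     forall c, g (F L f c) = F L' f' (map_mx g c)) ->
  F K iota c != 0 -> exists c0, F k idfun c0 != 0.
Proof.
move=> kinf Fnat Fc.
have nonroot (f : {poly K}) : f != 0 -> exists x, f.[iota x] != 0.
  move=> f0; have [t [ut st _]] := infinite_uniq kinf [::] (size f).
  apply: contrapT => no; have /negP[] := f0.
  apply/eqP/(@roots_geq_poly_eq0 _ _ (map iota t)).
  - apply/allP => _ /mapP[x _ ->]; rewrite /root; apply: contrapT => /negP fx.
    by apply: no; exists x.
  - by rewrite map_inj_uniq //; exact: fmorph_inj.
  - by rewrite size_map st.
have step : forall j, (j <= d)%N ->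
    exists2 c' : 'rV[K]_d, (forall i : 'I_d, (i < j)%N -> exists x, c' 0 i = iota x)
      & F K iota c' != 0.
  elim=> [|j IH] jd; first by exists c.
  have [c' c'k Fc'] := IH (ltnW jd).
  pose cX : 'rV[{poly K}]_d := \row_i (if i == j :> nat then 'X else (c' 0 i)%:P).
  pose f := F _ (polyC \o iota : {rmorphism k -> {poly K}}) cX.
  have fE a : f.[a] = F K iota (\row_i if i == j :> nat then a else c' 0 i).
    rewrite -[f.[a]]/(horner_eval a f) (Fnat _ _ _ iota).
      congr F; apply/rowP=> i; rewrite !mxE /horner_eval.
      by case: ifP => _; [exact: hornerX|exact: hornerC].
    by move=> x; exact: hornerC.
  have [|x fx] := nonroot f.
    apply: contraNneq Fc' => f0; have := fE (c' 0 (Ordinal jd)).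
    rewrite f0 horner0 => ->; apply/eqP; congr F; apply/rowP=> i; rewrite mxE.
    by case: eqP => // ij; congr (c' 0 _); apply: val_inj.
  exists (\row_i if i == j :> nat then iota x else c' 0 i); last by rewrite -fE.
  move=> i; rewrite ltnS leq_eqVlt mxE => /orP[->|ij]; first by exists x.
  by rewrite ltn_eqF //; exact: c'k.
have [c' c'k Fc'] := step d (leqnn d).
have /choice[x xE] : forall i, exists x, c' 0 i = iota x.
  by move=> i; apply: c'k; exact: ltn_ord.
exists (\row_i x i); apply: contraNneq Fc' => F0.
have -> : c' = map_mx iota (\row_i x i) by apply/rowP=> i; rewrite !mxE xE.
by rewrite -(Fnat _ _ idfun iota iota) // F0 rmorph0.
Qed.

Lemma distinct_square_multiples (k K : fieldType) (iota : {rmorphism k -> K}) n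
    (sigma : 'I_n -> K) :
  (forall s : seq k, exists x, x \notin s) -> (forall i, sigma i != 0) ->
  exists gamma : 'I_n -> K, (forall i, gamma i != 0) /\
    injective (fun i => gamma i ^+ 2 * sigma i).
Proof.
move=> kinf s0.
have Kinf (s : seq K) : exists x, x \notin s.
  have [t [ut st _]] := infinite_uniq kinf [::] (size s).+1.
  apply: contrapT => no.
  have sub : {subset map iota t <= s}.
    by move=> y _; apply: contrapT => /negP ys; apply: no; exists y.
  have := uniq_leq_size _ sub; rewrite map_inj_uniq; last exact: fmorph_inj.
  by rewrite size_map st ltnn => /(_ ut).
pose f (i j : 'I_n) : {poly K} := sigma i *: 'X^(i.*2) - sigma j *: 'X^(j.*2).
have [|t] := infinite_nonroot Kinf (f := 'X * \prod_i \prod_(j | i != j) f i j).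
  rewrite mulf_neq0 ?polyX_eq0 //; apply/prodf_neq0 => i _.
  apply/prodf_neq0 => j ij; apply/eqP => /(congr1 (fun g : {poly K} => g`_(i.*2))).
  rewrite coefB !coefZ !coefXn coef0 eqxx.
  have -> : (i.*2 == j.*2) = false.
    by rewrite -!muln2 eqn_pmul2r //; exact: negbTE.
  by rewrite mulr0 subr0 mulr1 => /eqP; rewrite (negPf (s0 i)).
rewrite hornerM hornerX mulf_eq0 negb_or => /andP[t0].
rewrite horner_prod => /prodf_neq0 ft.
(* The powers of an element [t] in general position. *)
exists (fun i : 'I_n => t ^+ i); split=> [i|i j E]; first by rewrite expf_neq0.
apply/eqP; apply: contrapT => /negP ij.
have := ft i isT; rewrite horner_prod => /prodf_neq0 /(_ j ij).
rewrite /f hornerD hornerN !hornerZ !hornerXn subr_eq0 => /eqP; apply.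
by move: E => /=; rewrite -!exprM !muln2 mulrC [RHS]mulrC.
Qed.

(** This product of determinants is a unit if and only if [c] is invertible and
    the powers of [c ^ 2 * s] form a basis of the algebra with regular
    representation [M], extended to [L]; [s] is given by its matrix [A]. *)
Definition generator_det (k : fieldType) d (M : 'I_d.+1 -> 'M[k]_d.+1) (u : 'rV[k]_d.+1)
    (A : 'M[k]_d.+1) (L : comNzRingType) (f : {rmorphism k -> L}) (c : 'rV[L]_d.+1) : L :=
  let C := \sum_i c 0 i *: map_mx f (M i) in
  \det C * \det (\matrix_i (map_mx f u *m (C *m C *m map_mx f A) ^+ i)).

Section Generator.
Variables (k : fieldType) (d : nat) (M : 'I_d.+1 -> 'M[k]_d.+1) (u : 'rV[k]_d.+1).
Hypothesis k_inf : forall s : seq k, exists x, x \notin s.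
Hypothesis Mcomm : forall i j, M i *m M j = M j *m M i.
Hypothesis Mcyc : forall i, u *m M i = delta_mx 0 i.
Hypothesis unram : forall X : 'M[k]_d.+1,
  (forall i j, let D := M i *m X - X *m M i in M j *m D = D *m M j) ->
  forall i, M i *m X = X *m M i.
Variable A : 'M[k]_d.+1.
Hypotheses (AM : forall i, M i *m A = A *m M i) (Aunit : A \in unitmx).

Lemma generator_det_natural (L L' : comNzRingType) (f : {rmorphism k -> L})
    (f' : {rmorphism k -> L'}) (g : {rmorphism L -> L'}) : (forall x, g (f x) = f' x) ->
  forall c, g (generator_det M u A f c) = generator_det M u A f' (map_mx g c).
Proof.
move=> gf c; rewrite /generator_det rmorphM -!det_map_mx /=.
have mE m n (B : 'M[k]_(m, n)) : map_mx g (map_mx f B) = map_mx f' B.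
  by apply/matrixP=> i j; rewrite !mxE gf.
have -> : map_mx g (\sum_i c 0 i *: map_mx f (M i)) =
    \sum_i (map_mx g c) 0 i *: map_mx f' (M i).
  rewrite raddf_sum; apply: eq_bigr => i _ /=.
  by rewrite map_mxZ mE mxE.
congr (_ * \det _); apply/row_matrixP => i.
rewrite -map_row !rowK map_mxM mE rmorphXn /= !map_mxM mE.
congr (_ *m (_ *m _ *m _) ^+ _).
  rewrite raddf_sum; apply: eq_bigr => j _ /=.
  by rewrite map_mxZ mE mxE.
rewrite raddf_sum; apply: eq_bigr => j _ /=.
by rewrite map_mxZ mE mxE.
Qed.

Section Extension.
Variables (K : fieldType) (iota : {rmorphism k -> K}).
Let MK i := map_mx iota (M i).
Let uK := map_mx iota u.

Let MKcomm i j : MK i *m MK j = MK j *m MK i.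
Proof. by rewrite -!map_mxM Mcomm. Qed.

Let MKcyc i : uK *m MK i = delta_mx 0 i.
Proof. by rewrite -map_mxM Mcyc map_delta_mx. Qed.

(** The trace form remains nondegenerate over an extension [K], and the trace of
    every multiple of an element of square zero vanishes. *)
Lemma regular_square_zero z : regular MK z *m regular MK z = 0 -> regular MK z = 0.
Proof.
move=> z2; pose Tr := \matrix_(i, j) \tr (M i *m M j).
have Trunit : Tr \in unitmx.
  rewrite -row_free_unit -kermx_eq0; apply/rowV0P => y /sub_kermxP yTr.
  rewrite -(regular1 Mcyc y) (trace_nondegenerate Mcomm Mcyc unram) ?mulmx0 //.
  move=> j; rewrite /regular mulmx_sumr raddf_sum /=.
  transitivity ((y *m Tr) 0 j); last by rewrite yTr mxE.
  rewrite mxE; apply: eq_bigr => i _.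
  by rewrite -scalemxAr mxtraceZ mxE mxtrace_mulC.
have zTr : z *m map_mx iota Tr = 0.
  apply/rowP=> j; rewrite [RHS]mxE.
  transitivity (\tr (regular MK z *m MK j)).
    rewrite /regular mulmx_suml raddf_sum mxE /=; apply: eq_bigr => i _.
    by rewrite -scalemxAl mxtraceZ !mxE -map_mxM trace_map_mx.
  apply: trace_square_zero.
  have E := regular_commM MKcomm z j.
  by rewrite mulmxA -(mulmxA (regular MK z)) E !mulmxA z2 !mul0mx.
have z0 : z = 0.
  apply/eqP; rewrite -(mulmx_free_eq0 _ (_ : row_free (map_mx iota Tr))).
    by rewrite zTr.
  by rewrite row_free_unit map_unitmx.
by rewrite z0 /regular big1 // => i _; rewrite mxE scale0r.
Qed.

Lemma regular_reduced Y N : (forall i, MK i *m Y = Y *m MK i) -> Y ^+ N = 0 -> Y = 0.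
Proof.
move=> YM YN; apply: contrapT => Y0.
have ex : exists n, Y ^+ n == 0 by exists N; rewrite YN.
case: (ex_minnP ex) => n /eqP Yn nmin.
have n1 : (1 < n)%N.
  case: n Yn {nmin} => [|[|n]] // Yn; case: Y0.
  by rewrite -[Y]mulr1 -[1](expr0 Y) Yn mulr0.
pose Z := Y ^+ n.-1.
have ZM i : MK i *m Z = Z *m MK i by apply: commrX; exact: YM.
have ZE := commutant_regular MKcomm MKcyc ZM.
have : Z *m Z = 0.
  rewrite -[Z *m Z]/(Z * Z) -exprD.
  by rewrite (_ : (n.-1 + n.-1)%N = (n + (n - 2))%N) ?exprD ?Yn ?mul0r //; lia.
rewrite ZE => /regular_square_zero; rewrite -ZE => /eqP /nmin.
by rewrite -ltnS prednK ?ltnn // ltnW.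
Qed.

(** The product of the ['X - x%:P], for [x] running once through each root in
    [s], kills [MK i]: its value there is nilpotent, and the algebra is
    reduced. *)
Lemma regular_codiagonalizable (s : seq K) (c : K) :
  map_poly iota (\prod_i char_poly (M i)) = c *: \prod_(x <- s) ('X - x%:P) ->
  codiagonalizable (codom MK).
Proof.
move=> split; apply/codiagonalizableP; split.
  by move=> _ _ /codomP[i ->] /codomP[j ->]; exact: MKcomm.
move=> _ /codomP[i ->]; apply/diagonalizableP.
exists (undup s); first exact: undup_uniq.
apply: mxminpoly_min; set g := \prod_(x <- undup s) _.
apply: (@regular_reduced _ (size s)).
  by move=> j; apply: comm_mx_horner; exact: MKcomm.
have chardvd : char_poly (MK i) %| g ^+ size s.
  apply: (@dvdp_trans _ (map_poly iota (\prod_i char_poly (M i)))).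
    rewrite -map_char_poly dvdp_map (bigD1 i) //=; exact: dvdp_mulr.
  have f0 : \prod_i char_poly (M i) != 0.
    by apply/prodf_neq0 => j _; exact/monic_neq0/char_poly_monic.
  have c0 : c != 0.
    by apply: contraNneq f0 => c0; rewrite -(map_poly_eq0 iota) split c0 scale0r.
  rewrite split dvdpZl //.
  have : {subset s <= undup s} by move=> x; rewrite mem_undup.
  elim: s {split} (s in undup s) @g => [|x s IH] s0 g sub.
    by rewrite big_nil dvd1p.
  rewrite big_cons exprS dvdp_mul ?IH //; last first.
    by move=> y ys; apply: sub; rewrite inE ys orbT.
  rewrite /g (big_rem x) /=; first exact: dvdp_mulr.
  by apply: sub; rewrite mem_head.
move: chardvd => /dvdpP[q qE].
rewrite -rmorphXn /= qE rmorphM /= Cayley_Hamilton.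
by rewrite mulr0.
Qed.
End Extension.

(** Over a splitting field [K], diagonalization identifies the algebra with a
    product of copies of [K]; [Delta] is the matrix of this isomorphism. An
    element of a product of fields is a generator if its components are pairwise
    distinct. *)
Lemma generator_exists : exists c : 'rV[k]_d.+1,
  regular M c \in unitmx /\
  \matrix_(i < d.+1) (u *m (regular M c *m regular M c *m A) ^+ i) \in unitmx.
Proof.
suff [c] : exists c, generator_det M u A idfun c != 0.
  rewrite /generator_det mulf_eq0 negb_or.
  have mid m n (B : 'M[k]_(m, n)) : map_mx idfun B = B.
    by apply/matrixP=> i j; rewrite mxE.
  have -> : \sum_i c 0 i *: map_mx idfun (M i) = regular M c.
    by apply: eq_bigr => i _; rewrite mid.
  rewrite !mid => /andP[C0 V0]; exists c.
  by rewrite !unitmxE !unitfE.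
have f0 : \prod_i char_poly (M i) != 0.
  by apply/prodf_neq0 => j _; exact/monic_neq0/char_poly_monic.
have [K [iota [s [c0 split]]]] := splitting_field f0.
suff [z Fz] : exists z, generator_det M u A iota z != 0.
  apply: (specialization (F := generator_det M u A) k_inf _ Fz).
  by move=> L L' f f' g gf c; exact: generator_det_natural.
have MKcomm i j : map_mx iota (M i) *m map_mx iota (M j)
    = map_mx iota (M j) *m map_mx iota (M i) by rewrite -!map_mxM Mcomm.
have MKcyc i : map_mx iota u *m map_mx iota (M i) = delta_mx 0 i.
  by rewrite -map_mxM Mcyc map_delta_mx.
have [P Pu /allP Pdiag] := regular_codiagonalizable split.
pose MK i := map_mx iota (M i); pose uK := map_mx iota u.
pose conj (Y : 'M[K]_d.+1) := P *m Y *m invmx P.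
have conjM Y Y' : conj (Y *m Y') = conj Y *m conj Y'.
  by rewrite /conj !mulmxA mulmxKV.
have conj_inj Y Y' : conj Y = conj Y' -> Y = Y'.
  move=> E; have : invmx P *m conj Y *m P = invmx P *m conj Y' *m P by rewrite E.
  by rewrite /conj !mulmxA mulVmx // !mul1mx !mulmxKV.
have /choice[D DE] : forall i, exists D, conj (MK i) = diag_mx D.
  move=> i; have : MK i \in codom MK by exact: codom_f.
  move=> /Pdiag H; have {H} : is_diag_mx (conjmx P (MK i)) by exact: H.
  by rewrite conjumx // => /diag_mxP.
pose Delta : 'M[K]_d.+1 := \matrix_(i, j) D i 0 j.
have conj_reg z : conj (regular MK z) = diag_mx (z *m Delta).
  rewrite /conj /regular mulmx_sumr mulmx_suml.
  rewrite (eq_bigr (fun i => z 0 i *: diag_mx (D i))); last first.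
    by move=> i _; rewrite -scalemxAr -scalemxAl -DE.
  apply/matrixP=> i j; rewrite summxE !mxE -sumrMnl; apply: eq_bigr => l _.
  by rewrite !mxE -mulrnAr.
have conj0 : conj 0 = 0 by rewrite /conj mulmx0 mul0mx.
have Du : Delta \in unitmx.
  rewrite -row_free_unit -kermx_eq0; apply/rowV0P => y /sub_kermxP yD.
  rewrite -(regular1 MKcyc y) (_ : regular _ y = 0) ?mulmx0 //.
  by apply: conj_inj; rewrite conj0 conj_reg yD linear0.
pose AK := map_mx iota A.
have AKM i : MK i *m AK = AK *m MK i by rewrite -!map_mxM AM.
pose sigma := uK *m AK *m Delta.
have conjA : conj AK = diag_mx sigma.
  by rewrite -conj_reg -(commutant_regular MKcomm MKcyc AKM).
have s0 i : sigma 0 i != 0.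
  have : conj AK \in unitmx.
    by rewrite /conj !unitmx_mul Pu unitmx_inv Pu map_unitmx Aunit.
  rewrite conjA unitmxE det_diag unitfE => /prodf_neq0; exact.
clearbody sigma; have [gamma [g0 ginj]] := distinct_square_multiples iota k_inf s0.
pose z := (\row_i gamma i) *m invmx Delta; exists z.
pose C := regular MK z; pose e := C *m C *m AK.
have conjC : conj C = diag_mx (\row_i gamma i) by rewrite conj_reg mulmxKV.
have Cu : C \in unitmx.
  have : conj C \in unitmx.
    rewrite conjC unitmxE det_diag unitfE; apply/prodf_neq0 => i _.
    by rewrite mxE g0.
  by rewrite /conj !unitmx_mul => /andP[/andP[]].
have conje : conj e = diag_mx (\row_i (gamma i ^+ 2 * sigma 0 i)).
  rewrite /e !conjM conjC conjA !mulmx_diag; congr diag_mx.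
  by apply/rowP=> i; rewrite !mxE expr2.
have CM i : MK i *m C = C *m MK i by exact: (regular_commM MKcomm).
have eM i : MK i *m e = e *m MK i.
  by rewrite /e !mulmxA CM -(mulmxA C) CM -!mulmxA AKM.
rewrite /generator_det mulf_eq0 negb_or -/C -/AK -/e; apply/andP; split.
  by move: Cu; rewrite unitmxE unitfE.
rewrite -unitfE -unitmxE -row_free_unit -kermx_eq0; apply/rowV0P => y /sub_kermxP yV.
pose f := rVpoly y.
have fE : f = \sum_(i < d.+1) y 0 i *: 'X^i.
  by rewrite /f /rVpoly poly_def; apply: eq_bigr => i _; rewrite valK.
have uY : uK *m horner_mx e f = 0.
  rewrite -yV fE raddf_sum mulmx_sumr [RHS]mulmx_sum_row; apply: eq_bigr => i _.
  by rewrite /= linearZ /= rmorphXn /= horner_mx_X -scalemxAr rowK.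
have YM i : MK i *m horner_mx e f = horner_mx e f *m MK i.
  by apply: comm_mx_horner; exact: eM.
have Y0 : horner_mx e f = 0.
  rewrite (commutant_regular MKcomm MKcyc YM) uY /regular big1 // => i _.
  by rewrite mxE scale0r.
suff f00 : f = 0 by rewrite -(rVpolyK y) -/f f00 linear0.
pose ev i := gamma i ^+ 2 * sigma 0 i.
apply: (@roots_geq_poly_eq0 _ _ (codom ev)); last 2 first.
- by rewrite map_inj_uniq ?enum_uniq.
- by rewrite size_codom card_ord size_poly.
apply/allP => _ /codomP[i ->]; rewrite /root.
have := horner_mx_uconj f e (_ : P \is a GRing.unit).
rewrite -/(conj e) -/(conj _) Y0 conj0 conje horner_mx_diag => /(_ Pu).
move=> /(congr1 (fun B : 'M[K]_d.+1 => B i i)).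
by rewrite !mxE eqxx mulr1n => ->.
Qed.
End Generator.

(** * Fibers of an unramified algebra *)

(** Square matrices as a module over [S], which acts by left multiplication
    through a ring morphism [rho]. *)
Definition matrix_action (S : comPzRingType) (k : comNzRingType) d
    (rho : S -> 'M[k]_d)
    of [/\ rho 1 = 1%:M, forall a b, rho (a * b) = rho a *m rho b &
           forall a b, rho (a + b) = rho a + rho b] : Type := 'M[k]_d.

Section MatrixAction.
Variables (S : comPzRingType) (k : comNzRingType) (d : nat) (rho : S -> 'M[k]_d).
Hypothesis rhoP : [/\ rho 1 = 1%:M, forall a b, rho (a * b) = rho a *m rho b &
           forall a b, rho (a + b) = rho a + rho b].

HB.instance Definition _ := GRing.Zmodule.on (matrix_action rhoP).

Let scale (a : S) (Y : matrix_action rhoP) : matrix_action rhoP :=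
  rho a *m (Y : 'M[k]_d).

Let scaleA a b Y : scale a (scale b Y) = scale (a * b) Y.
Proof. by have [_ rhoM _] := rhoP; rewrite /scale mulmxA rhoM. Qed.

Let scale1 : left_id 1 scale.
Proof. by have [rho1 _ _] := rhoP; move=> Y; rewrite /scale rho1 mul1mx. Qed.

Let scaleDr : right_distributive scale +%R.
Proof. by move=> a Y Z; rewrite /scale mulmxDr. Qed.

Let scaleDl Y : {morph scale^~ Y : a b / a + b}.
Proof. by have [_ _ rhoD] := rhoP; move=> a b; rewrite /scale rhoD mulmxDl. Qed.

HB.instance Definition _ := GRing.Zmodule_isLmodule.Build S (matrix_action rhoP)
  scaleA scale1 scaleDr scaleDl.

Lemma matrix_actionE (a : S) (Y : matrix_action rhoP) :
  a *: Y = rho a *m (Y : 'M[k]_d) :> 'M[k]_d.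
Proof. by []. Qed.
End MatrixAction.

Section Fiber.
Variables (R : comNzRingType) (k : fieldType) (pi : {rmorphism R -> k}).
Hypothesis pi_surj : forall y, exists x, pi x = y.
Hypothesis k_inf : forall s : seq k, exists x, x \notin s.
Variables (S : comPzRingType) (iota : {rmorphism R -> S}).
Hypothesis S_fg : finitely_generated (restrict iota).
Hypothesis S_unram : unramified iota.

(** The extension to [S] of the kernel of [pi]. *)
Definition fiber_ideal (a : S) : Prop :=
  exists t : seq (R * S), all (fun p => pi p.1 == 0) t /\
    a = \sum_(p <- t) iota p.1 * p.2.

Lemma fiber_ideal0 : fiber_ideal 0.
Proof. by exists [::]; rewrite big_nil. Qed.

Lemma fiber_idealD a b : fiber_ideal a -> fiber_ideal b -> fiber_ideal (a + b).
Proof.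
move=> [t [tP ->]] [s [sP ->]]; exists (t ++ s).
by rewrite all_cat tP sP big_cat.
Qed.

Lemma fiber_idealM a b : fiber_ideal a -> fiber_ideal (b * a).
Proof.
move=> [t [tP ->]]; exists [seq (p.1, b * p.2) | p <- t]; split.
  by rewrite all_map.
by rewrite big_map mulr_sumr; apply: eq_bigr => p _; rewrite mulrCA.
Qed.

Lemma fiber_idealN a : fiber_ideal a -> fiber_ideal (- a).
Proof. by rewrite -mulN1r; exact: fiber_idealM. Qed.

Lemma fiber_idealB a b : fiber_ideal a -> fiber_ideal b -> fiber_ideal (a - b).
Proof. by move=> aI bI; apply: fiber_idealD => //; exact: fiber_idealN. Qed.

Lemma fiber_ideal_iota r : pi r = 0 -> fiber_ideal (iota r).
Proof.
by move=> r0; exists [:: (r, 1)]; rewrite /= r0 eqxx big_seq1 mulr1.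
Qed.

Lemma fiber_ideal_sum (I : finType) (F : I -> S) :
  (forall i, fiber_ideal (F i)) -> fiber_ideal (\sum_i F i).
Proof. by move=> FI; apply: big_ind => //; [exact: fiber_ideal0|exact: fiber_idealD]. Qed.

(** The combination of the [x i] with coefficients in [R]. *)
Definition fiber_comb d (x : 'I_d -> S) (c : 'I_d -> R) := \sum_i iota (c i) * x i.

(** A basis of [S] modulo [fiber_ideal] over [k]: a generating family of minimal
    size. *)
Lemma fiber_basis : exists d (x : 'I_d -> S),
  (forall a, exists c, fiber_ideal (a - fiber_comb x c)) /\
  (forall c, fiber_ideal (fiber_comb x c) -> forall i, pi (c i) = 0).
Proof.
pose spans d := exists x : 'I_d -> S, forall a, exists c, fiber_ideal (a - fiber_comb x c).
have : exists d, `[< spans d >].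
  have [n [g gP]] := S_fg; exists n; apply/asboolP; exists g => a.
  by have [c ->] := gP a; exists c; rewrite subrr; exact: fiber_ideal0.
case/ex_minnP => d /asboolP[x xP] dmin; exists d, x; split=> // c cI i.
apply: contrapT => /eqP ci.
case: d => [|d] in x xP dmin c cI i ci *; first by case: i ci.
have [r rE] := pi_surj (pi (c i))^-1.
suff : spans d by move=> /asboolP/dmin; rewrite ltnn.
exists (fun j => x (lift i j)) => a; have [b bI] := xP a.
exists (fun j => b (lift i j) - b i * (r * c (lift i j))).
have -> : a - fiber_comb (fun j => x (lift i j))
      (fun j => b (lift i j) - b i * (r * c (lift i j))) =
    (a - fiber_comb x b) + iota (b i) * (iota r * fiber_comb x c
      + x i * iota (1 - r * c i)).
  rewrite /fiber_comb (bigD1_ord i) //= [X in iota r * X](bigD1_ord i) //=.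
  set B := \sum_j _; set B' := \sum_(j < d) iota (b _) * _.
  set C := \sum_j _.
  have -> : B = B' - iota (b i) * (iota r * C).
    rewrite /B /B' /C !mulr_sumr -sumrB; apply: eq_bigr => j _.
    by rewrite rmorphB !rmorphM mulrBl !mulrA.
  rewrite rmorphB rmorphM rmorph1.
  move: (iota r) (iota (b i)) (iota (c i)) => r' b' c'.
  ring.
apply: fiber_idealD => //; apply/fiber_idealM/fiber_idealD.
  exact: fiber_idealM.
by apply/fiber_idealM/fiber_ideal_iota; rewrite rmorphB rmorphM rmorph1 rE mulVf ?subrr.
Qed.

(** In the fiber of [S] over [k], some [c] is invertible and [c ^ 2 * s] has a
    power basis; both depend only on the class of [c]. Coordinates [kap] in a
    basis of the fiber lead to its regular representation [rho], and the
    commutators [rho a *m X - X *m rho a] are derivations of [S] with values in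
    matrices when they commute with the image of [rho]. *)
Lemma fiber_generator (s : S) : is_unit s -> exists d (c : S), forall c', fiber_ideal (c' - c) ->
  [/\ forall a, exists f : 'I_d -> R,
        fiber_ideal (a - \sum_i iota (f i) * (c' ^+ 2 * s) ^+ i),
      forall f : 'I_d -> R, fiber_ideal (\sum_i iota (f i) * (c' ^+ 2 * s) ^+ i) ->
        forall i, pi (f i) = 0 &
      exists b, fiber_ideal (1 - c' * b)].
Proof.
move=> [s1 ss1]; have [d [x [xspan xfree]]] := fiber_basis.
have /choice[co coP] := xspan.
pose kap a : 'rV[k]_d := \row_i pi (co a i).
have combB c c' : fiber_comb x c - fiber_comb x c' = fiber_comb x (fun i => c i - c' i).
  by rewrite /fiber_comb -sumrB; apply: eq_bigr => i _; rewrite rmorphB mulrBl.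
have kapE a c : fiber_ideal (a - fiber_comb x c) -> kap a = \row_i pi (c i).
  move=> ac; apply/rowP=> i; rewrite !mxE; apply/eqP; rewrite -subr_eq0 -rmorphB.
  apply/eqP; apply: (xfree (fun i => co a i - c i)); rewrite -combB.
  have -> : fiber_comb x (co a) - fiber_comb x c =
      (a - fiber_comb x c) - (a - fiber_comb x (co a)) by ring.
  exact: fiber_idealB.
have kap_eq a b : fiber_ideal (a - b) -> kap a = kap b.
  move=> ab; apply: kapE; rewrite -[a](subrK b) -addrA.
  exact: fiber_idealD.
have kapD a b : kap (a + b) = kap a + kap b.
  rewrite (kapE _ (fun i => co a i + co b i)); first by apply/rowP=> i; rewrite !mxE rmorphD.
  have -> : fiber_comb x (fun i => co a i + co b i) = fiber_comb x (co a) + fiber_comb x (co b).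
    by rewrite /fiber_comb -big_split; apply: eq_bigr => i _; rewrite rmorphD mulrDl.
  by rewrite opprD addrACA; exact: fiber_idealD.
have kapZ r a : kap (iota r * a) = pi r *: kap a.
  rewrite (kapE _ (fun i => r * co a i)); first by apply/rowP=> i; rewrite !mxE rmorphM.
  have -> : fiber_comb x (fun i => r * co a i) = iota r * fiber_comb x (co a).
    by rewrite /fiber_comb mulr_sumr; apply: eq_bigr => i _; rewrite rmorphM mulrA.
  by rewrite -mulrBr; exact: fiber_idealM.
have kap0 a : kap a = 0 -> fiber_ideal a.
  move=> a0; rewrite -[a](subrK (fiber_comb x (co a))); apply: fiber_idealD => //.
  apply: fiber_ideal_sum => i; rewrite mulrC; apply/fiber_idealM/fiber_ideal_iota.
  by have := congr1 (fun v : 'rV[k]_d => v 0 i) a0; rewrite !mxE.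
have kapB a b : kap (a - b) = kap a - kap b.
  by apply/eqP; rewrite eq_sym subr_eq -kapD subrK.
have kap00 : kap 0 = 0 by rewrite -(subrr (0 : S)) kapB subrr.
have kap_sum (I : finType) (F : I -> S) : kap (\sum_i F i) = \sum_i kap (F i).
  by apply: (big_morph kap kapD kap00).
have kap_surj (v : 'rV[k]_d) : exists a, kap a = v.
  have /choice[c cE] : forall i, exists r, pi r = v 0 i by move=> i; exact: pi_surj.
  exists (fiber_comb x c); rewrite (kapE _ c); last by rewrite subrr; exact: fiber_ideal0.
  by apply/rowP=> i; rewrite mxE cE.
have kapx i : kap (x i) = delta_mx 0 i.
  rewrite (kapE _ (fun j => (j == i)%:R)).
    by apply/rowP=> j; rewrite !mxE rmorph_nat eqxx.
  rewrite /fiber_comb (bigD1 i) //= eqxx rmorph1 mul1r big1 ?addr0 ?subrr.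
    exact: fiber_ideal0.
  by move=> j /negPf->; rewrite rmorph0 mul0r.
have kap_comb a : kap a = \sum_i pi (co a i) *: kap (x i).
  rewrite (kap_eq _ _ (coP a)) kap_sum; apply: eq_bigr => i _; exact: kapZ.
pose rho b : 'M[k]_d := \matrix_i kap (x i * b).
have kapM a b : kap (a * b) = kap a *m rho b.
  have -> : kap (a * b) = kap (fiber_comb x (co a) * b).
    by apply: kap_eq; rewrite -mulrBl mulrC; exact: fiber_idealM.
  rewrite (kap_comb a) /fiber_comb mulr_suml kap_sum mulmx_suml; apply: eq_bigr => i _.
  by rewrite -mulrA kapZ -scalemxAl kapx -rowE rowK.
have rhoM a b : rho (a * b) = rho a *m rho b.
  by apply/row_matrixP => i; rewrite row_mul !rowK mulrA kapM.
have rhoD a b : rho (a + b) = rho a + rho b.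
  by apply/row_matrixP => i; rewrite raddfD /= !rowK mulrDr kapD.
have rho1 : rho 1 = 1%:M.
  by apply/row_matrixP => i; rewrite !rowK mulr1 kapx rowE mulmx1.
have rhoiota r : rho (iota r) = (pi r)%:M.
  apply/row_matrixP => i; rewrite rowK mulrC kapZ kapx rowE mul_mx_scalar.
  by [].
case: d => [|d] in x xspan xfree co coP kap combB kapE kap_eq kapD kapZ kap0
  kapB kap00 kap_sum kap_surj kapx kap_comb rho kapM rhoM rhoD rho1 rhoiota *.
  exists 0%N, 1 => c' _; split=> [a|f _ []//|].
    by exists (fun=> 0); rewrite big_ord0 subr0; apply: kap0; exact: thinmx0.
  by exists 1; apply: kap0; exact: thinmx0.
pose M i := rho (x i); pose u := kap 1.
have Mcomm i j : M i *m M j = M j *m M i by rewrite -!rhoM mulrC.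
have Mcyc i : u *m M i = delta_mx 0 i by rewrite -kapM mul1r kapx.
have rhoP : [/\ rho 1 = 1%:M, forall a b, rho (a * b) = rho a *m rho b &
           forall a b, rho (a + b) = rho a + rho b] by [].
have rhoC a b : rho a *m rho b = rho b *m rho a by rewrite -!rhoM mulrC.
have unram X : (forall i j, let D := M i *m X - X *m M i in M j *m D = D *m M j) ->
  forall i, M i *m X = X *m M i.
  move=> Xcomm.
  have rhoE a : rho a = regular M (kap a).
    rewrite [LHS](commutant_regular Mcomm Mcyc); first by rewrite -kapM mul1r.
    by move=> i; exact: rhoC.
  pose D (a : S) : matrix_action rhoP := rho a *m X - X *m rho a.
  have DE a : D a = \sum_i kap a 0 i *: (M i *m X - X *m M i).
    rewrite /D rhoE mulmx_suml mulmx_sumr -sumrB; apply: eq_bigr => i _.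
    by rewrite -scalemxAl -scalemxAr scalerBr.
  have Dcomm a b : rho b *m D a = D a *m (rho b : 'M_d.+1).
    rewrite DE mulmx_sumr mulmx_suml; apply: eq_bigr => i _.
    rewrite -scalemxAr -scalemxAl; congr (_ *: _).
    rewrite rhoE mulmx_suml mulmx_sumr; apply: eq_bigr => j _.
    by rewrite -scalemxAl -scalemxAr Xcomm.
  have Dder : derivation iota D.
    split=> [a b|a b|a].
    - by rewrite /D rhoD mulmxDl mulmxDr opprD addrACA.
    - rewrite [a *: D b]matrix_actionE [b *: D a]matrix_actionE (Dcomm a b) /D rhoM.
      rewrite mulmxBr mulmxBl !mulmxA.
      move: (rho a *m rho b *m X) (rho a *m X *m rho b) (X *m rho a *m rho b).
      move=> Y Z W; have E : Y - W = (Y - Z) + (Z - W) by rewrite addrA subrK.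
      exact: E.
    - by rewrite /D rhoiota mul_scalar_mx mul_mx_scalar subrr.
  by move=> i; apply/eqP; rewrite -subr_eq0; apply/eqP; exact: (S_unram Dder (x i)).
have su : rho s \in unitmx.
  by have := mulmx1_unit (_ : rho s *m rho s1 = 1%:M); rewrite -rhoM ss1 => /(_ rho1)[].
have [c0 [Cu Vu]] := generator_exists k_inf Mcomm Mcyc unram (fun i => rhoC _ _) su.
have [c cE] := kap_surj c0; exists d.+1, c => c' cc'.
have rhoc' : rho c' = regular M c0.
  rewrite [LHS](commutant_regular Mcomm Mcyc); last by move=> i; exact: rhoC.
  by rewrite -kapM mul1r (kap_eq _ _ cc') cE.
pose th := c' ^+ 2 * s; pose V := \matrix_(i < d.+1) kap (th ^+ i).
have VU : V \in unitmx.
  move: Vu; congr (_ \in unitmx); apply/row_matrixP => i; rewrite !rowK.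
  rewrite -rhoc' -!rhoM -expr2 -/th.
  have -> : rho th ^+ i = rho (th ^+ i).
    elim: (nat_of_ord i) => [|j IH]; first by rewrite !expr0 rho1.
    by rewrite !exprS IH; exact: esym (rhoM th _).
  by rewrite -kapM mul1r.
have kapV (f : 'I_d.+1 -> R) : kap (\sum_i iota (f i) * th ^+ i) = (\row_i pi (f i)) *m V.
  rewrite kap_sum mulmx_sum_row; apply: eq_bigr => i _.
  by rewrite kapZ rowK mxE.
split=> [a|f fI i|].
- have /choice[f fE] : forall i, exists r, pi r = (kap a *m invmx V) 0 i.
    by move=> i; exact: pi_surj.
  exists f; apply: kap0; rewrite kapB kapV.
  rewrite (_ : \row_i _ = kap a *m invmx V) ?mulmxKV ?subrr //.
  by apply/rowP=> i; rewrite mxE fE.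
- have fV : (\row_i pi (f i)) *m V = 0.
    by rewrite -kapV -kap00; apply: kap_eq; rewrite subr0.
  have := congr1 (fun v => (v *m invmx V) 0 i) fV.
  by rewrite mulmxK // mul0mx !mxE.
- have [b bE] := kap_surj (u *m invmx (rho c')).
  exists b; apply: kap0; rewrite kapB mulrC kapM bE mulmxKV ?subrr //.
  by rewrite rhoc'.
Qed.
End Fiber.

(** * Power bases of finite etale algebras *)

(** The equational criterion: a linear relation [sum_i r_i x_i = 0] in a flat
    algebra comes from relations between the [r_i] over the base ring. *)
Section EquationalCriterion.
Variables (R : comNzRingType) (n : nat) (r : 'I_n -> R).

(** The ideal generated by the [r i]. *)
Definition span_pred : {pred R^o} := [pred x | `[< exists c, x = \sum_i c i * r i >]].

Lemma span_predP x : reflect (exists c, x = \sum_i c i * r i) (x \in span_pred).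
Proof. exact: asboolP. Qed.

Lemma span_pred_closed : submod_closed span_pred.
Proof.
split; first by apply/span_predP; exists (fun=> 0); rewrite big1 // => i _; rewrite mul0r.
move=> a _ _ /span_predP[c ->] /span_predP[c' ->]; apply/span_predP.
exists (fun i => a * c i + c' i); rewrite /= scaler_sumr -big_split.
by apply: eq_bigr => i _; rewrite mulrDl -mulrA.
Qed.

HB.instance Definition _ := GRing.isSubmodClosed.Build R R^o span_pred span_pred_closed.

(** The same ideal, as a module. *)
Record span_module := SpanModule { span_val :> R^o; span_valP : span_val \in span_pred }.

HB.instance Definition _ := [isSub for span_val].
HB.instance Definition _ := [Choice of span_module by <:].
HB.instance Definition _ := [SubChoice_isSubLmodule of span_module by <:].

Lemma span_module_coef (x : span_module) : exists c, span_val x = \sum_i c i * r i.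
Proof. exact/span_predP/span_valP. Qed.

Variables (S : comPzRingType) (iota : {rmorphism R -> S}).

Let coef x := projT1 (cid (span_module_coef x)).
Let coefE x : span_val x = \sum_i coef x i * r i := projT2 (cid (span_module_coef x)).

Let rel (c : 'I_n -> R) := \sum_i c i * r i = 0.

(* The submodule of [S ^ n] generated by the relations over [R]. *)
Let KS (z : 'I_n -> S) := exists l (c : 'I_l -> 'I_n -> R) (y : 'I_l -> S),
  (forall t, rel (c t)) /\ forall i, z i = \sum_t iota (c t i) * y t.

Let KS0 : KS (fun=> 0).
Proof.
exists 0%N, (fun _ _ => 0), (fun=> 0); split=> [[]//|i]; by rewrite big_ord0.
Qed.

Let KSD z z' : KS z -> KS z' -> KS (fun i => z i + z' i).
Proof.
move=> [l [c [y [cr zE]]]] [l' [c' [y' [cr' zE']]]].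
exists (l + l')%N, (fun t => match split t with inl t => c t | inr t => c' t end),
  (fun t => match split t with inl t => y t | inr t => y' t end).
split=> [t|i]; first by case: (split t).
rewrite big_split_ord zE zE' /=; congr (_ + _); apply: eq_bigr => t _.
  by rewrite (unsplitK (inl t)).
by rewrite (unsplitK (inr t)).
Qed.

Let KSM z s : KS z -> KS (fun i => s * z i).
Proof.
move=> [l [c [y [cr zE]]]]; exists l, c, (fun t => s * y t); split=> // i.
by rewrite zE mulr_sumr; apply: eq_bigr => t _; rewrite mulrCA.
Qed.

Let KS1 c s : rel c -> KS (fun i => iota (c i) * s).
Proof.
move=> cr; exists 1%N, (fun=> c), (fun=> s); split=> // i.
by rewrite big_ord1.
Qed.

Let KS_ext z z' : z =1 z' -> KS z -> KS z'.
Proof. by move=> /funext->. Qed.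

(* A lift to [S ^ n] of an element of the tensor product of the ideal with [S],
   well defined modulo [KS]. *)
Let lift_sum (t : seq (span_module * S)) i := \sum_(p <- t) iota (coef p.1 i) * p.2.

Let rel_sum (a : R) (x y z : span_module) :
  span_val x = a * span_val y + span_val z ->
  rel (fun i => coef x i - (a * coef y i + coef z i)).
Proof.
move=> E; rewrite /rel.
transitivity (span_val x - (a * span_val y + span_val z)); last by rewrite E subrr.
rewrite !coefE mulr_sumr -big_split -sumrB; apply: eq_bigr => i _ /=.
by rewrite mulrBl mulrDl mulrA.
Qed.

Lemma tensor_rel_lift t u : tensor_rel iota t u -> KS (fun i => lift_sum t i - lift_sum u i).
Proof.
elim=> {t u}.
- by move=> t; apply: KS_ext KS0 => i; rewrite subrr.
- move=> t u _ /(KSM (-1)); apply: KS_ext => i.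
  by rewrite mulN1r opprB.
- move=> t u w _ tu _ uw; apply: KS_ext (KSD tu uw) => i.
  by rewrite addrA subrK.
- move=> t t' u u' _ tt' _ uu'; apply: KS_ext (KSD tt' uu') => i.
  by rewrite /lift_sum !big_cat /= opprD addrACA.
- by move=> t u; apply: KS_ext KS0 => i; rewrite /lift_sum !big_cat /= addrC subrr.
- move=> s; apply: KS_ext (KS1 s (c := coef 0) _) => [i|].
    by rewrite /lift_sum big_seq1 big_nil subr0.
  by rewrite /rel -coefE.
- move=> v w s; have E : span_val (v + w) = 1 * span_val v + span_val w.
    by rewrite mul1r.
  apply: KS_ext (KS1 s (rel_sum E)) => i.
  rewrite /lift_sum big_seq1 !big_cons big_nil addr0 /=.
  by rewrite mul1r rmorphB rmorphD mulrBl mulrDl.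
- move=> v s s'; apply: KS_ext KS0 => i.
  by rewrite /lift_sum big_seq1 !big_cons big_nil addr0 /= mulrDr subrr.
- move=> a v s; have E : span_val (a *: v) = a * span_val v + span_val 0.
    by rewrite addr0.
  have E0 : rel (coef 0) by rewrite /rel -coefE.
  apply: KS_ext (KSD (KS1 s (rel_sum E)) (KS1 s E0)) => i.
  rewrite /lift_sum !big_seq1 /= rmorphB rmorphD rmorphM; ring.
Qed.

Lemma equational_criterion (x : 'I_n -> S) : flat iota ->
  \sum_i iota (r i) * x i = 0 ->
  exists l (c : 'I_l -> 'I_n -> R) (y : 'I_l -> S),
    (forall t, \sum_i c t i * r i = 0) /\ forall i, x i = \sum_t iota (c t i) * y t.
Proof.
move=> S_flat rx.
have rP i : r i \in span_pred.
  apply/span_predP; exists (fun j => (j == i)%:R).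
  by rewrite (bigD1 i) //= eqxx mul1r big1 ?addr0 // => j /negPf->; rewrite mul0r.
pose e i := SpanModule (rP i); pose t := [seq (e i, x i) | i <- enum 'I_n].
pose f : {linear span_module -> R^o} := (val : span_module -> R^o).
have tE : tensor_sum iota t = tensor_sum iota [::].
  apply: (S_flat _ _ f val_inj); rewrite !base_change_mapE -map_comp /=.
  rewrite !tensor_sumE big_nil big_map big_enum /=.
  rewrite (eq_bigr (fun i => (iota (r i) * x i) *: tens iota (1 : R^o) 1)).
    by rewrite -scaler_suml rx scale0r.
  move=> i _; rewrite -tensE; apply/tensor_sumP.
  by rewrite -{1}[r i]mulr1; exact: tensorZ.
have /tensor_sumP/tensor_rel_lift KSt := tE.
have KSe : KS (fun i => x i - lift_sum t i).
  exists n, (fun j i => (i == j)%:R - coef (e j) i), x; split=> [j|i].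
    rewrite /rel; transitivity (r j - span_val (e j)); last by rewrite subrr.
    rewrite coefE (eq_bigr (fun i => (i == j)%:R * r i - coef (e j) i * r i)).
      rewrite sumrB (bigD1 j) //= eqxx mul1r [X in _ + X - _]big1 ?addr0 //.
      by move=> i /negPf->; rewrite mul0r.
    by move=> i _; rewrite mulrBl.
  rewrite /lift_sum big_map big_enum /=.
  rewrite [RHS](eq_bigr (fun j => iota (i == j)%:R * x j - iota (coef (e j) i) * x j)).
    rewrite sumrB; congr (_ - _); rewrite (bigD1 i) //= eqxx rmorph1 mul1r.
    by rewrite big1 ?addr0 // => j; rewrite eq_sym => /negPf->; rewrite rmorph0 mul0r.
  by move=> j _; rewrite rmorphB mulrBl.
have [l [c [y [cr xE]]]] := KSD KSt KSe.
exists l, c, y; split=> // i; rewrite -xE /lift_sum big_nil subr0.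
by rewrite addrC subrK.
Qed.
End EquationalCriterion.

Section EtaleGenerator.
Variables (R : idomainType) (X : residue_system R).
Local Notation pi := (@res_proj R X).
Hypothesis res_inf : forall j (s : seq (@res_field R X j)), exists x, x \notin s.
Variables (S : comPzRingType) (iota : {rmorphism R -> S}).
Hypothesis S_etale : finite_etale iota.

(** A finite etale algebra is free with a power basis, whose generator can be
    chosen in the square class of any unit [s]. *)
Lemma etale_generator (s : S) : is_unit s ->
  exists n (c : S), let th := c ^+ 2 * s in
  [/\ is_unit c,
      forall a, exists f : 'I_n -> R, a = \sum_i iota (f i) * th ^+ i &
      forall f : 'I_n -> R, \sum_i iota (f i) * th ^+ i = 0 -> forall i, f i = 0].
Proof.
(* [n] is the largest degree of a fiber. The powers of [th] generate [S] by
   Nakayama's lemma. A relation between them has coefficients [f] that are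
   killed by a matrix [A], by the equational criterion; as [A] is the identity
   in the fiber [j0] of degree [n], its determinant is nonzero and [f = 0]. *)
have [S_fg S_flat S_unram] := S_etale; move=> sU.
have [N [g gP]] : exists N (g : 'I_N -> S), forall a, exists c : 'I_N -> R,
    a = \sum_i iota (c i) * g i by have [N [g gP]] := S_fg; exists N, g.
pose I j := @fiber_ideal R _ (pi j) S iota.
have gen j := fiber_generator (@res_surj R X j) (@res_inf j) S_fg S_unram sU.
pose d j := projT1 (cid (gen j)); pose cj j := projT1 (cid (projT2 (cid (gen j)))).
have cP j c' : I j (c' - cj j) ->
  [/\ forall a, exists f : 'I_(d j) -> R,
        I j (a - \sum_i iota (f i) * (c' ^+ 2 * s) ^+ i),
      forall f : 'I_(d j) -> R, I j (\sum_i iota (f i) * (c' ^+ 2 * s) ^+ i) ->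
        forall i, pi j (f i) = 0 &
      exists b, I j (1 - c' * b)].
  exact: (projT2 (cid (projT2 (cid (gen j)))) c').
pose c := \sum_j iota (@res_idem R X j) * cj j.
have {cP} cP j := cP j c.
have cI j : I j (c - cj j).
  rewrite /c (bigD1 j) //= addrAC; apply: fiber_idealD.
    have -> : iota (res_idem j) * cj j - cj j = cj j * iota (res_idem j - 1).
      by rewrite rmorphB rmorph1 mulrBr mulr1 mulrC.
    apply/fiber_idealM/fiber_ideal_iota.
    by rewrite rmorphB rmorph1 res_idemE eqxx subrr.
  apply: big_ind; [exact: fiber_ideal0|exact: fiber_idealD|].
  move=> i ij; rewrite mulrC; apply/fiber_idealM/fiber_ideal_iota.
  by rewrite res_idemE eq_sym (negPf ij).
have {cP} cP j := cP j (cI j).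
(* The system is not empty, as 0 would be a unit otherwise. *)
have [j0 dmax] : exists j0, forall j, (d j <= d j0)%N.
  have [j1|j0] := pickP (@predT 'I_(res_num X)).
    by move=> _; exists [arg max_(j > j1) d j]; case: arg_maxnP => // j _ jmax j'; exact: jmax.
  have : (0 : R) \is a GRing.unit by apply: (@res_unit R X) => j; have := j0 j.
  by rewrite unitr0.
pose th := c ^+ 2 * s; exists (d j0), c => /=; rewrite -/th.
have I_gen j a : I j a -> exists mu : 'I_N -> R, (forall l, pi j (mu l) = 0) /\
    a = \sum_l iota (mu l) * g l.
  move=> [t [/allP tP ->]].
  have /choice[co coE] := gP.
  exists (fun l => \sum_(p <- t) p.1 * co p.2 l); split=> [l|].
    rewrite rmorph_sum big_seq big1 // => p /tP /eqP p0.
    by rewrite rmorphM p0 mul0r.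
  transitivity (\sum_(p <- t) \sum_l iota (p.1 * co p.2 l) * g l).
    apply: eq_bigr => p _; rewrite {1}(coE p.2) mulr_sumr; apply: eq_bigr => l _.
    by rewrite rmorphM mulrA.
  rewrite exchange_big; apply: eq_bigr => l _.
  by rewrite rmorph_sum mulr_suml.
have nak (P : S -> Prop) : P 0 -> (forall a b, P a -> P b -> P (a + b)) ->
    (forall r a, P a -> P (iota r * a)) ->
    (forall j i, exists2 b, P b & I j (g i - b)) -> forall a, P a.
  move=> P0 PD PZ PI a; have Pg : forall i, P (g i).
    apply: (@nakayama R X (restrict iota) P N g P0 PD PZ) => j i.
    have [b Pb /I_gen[mu [mu0 muE]]] := PI j i; exists mu; split=> //.
    have H : g i - (\sum_l iota (mu l) * g l) = b by rewrite -muE opprB addrC subrK.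
    by move: Pb; rewrite -{1}H.
  have [co ->] := gP a.
  by apply: big_ind => // i _; exact: PZ.
have span a : exists f : 'I_(d j0) -> R, a = \sum_i iota (f i) * th ^+ i.
  apply: (nak (fun a => exists f : 'I_(d j0) -> R, a = \sum_i iota (f i) * th ^+ i)).
  - by exists (fun=> 0); rewrite big1 // => i _; rewrite rmorph0 mul0r.
  - move=> _ _ [f ->] [f' ->]; exists (fun i => f i + f' i).
    by rewrite -big_split; apply: eq_bigr => i _; rewrite rmorphD mulrDl.
  - move=> r _ [f ->]; exists (fun i => r * f i); rewrite mulr_sumr.
    by apply: eq_bigr => i _; rewrite rmorphM mulrA.
  - move=> j i; have [/(_ (g i))[f fI] _ _] := cP j.
    exists (\sum_i iota (f i) * th ^+ i) => //.
    pose F (m : nat) : R := if insub m is Some l then f l else 0.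
    exists F; rewrite -[RHS](big_mkord xpredT (fun m => iota (F m) * th ^+ m)).
    rewrite (big_cat_nat (leq0n _) (dmax j)) /= [X in _ + X]big_nat_cond.
    rewrite [X in _ + X]big1 ?addr0; last first.
      move=> m; rewrite andbT => /andP[jm _].
      by rewrite /F insubF ?rmorph0 ?mul0r // ltnNge jm.
    by rewrite big_mkord; apply: eq_bigr => l _; rewrite /F valK.
split=> //.
- have [b bE] : exists b, 1 = c * b.
    apply: (nak (fun a => exists b, a = c * b)).
    - by exists 0; rewrite mulr0.
    - by move=> _ _ [b ->] [b' ->]; exists (b + b'); rewrite mulrDr.
    - by move=> r _ [b ->]; exists (iota r * b); rewrite mulrCA.
    - move=> j i; have [_ _ [b bI]] := cP j; exists (c * (b * g i)); first by exists (b * g i).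
      have -> : g i - c * (b * g i) = g i * (1 - c * b) by ring.
      exact: fiber_idealM.
  by exists b.
move=> f f0 i.
have [l [a [y [af thE]]]] := equational_criterion S_flat f0.
have /choice[b bE] : forall t, exists b : 'I_(d j0) -> R, y t = \sum_i iota (b i) * th ^+ i.
  by move=> t; exact: span.
pose A : 'M[R]_(d j0) := \matrix_(i, m) \sum_t a t i * b t m.
have thA (m : 'I_(d j0)) : th ^+ m = \sum_i iota (A m i) * th ^+ i.
  rewrite thE; under eq_bigr => t _ do rewrite bE mulr_sumr.
  rewrite exchange_big; apply: eq_bigr => q _ /=.
  rewrite mxE rmorph_sum mulr_suml; apply: eq_bigr => t _.
  by rewrite rmorphM mulrA.
have fA : (\row_i f i) *m A = 0.
  apply/rowP=> m; rewrite !mxE; under eq_bigr => t _ do rewrite !mxE mulr_sumr.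
  rewrite exchange_big big1 // => t _ /=.
  rewrite (eq_bigr (fun q => b t m * (a t q * f q))); last by move=> q _; ring.
  by rewrite -mulr_sumr af mulr0.
have A1 : map_mx (pi j0) A = 1%:M.
  apply/matrixP=> m q; rewrite [LHS]mxE [RHS]mxE; apply/eqP; rewrite -subr_eq0.
  have [_ free _] := cP j0.
  have := free (fun q => A m q - (m == q)%:R) _ q; rewrite rmorphB rmorph_nat => -> //.
  suff -> : \sum_i iota (A m i - (m == i)%:R) * (c ^+ 2 * s) ^+ i = 0.
    exact: fiber_ideal0.
  rewrite (eq_bigr (fun i => iota (A m i) * th ^+ i - iota (m == i)%:R * th ^+ i)).
    rewrite sumrB -thA (bigD1 m) //= eqxx rmorph1 mul1r big1 ?addr0 ?subrr //.
    by move=> i' mi; rewrite eq_sym (negPf mi) rmorph0 mul0r.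
  by move=> i' _; rewrite rmorphB mulrBl.
have detA : \det A != 0.
  apply: contra_eq_neq A1 => det0; apply/eqP => /(congr1 (fun B => \det B)).
  by rewrite det_map_mx det0 det1 => /eqP; rewrite [pi j0 0](rmorph0 (pi j0)) eq_sym oner_eq0.
have : (\row_i f i) *m A *m \adj A = 0 by rewrite fA mul0mx.
rewrite -mulmxA mul_mx_adj mul_mx_scalar => /(congr1 (fun v : 'rV[R]_(d j0) => v 0 i)).
by rewrite !mxE => /eqP; rewrite mulf_eq0 (negPf detA) => /eqP.
Qed.
End EtaleGenerator.

(** * Norms *)

Lemma det_1D_mulC (R : comNzRingType) m n (A : 'M[R]_(m, n)) (B : 'M[R]_(n, m)) :
  \det (1%:M + A *m B) = \det (1%:M + B *m A).
Proof.
pose U := block_mx 1%:M A (- B) 1%:M; pose W := block_mx 1%:M (- A) 0 1%:M.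
have detW : \det W = 1 by rewrite det_ublock !det1 mulr1.
have WU : \det (W *m U) = \det (1%:M + A *m B).
  rewrite mulmx_block !mul1mx !mul0mx !mulmx1 !mulNmx mulmxN opprK subrr !add0r.
  by rewrite det_lblock det1 mulr1.
have UW : \det (U *m W) = \det (1%:M + B *m A).
  rewrite mulmx_block !mul1mx !mulmx0 !mulmx1 !mulNmx mulmxN opprK addNr addr0.
  by rewrite det_lblock det1 mul1r addrC.
by rewrite -WU -UW !det_mulmx mulrC.
Qed.

Lemma det_companion (R : comNzRingType) n (F : 'M[R]_n) (p : {poly R}) :
  p \is monic -> size p = n.+1 ->
  (forall i j : 'I_n, F i j = if i == n.-1 :> nat then - p`_j else (i.+1 == j)%:R) ->
  \det F = (-1) ^+ n * p.[0].
Proof.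
move=> pm sp; have E : (size p).-1 = n by rewrite sp.
case: n / E F {sp} => F FE.
have -> : F = companionmx p by apply/matrixP=> i j; rewrite FE mxE.
have := char_poly_det (companionmx p); rewrite companionmxK // horner_coef0 => ->.
by rewrite mulrA -exprD addnn -signr_odd odd_double mul1r.
Qed.

Section NormBasis.
Variables (R : comNzRingType) (S : comPzRingType) (iota : {rmorphism R -> S}).
Variables (n : nat) (b : 'I_n -> S).
Hypothesis b_span : forall a, exists f : 'I_n -> R, a = \sum_i iota (f i) * b i.
Hypothesis b_free : forall f : 'I_n -> R, \sum_i iota (f i) * b i = 0 -> forall i, f i = 0.

(** The coordinates of [a] in the basis [b]. *)
Definition basis_coord (i : 'I_n) (a : restrict iota) : R^o := projT1 (cid (b_span a)) i.

Lemma basis_coordE a : a = \sum_i iota (basis_coord i a) * b i.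
Proof. exact: (projT2 (cid (b_span a))). Qed.

Lemma basis_coord_uniq a f : a = \sum_i iota (f i) * b i ->
  forall i, basis_coord i a = f i.
Proof.
move=> aE i; apply/eqP; rewrite -subr_eq0; apply/eqP.
apply: (b_free (f := fun i => basis_coord i a - f i)).
rewrite (eq_bigr (fun j => iota (basis_coord j a) * b j - iota (f j) * b j)).
  by rewrite sumrB -basis_coordE -aE subrr.
by move=> j _; rewrite rmorphB mulrBl.
Qed.

Lemma basis_coord_linear i : linear (basis_coord i).
Proof.
move=> r x y; apply: (basis_coord_uniq (f := fun i => r * basis_coord i x + basis_coord i y)).
rewrite -[r *: x]/(iota r * (x : S)) {1}(basis_coordE x) {1}(basis_coordE y).
rewrite mulr_sumr -big_split; apply: eq_bigr => j _ /=.
by rewrite rmorphD rmorphM mulrDl mulrA.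
Qed.

HB.instance Definition _ i := GRing.isLinear.Build R (restrict iota) R^o _ (basis_coord i)
  (basis_coord_linear i).

(** The matrix of the multiplication by [s], acting on rows of coordinates. *)
Definition mult_mx (s : S) : 'M[R]_n := \matrix_(i, j) basis_coord j (s * b i).

Lemma mult_mxM s t : mult_mx (s * t) = mult_mx s *m mult_mx t.
Proof.
apply/matrixP=> i j; rewrite !mxE.
apply: (basis_coord_uniq (f := fun j => \sum_l mult_mx s i l * mult_mx t l j)).
rewrite -mulrA [t * _]mulrC mulrA {1}(basis_coordE (s * b i)) mulr_suml.
transitivity (\sum_l \sum_j iota (mult_mx s i l * mult_mx t l j) * b j).
  apply: eq_bigr => l _; rewrite -mulrA [b l * t]mulrC {1}(basis_coordE (t * b l)) mulr_sumr.
  by apply: eq_bigr => m _; rewrite rmorphM mulrA !mxE.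
rewrite exchange_big; apply: eq_bigr => m _; by rewrite rmorph_sum mulr_suml.
Qed.

(** Any two matrices that describe the multiplication by [s], one of them in the
    basis [b], are related by [det_1D_mulC]. *)
Lemma norm_det s : norm iota s = \det (mult_mx s).
Proof.
pose f (x : restrict iota) : restrict iota := s * (x : S).
have det_uniq d : is_det f d -> d = \det (mult_mx s).
  move=> [m [e [phi [eP ->]]]].
  pose E := \matrix_(i < m, j < n) basis_coord j (e i).
  pose Phi := \matrix_(i < n, j < m) phi j (b i).
  have PhiE : Phi *m E = 1%:M.
    apply/matrixP=> i j; rewrite !mxE -(basis_coord_uniq (f := fun j => (i == j)%:R) (a := b i)).
      rewrite [in RHS](eP (b i)) linear_sum /=; apply: eq_bigr => l _.
      by rewrite !mxE linearZ.
    rewrite (bigD1 i) //= eqxx rmorph1 mul1r big1 ?addr0 // => l.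
    by rewrite eq_sym => /negPf->; rewrite rmorph0 mul0r.
  have -> : \matrix_(i, j) phi j (f (e i) - e i) = E *m ((mult_mx s - 1%:M) *m Phi).
    apply/matrixP=> i j; rewrite !mxE.
    have -> : f (e i) - e i = \sum_l basis_coord l (e i) *: (f (b l) - b l : restrict iota).
      have fB : f (e i) = \sum_l basis_coord l (e i) *: f (b l).
        rewrite /f {1}(basis_coordE (e i)) mulr_sumr; apply: eq_bigr => l _.
        exact: mulrCA.
      have eB : e i = \sum_l basis_coord l (e i) *: (b l : restrict iota).
        exact: basis_coordE.
      rewrite fB {2}eB -sumrB; apply: eq_bigr => l _.
      by rewrite scalerBr.
    rewrite linear_sum; apply: eq_bigr => l _ /=; rewrite linearZ /= mxE; congr (_ * _).
    have -> : f (b l) - b l = \sum_q (mult_mx s - 1%:M) l q *: (b q : restrict iota).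
      have fB : f (b l) = \sum_q mult_mx s l q *: (b q : restrict iota).
        rewrite /f {1}(basis_coordE (s * b l)); apply: eq_bigr => q _.
        by rewrite mxE.
      rewrite fB [RHS](eq_bigr (fun q => mult_mx s l q *: (b q : restrict iota)
          - (l == q)%:R *: (b q : restrict iota))); last first.
        move=> q _; rewrite -scalerBl; congr (_ *: _); by rewrite !mxE.
      rewrite sumrB; congr (_ - _); rewrite (bigD1 l) //= eqxx scale1r big1 ?addr0 //.
      by move=> q; rewrite eq_sym => /negPf->; rewrite scale0r.
    rewrite linear_sum mxE; apply: eq_bigr => q _ /=.
    by rewrite linearZ /=; congr (_ * _); rewrite mxE.
  by rewrite det_1D_mulC -mulmxA PhiE mulmx1 addrC subrK.
apply: det_uniq; apply: (xgetPex 0 (P := is_det f)).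
exists (\det (mult_mx s)), n, b.
exists (fun i => basis_coord i : {scalar restrict iota}); split; first exact: basis_coordE.
congr (\det _); apply/matrixP=> i j; rewrite !mxE linearB /=.
rewrite (basis_coord_uniq (f := fun j => (i == j)%:R) (a := b i)).
  by rewrite addrC subrK.
rewrite (bigD1 i) //= eqxx rmorph1 mul1r big1 ?addr0 // => l.
by rewrite eq_sym => /negPf->; rewrite rmorph0 mul0r.
Qed.
End NormBasis.

(** * Quadratic forms and base change *)

Section Evaluation.
Variables (R : comNzRingType) (S : comPzRingType) (iota : {rmorphism R -> S}) (th : S).

(** The value at [th] of a polynomial over [R]; the algebra [S] is allowed to be
    zero. *)
Definition eval_poly (f : {poly R}) : S := \sum_(i < size f) iota f`_i * th ^+ i.

Lemma eval_polyE m (f : {poly R}) : (size f <= m)%N ->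
  eval_poly f = \sum_(i < m) iota f`_i * th ^+ i.
Proof.
move=> fm; rewrite /eval_poly -!(big_mkord xpredT (fun i => iota f`_i * th ^+ i)).
rewrite (big_cat_nat (leq0n _) fm) /= [X in _ = _ + X]big_nat_cond.
rewrite [X in _ = _ + X]big1 ?addr0 // => i /andP[/andP[fi _] _].
by rewrite nth_default // rmorph0 mul0r.
Qed.

Lemma eval_polyD f g : eval_poly (f + g) = eval_poly f + eval_poly g.
Proof.
pose m := maxn (size f) (size g).
rewrite (@eval_polyE m (f + g)) ?size_polyD // (@eval_polyE m f) ?leq_maxl //.
rewrite (@eval_polyE m g) ?leq_maxr // -big_split; apply: eq_bigr => i _.
by rewrite coefD rmorphD mulrDl.
Qed.

Lemma eval_polyZ a f : eval_poly (a *: f) = iota a * eval_poly f.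
Proof.
rewrite (eval_polyE (size_scale_leq a f)) mulr_sumr; apply: eq_bigr => i _.
by rewrite coefZ rmorphM mulrA.
Qed.

Lemma eval_polyC a : eval_poly a%:P = iota a.
Proof.
by rewrite (@eval_polyE 1) ?size_polyC_leq1 // big_ord1 coefC expr0 mulr1.
Qed.

Lemma eval_polyMX f : eval_poly (f * 'X) = eval_poly f * th.
Proof.
rewrite (@eval_polyE (size f).+1); last first.
  by rewrite (leq_trans (size_polyMleq _ _)) // size_polyX addn2.
rewrite big_ord_recl coefMX rmorph0 mul0r add0r mulr_suml.
by apply: eq_bigr => i _; rewrite coefMX exprSr mulrA.
Qed.

Lemma eval_polyM f g : eval_poly (f * g) = eval_poly f * eval_poly g.
Proof.
elim/poly_ind: f => [|f a IH]; first by rewrite mul0r -polyC0 eval_polyC rmorph0 mul0r.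
rewrite mulrDl eval_polyD mulrAC eval_polyMX IH mul_polyC eval_polyZ.
by rewrite eval_polyD eval_polyMX eval_polyC mulrDl mulrAC.
Qed.

Lemma eval_polyX : eval_poly 'X = th.
Proof. by rewrite -[X in eval_poly X]mul1r eval_polyMX -polyC1 eval_polyC rmorph1 mul1r. Qed.

Lemma eval_polyB f g : eval_poly (f - g) = eval_poly f - eval_poly g.
Proof. by rewrite -scaleN1r eval_polyD eval_polyZ rmorphN1 mulN1r. Qed.

Lemma eval_poly_sum (I : finType) (F : I -> {poly R}) :
  eval_poly (\sum_i F i) = \sum_i eval_poly (F i).
Proof.
by apply: (big_morph eval_poly eval_polyD); rewrite -polyC0 eval_polyC rmorph0.
Qed.
End Evaluation.

Section ValueGroup.
Variables (R : comPzRingType) (V : lmodType R) (q : V -> R).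

Lemma is_unitM (a b : R) : is_unit a -> is_unit b -> is_unit (a * b).
Proof.
by move=> [a' aa'] [b' bb']; exists (a' * b'); rewrite mulrACA aa' bb' mulr1.
Qed.

Lemma Dq_subgroup : unit_subgroup (Dq q).
Proof.
have U : unit_subgroup (@is_unit R).
  split=> // [|a b|a b _ ab]; [by exists 1; rewrite mulr1|exact: is_unitM|].
  by exists a; rewrite mulrC.
split.
- by move=> a aD; apply: (aD _); split=> // b [].
- by move=> A [[_ A1 _ _] _].
- move=> a b aD bD A [AU Aq]; have [_ _ AM _] := AU; apply: AM.
    exact: (aD A (conj AU Aq)).
  exact: (bD A (conj AU Aq)).
- move=> a b aD ab A [AU Aq]; have [_ _ _ AV] := AU; apply: AV ab.
  exact: (aD A (conj AU Aq)).
Qed.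

Lemma Dq_value v : is_unit (q v) -> Dq q (q v).
Proof. by move=> qU A [_ Aq]; apply: Aq; split=> //; exists v. Qed.

Hypothesis qP : quadratic_form q.

Lemma polarC v w : polar q v w = polar q w v.
Proof. by rewrite /polar [w + v]addrC addrAC. Qed.

Lemma polarDr v u w : polar q v (u + w) = polar q v u + polar q v w.
Proof. by rewrite -[u]scale1r qP.2 mul1r !scale1r. Qed.

Lemma polar0r v : polar q v 0 = 0.
Proof. by apply: (addIr (polar q v 0)); rewrite -polarDr !add0r. Qed.

Lemma polarZr v a w : polar q v (a *: w) = a * polar q v w.
Proof. by rewrite -[a *: w]addr0 qP.2 polar0r addr0. Qed.

Lemma polar_sumr (I : Type) (t : seq I) (F : I -> V) v :
  polar q v (\sum_(i <- t) F i) = \sum_(i <- t) polar q v (F i).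
Proof. by apply: (big_morph _ (polarDr v) (polar0r v)). Qed.

Lemma polar_suml (I : Type) (t : seq I) (F : I -> V) v :
  polar q (\sum_(i <- t) F i) v = \sum_(i <- t) polar q (F i) v.
Proof. by rewrite polarC polar_sumr; apply: eq_bigr => i _; exact: polarC. Qed.

Lemma polarZl v a w : polar q (a *: v) w = a * polar q v w.
Proof. by rewrite polarC polarZr polarC. Qed.

Lemma polar_diag v : polar q v v = 2%:R * q v.
Proof.
rewrite /polar -mulr2n -scaler_nat qP.1 -addrA -opprD -mulr2n -[q v *+ 2]mulr_natl -mulrBl.
by congr (_ * _); ring.
Qed.
End ValueGroup.

Lemma base_change_polar_tens (R S : comPzRingType) (iota : {rmorphism R -> S})
    (V : lmodType R) (q : V -> R) (qP : quadratic_form q) v w :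
  polar (base_change_form iota q) (tens iota v 1) (tens iota w 1) = iota (polar q v w).
Proof.
have tD : tens iota v 1 + tens iota w 1 = tens iota (v + w) 1.
  by rewrite /tens -tensor_sum_cat; apply/tensor_sumP/tensor_sym/tensorDl.
by rewrite /polar tD !base_change_form_tens // !rmorphB.
Qed.

(** * The norm principle *)

Lemma gform_sum (L : comNzRingType) N (G : 'M[L]_N) (x y : 'rV[L]_N) :
  gform G x y = \sum_l \sum_m x 0 l * y 0 m * G l m.
Proof.
rewrite /gform mxE exchange_big /=; apply: eq_bigr => m _.
by rewrite mxE mulr_suml; apply: eq_bigr => l _; rewrite mxE mulrAC.
Qed.

Section NormPrinciple.
Variables (R : idomainType) (X : residue_system R).
Local Notation pi := (@res_proj R X).
Hypothesis res_inf : forall j (s : seq (@res_field R X j)), exists x, x \notin s.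
Hypothesis res_two : forall j, (2%:R : @res_field R X j) != 0.
Variables (S : comPzRingType) (iota : {rmorphism R -> S}).
Hypothesis S_etale : finite_etale iota.
Variables (V : lmodType R) (q : V -> R).
Hypothesis qP : quadratic_form q.

Let twoU : (2%:R : R) \is a GRing.unit.
Proof. by apply: (@res_unit R X) => j; rewrite [X in X != 0](rmorph_nat (pi j)) res_two. Qed.

(** If [th] generates [S], a value of [q] over [S] is the value at [th] of a
    polynomial [pform G w w], where [G] is the Gram matrix of half the polar
    form at the vectors that occur in the tensor [t]. *)
Lemma gram_value n (th : S) (t : seq (V * S)) :
  (forall a, exists f : 'I_n -> R, a = \sum_i iota (f i) * th ^+ i) ->
  exists N (G : 'M[R]_N) (w : 'rV[{poly R}]_N) (v : 'I_N -> V),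
    [/\ G^T = G, forall x, gform G x x = q (\sum_i x 0 i *: v i) &
        eval_poly iota th (pform G w w) = base_change_form iota q (tensor_sum iota t)].
Proof.
move=> span; pose N := size t; pose p l := nth (0, 0) t l.
pose v (l : 'I_N) := (p l).1; pose s (l : 'I_N) := (p l).2.
have /choice[w wE] : forall l, exists f : {poly R}, eval_poly iota th f = s l.
  move=> l; have [f ->] := span (s l).
  exists (\sum_i (f i) *: 'X^i); rewrite eval_poly_sum; apply: eq_bigr => i _.
  rewrite eval_polyZ; congr (_ * _).
  elim: (nat_of_ord i) => [|m IH]; first by rewrite !expr0 -polyC1 eval_polyC rmorph1.
  by rewrite !exprSr eval_polyMX IH.
pose G : 'M[R]_N := \matrix_(l, m) (2%:R^-1 * polar q (v l) (v m)).
have Gsym : G^T = G by apply/matrixP=> l m; rewrite !mxE polarC.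
have half (T : comPzRingType) (f : {rmorphism R -> T}) (x : T) : f 2%:R^-1 * (2%:R * x) = x.
  by rewrite mulrA -(rmorph_nat f) -rmorphM mulVr // rmorph1 mul1r.
exists N, G, (\row_l w l), v; split=> // [x|].
  rewrite -[RHS](half R idfun) /= -polar_diag // polar_suml // mulr_sumr gform_sum.
  apply: eq_bigr => l _; rewrite polar_sumr // mulr_sumr; apply: eq_bigr => m _.
  by rewrite polarZl // polarZr // !mxE; ring.
have qSP := base_change_form_quadratic iota qP.
rewrite -[RHS](half S iota) -(polar_diag qSP) gform_sum eval_poly_sum.
have tE : tensor_sum iota t = \sum_l s l *: tens iota (v l) 1.
  rewrite tensor_sumE (big_nth (0, 0)) big_mkord; apply: eq_bigr => l _.
  by rewrite -tensE.
rewrite tE (polar_suml qSP) mulr_sumr; apply: eq_bigr => l _.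
rewrite eval_poly_sum (polar_sumr qSP) mulr_sumr; apply: eq_bigr => m _.
rewrite (polarZl qSP) (polarZr qSP) base_change_polar_tens //.
rewrite !mxE !eval_polyM !wE eval_polyC rmorphM; ring.
Qed.

(** The norm principle for a value [th] of [q] that has a power basis. Its
    minimal polynomial [p] is read off from the expression of [th ^+ n] in this
    basis. *)
Lemma norm_value n (th : S) (t : seq (V * S)) :
  (forall a, exists f : 'I_n -> R, a = \sum_i iota (f i) * th ^+ i) ->
  (forall f : 'I_n -> R, \sum_i iota (f i) * th ^+ i = 0 -> forall i, f i = 0) ->
  is_unit th -> base_change_form iota q (tensor_sum iota t) = th ->
  Dq q (norm iota th) /\ ((0 < n)%N -> exists v, q v \is a GRing.unit).
Proof.
move=> span free [th' thth'] qth.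
have [N [G [w [v [Gsym GE evG]]]]] := gram_value t span.
have [a aE] := span (th ^+ n).
pose ap : {poly R} := \poly_(i < n) (if insub i is Some l then a l else 0).
pose p : {poly R} := 'X^n - ap.
have sa : (size ap < size ('X^n : {poly R}))%N by rewrite size_polyXn ltnS size_poly.
have sp : size p = n.+1 by rewrite size_polyDl ?size_polyN // size_polyXn.
have pm : p \is monic by rewrite monicE lead_coefDl ?size_polyN // lead_coefXn.
have evX m : eval_poly iota th 'X^m = th ^+ m.
  elim: m => [|m IH]; first by rewrite !expr0 -polyC1 eval_polyC rmorph1.
  by rewrite !exprSr eval_polyMX IH.
have evp : eval_poly iota th p = 0.
  rewrite eval_polyB evX (@eval_polyE _ _ _ _ n) ?size_poly // aE -sumrB big1 // => i _.
  by rewrite coef_poly ltn_ord valK subrr.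
have dvd (f : {poly R}) : eval_poly iota th f = 0 -> exists h, f = h * p.
  rewrite {1}(rdivp_eq pm f) eval_polyD eval_polyM evp mulr0 add0r => f0.
  exists (rdivp f p); rewrite {1}(rdivp_eq pm f).
  suff -> : rmodp f p = 0 by rewrite addr0.
  have sr : (size (rmodp f p) <= n)%N.
    by rewrite -ltnS -sp ltn_rmodpN0 // monic_neq0.
  rewrite (eval_polyE _ _ sr) in f0; apply/polyP=> i; rewrite coef0.
  have [lt|ge] := ltnP i n; last by rewrite nth_default // (leq_trans sr).
  exact: (free _ f0 (Ordinal lt)).
have [h hE] : exists h, pform G w w - 'X = h * p.
  by apply: dvd; rewrite eval_polyB evG qth eval_polyX subrr.
have Qw : pform G w w = 'X + h * p by rewrite -hE addrC subrK.
have p0 : p.[0] \is a GRing.unit.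
  have [g gE] := span th'.
  have [c cE] : exists c, 'X * (\sum_i (g i) *: 'X^i) - 1 = c * p.
    apply: dvd; rewrite eval_polyB eval_polyM eval_polyX -polyC1 eval_polyC rmorph1.
    rewrite eval_poly_sum (eq_bigr (fun i => iota (g i) * th ^+ i)).
      by rewrite -gE thth' subrr.
    by move=> i _; rewrite eval_polyZ evX.
  have := congr1 (fun f : {poly R} => f.[0]) cE.
  rewrite hornerD hornerN !hornerM hornerX mul0r hornerC sub0r => E.
  by apply/unitrPr; exists (- c.[0]); rewrite mulrN mulrC -E opprK.
have normth : norm iota th = (-1) ^+ n * p.[0].
  rewrite (norm_det span free); apply: det_companion => // i j.
  have n0 : (0 < n)%N by apply: leq_ltn_trans (ltn_ord i).
  have -> : - p`_j = a j.
    by rewrite coefB coefXn coef_poly ltn_ord valK ltn_eqF // sub0r opprK.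
  rewrite mxE; apply: (basis_coord_uniq span free (f := fun j =>
    if i == n.-1 :> nat then a j else (i.+1 == j)%:R)).
  rewrite -exprS; have [iE|ne] := eqVneq (i : nat) n.-1; first by rewrite iE prednK.
  have lt : (i.+1 < n)%N.
    by move/eqP: ne; have := ltn_ord i; lia.
  rewrite (bigD1 (Ordinal lt)) //= eqxx rmorph1 mul1r big1 ?addr0 // => l ne'.
  case: eqP => [E|_]; last by rewrite rmorph0 mul0r.
  by case/eqP: ne'; apply: val_inj; rewrite /= E.
split.
  rewrite normth.
  apply: (norm_principle_monogenic res_inf res_two Gsym (Dq_subgroup q) _ pm sp p0 Qw).
  by move=> x; rewrite GE; exact: Dq_value.
move=> n0; have := monogenic_represents_unit res_inf res_two Gsym pm _ p0 Qw.
move=> /(_ n.-1); rewrite sp prednK // => /(_ erefl)[x xU].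
by exists (\sum_i x 0 i *: v i); rewrite -GE.
Qed.
End NormPrinciple.

Section SemilocalNormPrinciple.
Variables (R : idomainType) (X : residue_system R).
Hypothesis res_inf : forall j (s : seq (@res_field R X j)), exists x, x \notin s.
Hypothesis res_two : forall j, (2%:R : @res_field R X j) != 0.
Variables (S : comPzRingType) (iota : {rmorphism R -> S}).
Hypothesis S_etale : finite_etale iota.

Lemma norm_monoid_morphism :
  norm iota 1 = 1 /\ forall s t, norm iota (s * t) = norm iota s * norm iota t.
Proof.
have [n [c /=[_ span free]]] : exists n (c : S), let th := c ^+ 2 * 1 in
  [/\ is_unit c,
      forall a, exists f : 'I_n -> R, a = \sum_i iota (f i) * th ^+ i &
      forall f : 'I_n -> R, \sum_i iota (f i) * th ^+ i = 0 -> forall i, f i = 0].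
  by apply: (etale_generator res_inf S_etale); exists 1; rewrite mulr1.
split=> [|s t]; rewrite !(norm_det span free); last first.
  by rewrite (mult_mxM span free) det_mulmx.
rewrite (_ : mult_mx span 1 = 1%:M) ?det1 //; apply/matrixP=> i j; rewrite !mxE mul1r.
apply: (basis_coord_uniq span free (f := fun j => (i == j)%:R)).
rewrite (bigD1 i) //= eqxx rmorph1 mul1r big1 ?addr0 // => l.
by rewrite eq_sym => /negPf->; rewrite rmorph0 mul0r.
Qed.

Lemma norm_unit s : is_unit s -> is_unit (norm iota s).
Proof.
have [N1 NM] := norm_monoid_morphism.
by move=> [t st]; exists (norm iota t); rewrite -NM st.
Qed.

Variables (V : lmodType R) (q : V -> R).
Hypothesis qP : quadratic_form q.

(** The norm principle for a single value. *)
Lemma norm_base_change_value (v : base_change iota V) :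
  is_unit (base_change_form iota q v) -> Dq q (norm iota (base_change_form iota q v)).
Proof.
move=> sU; set s := base_change_form iota q v in sU *.
have [N1 NM] := norm_monoid_morphism.
have [n [c /=[cU span free]]] := etale_generator res_inf S_etale sU.
have [D_unit D1 DM DV] := Dq_subgroup q.
have cvE : base_change_form iota q (tensor_sum iota (repr (c *: v))) = c ^+ 2 * s.
  by rewrite /tensor_sum reprK (base_change_form_quadratic iota qP).1.
have thU : is_unit (c ^+ 2 * s) by apply: is_unitM => //; exact: is_unitM.
have [Dth val] := norm_value res_inf res_two qP span free thU cvE.
have [n0|/val[w wU]] := posnP n.
  suff -> : norm iota s = 1 by [].
  by subst n; rewrite (norm_det span free) det_mx00.
have [r nr] := norm_unit cU.
have rwD : Dq q (norm iota c ^+ 2 * q w).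
  rewrite -qP.1; apply: Dq_value; rewrite qP.1.
  by apply: is_unitM; [apply: is_unitM; exact: norm_unit|exact/is_unitP].
have wD := Dq_value ((is_unitP _).2 wU).
(* The square of [norm c] is a quotient of two values of [q]. *)
have wVD : Dq q (q w)^-1 by apply: DV wD _; rewrite mulrV.
have sqD : Dq q (norm iota c ^+ 2) by rewrite -[_ ^+ 2](mulrK wU); exact: DM.
have sqVD : Dq q (r ^+ 2) by apply: DV sqD _; rewrite -exprMn nr expr1n.
have <- : r ^+ 2 * norm iota (c ^+ 2 * s) = norm iota s.
  by rewrite !NM mulrA -expr2 -exprMn [r * _]mulrC nr expr1n mul1r.
exact: DM.
Qed.

Lemma norm_principle : norm iota @` Dq (base_change_form iota q) `<=` Dq q.
Proof.
have [N1 NM] := norm_monoid_morphism; have [D_unit D1 DM DV] := Dq_subgroup q.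
move=> _ [s sD <-].
have [] : is_unit s /\ Dq q (norm iota s); last by [].
apply: (sD [set a | is_unit a /\ Dq q (norm iota a)]); split.
  split=> [a []//|||].
  - by split; [exists 1; rewrite mulr1|rewrite N1].
  - by move=> a b [aU aD] [bU bD]; split; [exact: is_unitM|rewrite NM; exact: DM].
  - move=> a b [aU aD] ab; split; first by exists a; rewrite mulrC.
    by apply: DV aD _; rewrite -NM ab.
by move=> a [aU [v vE]]; split=> //; move: aU; rewrite -vE; exact: norm_base_change_value.
Qed.
End SemilocalNormPrinciple.

Theorem theorem3p2 (R : idomainType) (S : comPzRingType)
    (iota : {rmorphism R -> S}) (V : lmodType R) (q : V -> R) (m : nat) :
  noetherian R -> semilocal R ->
  (forall I : idealr R, maximal_ideal I ->
     infinite_set [set: {ideal_quot I}] /\ 2%N \notin [pchar {ideal_quot I}]) ->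
  finite_etale iota ->
  quadratic_space q -> has_rank V m ->
  norm iota @` Dq (base_change_form iota q) `<=` Dq q.
Proof.
move=> _ semi res S_etale [_ _ qP _] _.
pose P (K : fieldType) := (forall s : seq K, exists x, x \notin s) /\ (2%:R : K) != 0.
have [X XP] : exists X : residue_system R, forall j, P (@res_field R X j).
  apply: (semilocal_residue_system (P := P)) semi _ => I Imax.
  have [inf two] := res I Imax; split=> [s|]; last first.
    by move: two; rewrite inE.
  apply: contrapT => no; apply: inf.
  apply: (sub_finite_set _ (finite_seq (s : seq {ideal_quot I}))) => x _ /=.
  by apply: contrapT => /negP xs; apply: no; exists x.
exact: (norm_principle (X := X) (fun j => (XP j).1) (fun j => (XP j).2) S_etale qP).
Qed.
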